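(* Let $q$ be a real number with $0<|q|<1$ and let $(\Omega,d)$ be Woronowicz's three-dimensional $*$-differential calculus over the Hopf $*$-algebra $\mathcal{A}_q$ of $SU_q(2)$, with the left-invariant inner product on $\Omega$ for which $1,\ \eta_1,\eta_2,\eta_3,\ q^{-7}\eta_1\eta_2,\ q\,\eta_2\eta_3,\ -q^{-6}\eta_3\eta_1,\ \eta_1\eta_2\eta_3$ is an orthonormal basis of $\Omega^{\mathrm{inv}}$. Let $\nabla=(d+d^* )^2$ be the Laplacian. For $M=1,2,3,\dots$, $M=2m+1$, $p\in\{-m,-m+1,\dots,m\}$ and $k\in\{-m-1,-m,\dots,m+1\}$ let $\mathcal{E}_1(M,p,k)$ be the linear span of $W^M_{p,k+1}\eta_1$, $W^M_{pk}\eta_2$, $W^M_{p,k-1}\eta_3$, where $W^M_{p,j}=0$ for $|j|>m$. Then $\Omega_1$ is the orthogonal direct sum of the spaces $\mathcal{E}_1(M,p,k)$, each of them is invariant under $\nabla$, each has dimension $1$, $2$ or $3$, and the eigenvalues of $\nabla$ on $\mathcal{E}_1(M,p,k)$ are as follows. Case 1: $\dim\mathcal{E}_1(M,p,k)=1$. If $M>1$, the eigenvalue is $q^{14}\lambda_k^2$ if $k=-m-1$ and $q^6\lambda_k^2$ if $k=m+1$. If $M=1$, the eigenvalues on $\mathcal{E}_1(1,0,-1)$, $\mathcal{E}_1(1,0,0)$ and $\mathcal{E}_1(1,0,1)$ are $q^{18}(1+q^2)^2$, $q^{10}$ and $q^2(1+q^2)^2$, respectively. Case 2: $\dim\mathcal{E}_1(M,p,k)=2$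 (that is, $M>1$ and $k=\pm m$). The eigenvalues are $\nu_k$ and $(q^5-q^7\lambda_k)^2$ if $k=-m$, and $\nu_k$ and $(q^5+q^3\lambda_k)^2$ if $k=m$. Case 3: $\dim\mathcal{E}_1(M,p,k)=3$ (that is, $-m+1\le k\le m-1$). The eigenvalues are $\nu_k$, $(\mu_k^+)^2$ and $(\mu_k^-)^2$, where $$\mu_k^\pm=\tfrac12\Bigl(B_k\pm\sqrt{B_k^2-4C_k}\Bigr),\qquad B_k=(q^3-q^7)\lambda_k+q^5,\qquad C_k=-q^{10}\nu_k.$$ Moreover, $\nabla W^M_{pk}=\nu_kW^M_{pk}$ for all $M$ and all $p,k\in\{-m,\dots,m\}$, which determines the eigenvalues of $\nabla$ on $\Omega_0=\mathcal{A}_q$; the eigenvalues of $\nabla$ on $\Omega_2$ are the same as those on $\Omega_1$, and the eigenvalues of $\nabla$ on $\Omega_3$ are the same as those on $\Omega_0$. Here, for each $M=2m+1$, $$\lambda_k=\frac{q^2}{1-q^2}(q^{-4k}-1),\qquad c_k=\frac{q}{1-q^2}\bigl[(q^{-2k}-q^{2m})(q^{-2m}-q^{-2(k-1)})\bigr]^{1/2}\ (-m\le k\le m),\quad c_{m+1}=0,$$ $$\nu_k=c_{k+1}^2+\lambda_k^2+q^2c_k^2\quad(-m\le k\le m).$$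
   Context: $\mathcal{A}_q$ is the universal unital $*$-algebra generated by $\alpha,\gamma$ with $\alpha^*\alpha+\gamma^*\gamma=1$, $\alpha\alpha^*+q^2\gamma\gamma^*=1$, $\gamma\gamma^*=\gamma^*\gamma$, $\alpha\gamma=q\gamma\alpha$, $\alpha\gamma^*=q\gamma^*\alpha$, with $\Delta(\alpha)=\alpha\otimes\alpha-q\gamma^*\otimes\gamma$, $\Delta(\gamma)=\gamma\otimes\alpha+\alpha^*\otimes\gamma$; $h$ is its (positive, faithful) Haar integral. For a linear functional $\chi$ on $\mathcal{A}_q$, $\chi*a=(\mathrm{id}\otimes\chi)\Delta(a)$. The calculus: $\Omega=\bigoplus_{k=0}^3\Omega_k$ is a graded algebra with $\Omega_0=\mathcal{A}_q$, generated by $\mathcal{A}_q$ and $1$-forms $\eta_1,\eta_2,\eta_3$; as left $\mathcal{A}_q$-modules, $\Omega_1,\Omega_2,\Omega_3$ are free with bases $\{\eta_1,\eta_2,\eta_3\}$, $\{\eta_1\eta_2,\eta_2\eta_3,\eta_3\eta_1\}$, $\{\eta_1\eta_2\eta_3\}$. Relations: $\eta_r^2=0$, $\eta_2\eta_1=-q^4\eta_1\eta_2$, $\eta_3\eta_2=-q^4\eta_2\eta_3$, $\eta_1\eta_3=-q^{-2}\eta_3\eta_1$; $\eta_r\alpha=q^{-\varepsilon_r}\alpha\eta_r$, $\eta_r\gamma=q^{-\varepsilon_r}\gamma\eta_r$, $\eta_r\alpha^*=q^{\varepsilon_r}\alpha^*\eta_r$, $\eta_r\gamma^*=q^{\varepsilon_r}\gamma^*\eta_r$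 with $\varepsilon_1=\varepsilon_3=1$, $\varepsilon_2=2$. The graded involution satisfies $(\omega_1\omega_2)^*=(-1)^{kl}\omega_2^*\omega_1^*$ for $\omega_1\in\Omega_k$, $\omega_2\in\Omega_l$, and $\eta_1^*=q\eta_3$, $\eta_2^*=-\eta_2$, $\eta_3^*=q^{-1}\eta_1$. The differential $d$ is the degree-one graded derivation ($d(\omega'\omega)=d(\omega')\omega+(-1)^k\omega'd\omega$ for $\omega'\in\Omega_k$) with $d^2=0$, $d(\omega^* )=(d\omega)^*$ and $$d\alpha=\alpha\eta_2-q^2\gamma^*\eta_3,\quad d\gamma=\gamma\eta_2+q\alpha^*\eta_3,\quad d\alpha^*=-q^2\alpha^*\eta_2-\gamma\eta_1,\quad d\gamma^*=-q^2\gamma^*\eta_2+q^{-1}\alpha\eta_1,$$ $$d\eta_1=q^2(1+q^2)\eta_1\eta_2,\quad d\eta_2=q\eta_1\eta_3,\quad d\eta_3=q^2(1+q^2)\eta_2\eta_3.$$ The space $\Omega^{\mathrm{inv}}$ of left-invariant forms is the span of $1,\eta_1,\eta_2,\eta_3,\eta_1\eta_2,\eta_2\eta_3,\eta_3\eta_1,\eta_1\eta_2\eta_3$, and $\Omega\cong\mathcal{A}_q\otimes\Omega^{\mathrm{inv}}$ via $a\otimes\omega\mapsto a\omega$. An inner product on $\Omega$ (linear in the first variable) is left-invariant if $(a\omega\mid b\eta)=h(b^*a)(\omega\mid\eta)$ for $a,b\in\mathcal{A}_q$, $\omega,\eta\in\Omega^{\mathrm{inv}}$. The operator $d$ has an adjoint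 $d^*$ on $\Omega$ for this inner product. There are unique linear functionals $\chi_1,\chi_2,\chi_3$ on $\mathcal{A}_q$ with $da=\sum_{r=1}^3(\chi_r*a)\eta_r$ for $a\in\mathcal{A}_q$. For $M=2m+1\ge1$, $W^M=(W^M_{pk})_{p,k=-m,\dots,m}$ is the $M$-dimensional irreducible (invertible, not necessarily unitary) representation of $SU_q(2)$ constructed by Woronowicz, with matrix elements taken in a basis adapted to the infinitesimal generators: $\Delta(W^M_{pk})=\sum_iW^M_{pi}\otimes W^M_{ik}$ and $$\chi_1(W^M_{ik})=-c_{k+1}\delta_{i,k+1},\qquad\chi_2(W^M_{ik})=\lambda_k\delta_{ik},\qquad\chi_3(W^M_{ik})=q\,c_k\,\delta_{i,k-1}.$$ The elements $W^M_{pk}$ ($M\ge1$, $-m\le p,k\le m$) form a linear basis of $\mathcal{A}_q$. All indices $p,k$ run in integer steps (they are integers or half-integers according to $m$), and $c_k$, $\nu_k$ depend on $m$ as well as on $k$. *)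

(* Defs.v *)
From HB Require Import structures.
From mathcomp Require Import all_boot all_order all_algebra.
From mathcomp Require Import classical_sets reals complex.

Set Implicit Arguments.
Unset Strict Implicit.
Unset Printing Implicit Defensive.

Import Order.TTheory GRing.Theory Num.Theory.
Local Open Scope classical_set_scope.
Local Open Scope ring_scope.

Notation "x %:C" := (real_complex _ x) : ring_scope.

(** ** Linear algebra in possibly infinite-dimensional spaces *)

Definition lin_span (F : fieldType) (V : lmodType F) (s : seq V) : set V :=
  [set v | exists c : nat -> F, v = \sum_(i < size s) c i *: s`_i].

Definition has_dim (F : fieldType) (V : lmodType F) (E : set V) (n : nat) : Prop :=
  exists b : 'I_n -> V,
    (forall c : 'I_n -> F, \sum_i c i *: b i = 0 -> forall i, c i = 0) /\
    (forall v, E v <-> exists c : 'I_n -> F, v = \sum_i c i *: b i).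

(* The family [(v t)], [t] ranging over the indices that satisfy [P], is a
   linear basis of the whole space. *)
Definition linear_basis (F : fieldType) (V : lmodType F) (I : eqType)
    (P : pred I) (v : I -> V) : Prop :=
  (forall (s : seq I) (c : I -> F), uniq s -> all P s ->
     \sum_(t <- s) c t *: v t = 0 -> forall t, t \in s -> c t = 0) /\
  (forall x : V, exists (s : seq I) (c : I -> F),
     [/\ uniq s, all P s & x = \sum_(t <- s) c t *: v t]).

Definition eigenspace_on (F : fieldType) (V : lmodType F) (f : V -> V)
    (E : set V) (z : F) : set V :=
  [set v | E v /\ f v = z *: v].

Definition eigenvalue_on (F : fieldType) (V : lmodType F) (f : V -> V)
    (E : set V) (z : F) : Prop :=
  exists2 v, eigenspace_on f E z v & v != 0.

(* [s] lists the eigenvalues of [f] on [E], each repeated according to its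
   geometric multiplicity; scalars not in [s] have eigenspace 0. *)
Definition eigenvalues_are (F : fieldType) (V : lmodType F) (f : V -> V)
    (E : set V) (s : seq F) : Prop :=
  forall z, has_dim (eigenspace_on f E z) (count_mem z s).

Definition bilinear_map (F : fieldType) (U V W : lmodType F)
    (B : U -> V -> W) : Prop :=
  (forall y, linear (fun x => B x y)) /\ (forall x, linear (B x)).

(** ** Inner products (linear in the first variable) *)

Definition inner_product (C : numClosedFieldType) (V : lmodType C)
    (ip : V -> V -> C) : Prop :=
  [/\ forall (a : C) u v w, ip (a *: u + v) w = a * ip u w + ip v w,
      forall u v, ip v u = (ip u v)^* &
      forall v, v != 0 -> 0 < ip v v].

Definition orthonormal_basis (C : numClosedFieldType) (V : lmodType C)
    (ip : V -> V -> C) (s : seq V) (E : set V) : Prop :=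
  E = lin_span s /\
  forall i j : nat, (i < size s)%N -> (j < size s)%N ->
    ip s`_i s`_j = (i == j)%:R.

Definition is_adjoint (C : numClosedFieldType) (V : lmodType C)
    (ip : V -> V -> C) (f g : V -> V) : Prop :=
  forall u v, ip (f u) v = ip u (g v).

(* [F] is the orthogonal direct sum of the subspaces [E t], [P t]. *)
Definition orthogonal_direct_sum (C : numClosedFieldType) (V : lmodType C)
    (ip : V -> V -> C) (I : eqType) (P : pred I) (E : I -> set V)
    (F : set V) : Prop :=
  [/\ forall t, P t -> E t `<=` F,
      forall t u, P t -> P u -> t != u ->
        forall v w, E t v -> E u w -> ip v w = 0,
      forall v, F v -> exists (s : seq I) (e : I -> V),
        [/\ uniq s, all P s, forall t, t \in s -> E t (e t) &
            v = \sum_(t <- s) e t] &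
      forall (s : seq I) (e : I -> V), uniq s -> all P s ->
        (forall t, t \in s -> E t (e t)) -> \sum_(t <- s) e t = 0 ->
        forall t, t \in s -> e t = 0].

(** ** Unital *-algebras and the algebraic tensor square *)

Record starAlg (C : numClosedFieldType) := StarAlg {
  starAlg_sort :> algType C;
  adj : starAlg_sort -> starAlg_sort;
  adj_antilinear : forall (c : C) x y, adj (c *: x + y) = c^* *: adj x + adj y;
  adjM : forall x y, adj (x * y) = adj y * adj x;
  adjK : involutive adj
}.

Definition star_morphism (C : numClosedFieldType) (A B : starAlg C)
    (f : A -> B) : Prop :=
  forall x, f (adj x) = adj (f x).

(* A model of the *-algebra [A (x) A]; [tlift B] is the linear map induced by
   a bilinear map [B] through the universal property, and is unspecified when
   [B] is not bilinear. *)
Record tensorSquare (C : numClosedFieldType) (A : starAlg C) := TensorSquare {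
  tensorSquare_sort :> starAlg C;
  tens : A -> A -> tensorSquare_sort;
  tlift : forall V : lmodType C, (A -> A -> V) -> tensorSquare_sort -> V;
  tens_bilinear : bilinear_map tens;
  tensM : forall a b c d, tens a b * tens c d = tens (a * c) (b * d);
  tens1 : tens 1 1 = 1;
  tens_adj : forall a b, adj (tens a b) = tens (adj a) (adj b);
  tlift_linear : forall (V : lmodType C) (B : A -> A -> V),
    bilinear_map B -> linear (tlift B);
  tliftE : forall (V : lmodType C) (B : A -> A -> V),
    bilinear_map B -> forall a b, tlift B (tens a b) = B a b;
  tlift_uniq : forall (V : lmodType C) (f g : {linear tensorSquare_sort -> V}),
    (forall a b, f (tens a b) = g (tens a b)) -> f =1 g
}.

(** ** The Hopf *-algebra of SU_q(2) *)

Definition SUq2_relations (R : realType) (q : R) (B : starAlg R[i])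
    (a c : B) : Prop :=
  [/\ adj a * a + adj c * c = 1,
      a * adj a + (q%:C ^+ 2) *: (c * adj c) = 1,
      c * adj c = adj c * c,
      a * c = q%:C *: (c * a) &
      a * adj c = q%:C *: (adj c * a)].

Definition is_SUq2 (R : realType) (q : R) (A : starAlg R[i])
    (alpha gamma : A) : Prop :=
  SUq2_relations q alpha gamma /\
  forall (B : starAlg R[i]) (a c : B), SUq2_relations q a c ->
    exists f : {lrmorphism A -> B},
      [/\ star_morphism f, f alpha = a, f gamma = c &
          forall g : {lrmorphism A -> B},
            star_morphism g -> g alpha = a -> g gamma = c -> g =1 f].

Definition is_comult (R : realType) (q : R) (A : starAlg R[i])
    (alpha gamma : A) (T : tensorSquare A) (Delta : {lrmorphism A -> T}) : Prop :=
  [/\ star_morphism Delta,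
      Delta alpha = tens T alpha alpha - q%:C *: tens T (adj gamma) gamma &
      Delta gamma = tens T gamma alpha + tens T (adj alpha) gamma].

Definition slice_right (C : numClosedFieldType) (A : starAlg C)
    (T : tensorSquare A) (chi : A -> C) : T -> A :=
  tlift (fun x y => chi y *: (x : A)).

Definition slice_left (C : numClosedFieldType) (A : starAlg C)
    (T : tensorSquare A) (chi : A -> C) : T -> A :=
  tlift (fun x y => chi x *: (y : A)).

Definition convol (C : numClosedFieldType) (A : starAlg C)
    (T : tensorSquare A) (Delta : A -> T) (chi : A -> C) (a : A) : A :=
  slice_right chi (Delta a).

Definition is_haar (C : numClosedFieldType) (A : starAlg C)
    (T : tensorSquare A) (Delta : A -> T) (h : A -> C) : Prop :=
  [/\ h 1 = 1,
      forall a, slice_right h (Delta a) = (h a)%:A,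
      forall a, slice_left h (Delta a) = (h a)%:A,
      forall a, 0 <= h (adj a * a) &
      forall a, h (adj a * a) = 0 -> a = 0].

(** ** The three-dimensional calculus *)

Section Forms.

Variables (R : realType) (A : starAlg R[i]) (Om : algType R[i]).
Variables (incl : {lrmorphism A -> Om}) (eta1 eta2 eta3 : Om).

Definition inv_basis (k : nat) : seq Om :=
  match k with
  | 0 => [:: 1]
  | 1 => [:: eta1; eta2; eta3]
  | 2 => [:: eta1 * eta2; eta2 * eta3; eta3 * eta1]
  | 3 => [:: eta1 * eta2 * eta3]
  | _ => [::]
  end.

Definition inv_basis_all : seq Om :=
  inv_basis 0 ++ inv_basis 1 ++ inv_basis 2 ++ inv_basis 3.

Definition module_span (s : seq Om) : set Om :=
  [set w | exists a : nat -> A, w = \sum_(i < size s) incl (a i) * s`_i].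

Definition homogeneous (k : nat) : set Om := module_span (inv_basis k).

(* [eta a = t^-1 a eta] for the generators, and [eta a^* = t a^* eta]. *)
Definition commutation (t : R[i]) (eta : Om) (alpha gamma : A) : Prop :=
  [/\ eta * incl alpha = t^-1 *: (incl alpha * eta),
      eta * incl gamma = t^-1 *: (incl gamma * eta),
      eta * incl (adj alpha) = t *: (incl (adj alpha) * eta) &
      eta * incl (adj gamma) = t *: (incl (adj gamma) * eta)].

(* [Om] is the algebra of forms: a free left [A]-module on the eight listed
   left-invariant forms, subject to the quadratic relations. *)
Definition forms_axioms (q : R[i]) (alpha gamma : A) : Prop :=
  [/\ (forall a : nat -> A,
         \sum_(i < size inv_basis_all) incl (a i) * inv_basis_all`_i = 0 ->
         forall i, (i < size inv_basis_all)%N -> a i = 0),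
      (forall w, module_span inv_basis_all w),
      [/\ eta1 ^+ 2 = 0, eta2 ^+ 2 = 0 & eta3 ^+ 2 = 0],
      [/\ eta2 * eta1 = - q ^+ 4 *: (eta1 * eta2),
          eta3 * eta2 = - q ^+ 4 *: (eta2 * eta3) &
          eta1 * eta3 = - q ^- 2 *: (eta3 * eta1)] &
      [/\ commutation q eta1 alpha gamma,
          commutation (q ^+ 2) eta2 alpha gamma &
          commutation q eta3 alpha gamma]].

Definition graded_involution (q : R[i]) (st : Om -> Om) : Prop :=
  [/\ forall (c : R[i]) v w, st (c *: v + w) = c^* *: st v + st w,
      involutive st,
      forall a, st (incl a) = incl (adj a),
      (forall k l v w, homogeneous k v -> homogeneous l w ->
         st (v * w) = (-1) ^+ (k * l) *: (st w * st v)) &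
      [/\ st eta1 = q *: eta3, st eta2 = - eta2 & st eta3 = q^-1 *: eta1]].

Definition differential_axioms (q : R[i]) (alpha gamma : A)
    (st : Om -> Om) (d : {linear Om -> Om}) : Prop :=
  [/\ (forall k w, homogeneous k w -> homogeneous k.+1 (d w)),
      (forall k v w, homogeneous k v ->
         d (v * w) = d v * w + (-1) ^+ k *: (v * d w)),
      (forall w, d (d w) = 0) /\ (forall w, d (st w) = st (d w)),
      [/\ d (incl alpha) =
            incl alpha * eta2 - q ^+ 2 *: (incl (adj gamma) * eta3),
          d (incl gamma) =
            incl gamma * eta2 + q *: (incl (adj alpha) * eta3),
          d (incl (adj alpha)) =
            - q ^+ 2 *: (incl (adj alpha) * eta2) - incl gamma * eta1 &
          d (incl (adj gamma)) =
            - q ^+ 2 *: (incl (adj gamma) * eta2) +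
            q^-1 *: (incl alpha * eta1)] &
      [/\ d eta1 = (q ^+ 2 * (1 + q ^+ 2)) *: (eta1 * eta2),
          d eta2 = q *: (eta1 * eta3) &
          d eta3 = (q ^+ 2 * (1 + q ^+ 2)) *: (eta2 * eta3)]].

End Forms.

Record calculus3D (R : realType) (q : R) (A : starAlg R[i])
    (alpha gamma : A) := Calculus3D {
  forms :> algType R[i];
  incl : {lrmorphism A -> forms};
  eta1 : forms;
  eta2 : forms;
  eta3 : forms;
  form_star : forms -> forms;
  diff : {linear forms -> forms};
  calculus_forms : forms_axioms incl eta1 eta2 eta3 q%:C alpha gamma;
  calculus_star : graded_involution incl eta1 eta2 eta3 q%:C form_star;
  calculus_diff :
    differential_axioms incl eta1 eta2 eta3 q%:C alpha gamma form_star diff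
}.

Section Calculus.

Variables (R : realType) (q : R) (A : starAlg R[i]) (alpha gamma : A).
Variable (Om : calculus3D q alpha gamma).

Definition Omega_ (k : nat) : set Om :=
  homogeneous (incl Om) (eta1 Om) (eta2 Om) (eta3 Om) k.

Definition Omega_inv : set Om :=
  lin_span (inv_basis_all (eta1 Om) (eta2 Om) (eta3 Om)).

Definition left_invariant (h : A -> R[i]) (ip : Om -> Om -> R[i]) : Prop :=
  forall (a b : A) (v w : Om), Omega_inv v -> Omega_inv w ->
    ip (incl Om a * v) (incl Om b * w) = h (adj b * a) * ip v w.

Definition orthonormal_forms : seq Om :=
  let e1 := eta1 Om in let e2 := eta2 Om in let e3 := eta3 Om in
  let Q := q%:C in
  [:: 1; e1; e2; e3; Q ^- 7 *: (e1 * e2); Q *: (e2 * e3);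
      - Q ^- 6 *: (e3 * e1); e1 * e2 * e3].

Definition laplacian (dstar : Om -> Om) (w : Om) : Om :=
  let D v := diff Om v + dstar v in D (D w).

Definition generators (T : tensorSquare A) (Delta : A -> T)
    (chi1 chi2 chi3 : A -> R[i]) : Prop :=
  forall a : A,
    diff Om (incl Om a) = incl Om (convol Delta chi1 a) * eta1 Om
                        + incl Om (convol Delta chi2 a) * eta2 Om
                        + incl Om (convol Delta chi3 a) * eta3 Om.

End Calculus.

Arguments Omega_ {R q A alpha gamma} Om k _.
Arguments Omega_inv {R q A alpha gamma} Om _.
Arguments laplacian {R q A alpha gamma} Om dstar w.

(** ** The irreducible representations [W^M]

   The indices [p], [k] are integers or half-integers.  Such an index [k] is
   represented by the integer [K = 2k]; thus [k + 1] becomes [K + 2], and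
   [2m] is [M - 1].  The index range [-m - 1, ..., m + 1] attached to [M] is
   the range [-m, ..., m] attached to [M + 2]. *)

(* The list [-m, -m + 1, ..., m], doubled. *)
Definition idx (M : nat) : seq int :=
  [seq (2 * i)%:Z - M.-1%:Z | i <- iota 0 M].

Definition lam (R : realType) (q : R) (K : int) : R :=
  q ^+ 2 / (1 - q ^+ 2) * (q ^ (- (2 * K)) - 1).

Definition cc (R : realType) (q : R) (M : nat) (K : int) : R :=
  if K \in idx M then
    q / (1 - q ^+ 2) *
    Num.sqrt ((q ^ (- K) - q ^ M.-1%:Z) *
              (q ^ (- M.-1%:Z) - q ^ (- (K - 2))))
  else 0.

Definition nu (R : realType) (q : R) (M : nat) (K : int) : R :=
  cc q M (K + 2) ^+ 2 + lam q K ^+ 2 + q ^+ 2 * cc q M K ^+ 2.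

Definition Bk (R : realType) (q : R) (K : int) : R :=
  (q ^+ 3 - q ^+ 7) * lam q K + q ^+ 5.

Definition Ck (R : realType) (q : R) (M : nat) (K : int) : R :=
  - q ^+ 10 * nu q M K.

Definition mu_plus (R : realType) (q : R) (M : nat) (K : int) : R :=
  2^-1 * (Bk q K + Num.sqrt (Bk q K ^+ 2 - 4 * Ck q M K)).

Definition mu_minus (R : realType) (q : R) (M : nat) (K : int) : R :=
  2^-1 * (Bk q K - Num.sqrt (Bk q K ^+ 2 - 4 * Ck q M K)).

Definition W_index (t : nat * int * int) : bool :=
  [&& (0 < t.1.1)%N, t.1.2 \in idx t.1.1 & t.2 \in idx t.1.1].

(* The values of [W M p k] for [p] or [k] outside of [idx M] are irrelevant.
   Irreducibility of each [W^M] is part of the last clause: the entries of a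
   matrix representation with a nontrivial invariant subspace are linearly
   dependent. *)
Definition is_woronowicz_reps (R : realType) (q : R) (A : starAlg R[i])
    (T : tensorSquare A) (Delta : A -> T) (chi1 chi2 chi3 : A -> R[i])
    (W : nat -> int -> int -> A) : Prop :=
  [/\ (forall M p k, W_index (M, p, k) ->
         Delta (W M p k) = \sum_(i <- idx M) tens T (W M p i) (W M i k)),
      (forall M, (0 < M)%N -> exists V : int -> int -> A,
         forall p k, p \in idx M -> k \in idx M ->
           \sum_(i <- idx M) W M p i * V i k = (p == k)%:R /\
           \sum_(i <- idx M) V p i * W M i k = (p == k)%:R),
      (forall M i k, W_index (M, i, k) ->
         [/\ chi1 (W M i k) = (if i == k + 2 then - cc q M (k + 2) else 0)%:C,
             chi2 (W M i k) = (if i == k then lam q k else 0)%:C &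
             chi3 (W M i k) = (if i == k - 2 then q * cc q M k else 0)%:C]) &
      linear_basis W_index (fun t => W t.1.1 t.1.2 t.2)].

Definition W0 (R : realType) (A : starAlg R[i]) (W : nat -> int -> int -> A)
    (M : nat) (p k : int) : A :=
  if k \in idx M then W M p k else 0.

Definition E1_index (t : nat * int * int) : bool :=
  [&& (0 < t.1.1)%N, t.1.2 \in idx t.1.1 & t.2 \in idx t.1.1.+2].

Definition E1 (R : realType) (q : R) (A : starAlg R[i]) (alpha gamma : A)
    (Om : calculus3D q alpha gamma) (W : nat -> int -> int -> A)
    (M : nat) (p k : int) : set Om :=
  lin_span [:: incl Om (W0 W M p (k + 2)) * eta1 Om;
               incl Om (W0 W M p k) * eta2 Om;
               incl Om (W0 W M p (k - 2)) * eta3 Om].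

Arguments E1 {R q A alpha gamma} Om W M p k _.

(* Main.v *)
(* Write d a = sum_r X_r(a) eta_r.  The twisted Leibniz rule, the *-structure and the
   invariance of the Haar integral h under the twists eta_r a = f_r(a) eta_r give, for the
   form <a, b> = h(b^* a), that X_2 is symmetric and X_1, -q^-1 X_3 are mutually adjoint.
   In orthonormal coordinates d is D = (X_1, X_2, X_3)^T on functions, a symmetric operator
   L on 1-forms and -D^* on 2-forms, so the Laplacian is D^* D, D D^* + L^2, D D^* + L^2,
   D^* D in degrees 0 to 3.  On E_1(M,p,k) both D and L act by scalars: L becomes a
   tridiagonal 3x3 matrix whose kernel contains the gradient D W_pk, of eigenvalue nu_k,
   and whose other eigenvalues mu satisfy mu^2 - B_k mu + C_k = 0; the Laplacian is mu^2 on
   the corresponding eigenvectors.  The matrix elements W_pk are orthogonal because lambda_k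
   and nu_k separate k and M, and a character of A_q separates p. *)
Require Import Defs.
From HB Require Import structures.
From mathcomp Require Import all_boot all_order all_algebra.
From mathcomp Require Import boolp classical_sets reals complex ring lra zify.
Set Implicit Arguments.
Unset Strict Implicit.
Unset Printing Implicit Defensive.
Import Order.TTheory GRing.Theory Num.Theory.
Local Open Scope ring_scope.

(** Two obstacles shape the proof. The [W^M] need not be unitary, so their orthogonality is not read
    off from Schur's relations but from operators symmetric for <a, b>. And the Laplacian itself
    need not separate the eigenvectors: B_k vanishes for special q, for instance k = -1 and q^2 +
    q^4 = 1, and then mu_k^+ and mu_k^- have the same square. Orthogonality of eigenvectors is
    therefore never deduced from distinct eigenvalues of the Laplacian. A form killed by the
    codifferential is orthogonal to every gradient, and two such forms in one E_1(M,p,k) with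
    distinct mu are orthogonal because L is symmetric. Nonzero orthogonal eigenvectors, as many as
    the dimension, then give every multiplicity, whatever coincidences occur. The powers of q in the
    orthonormal 2-forms absorb those of the quadratic relations and so make L symmetric; the factor
    -q^-1 between X_1 and X_3 goes back to eta_1^* = q eta_3. *)

Section UnbundledLinear.
Variables (K : pzRingType) (U V : lmodType K) (f : U -> V).
Hypothesis f_linear : linear f.

(** Tensor lifts, slices, convolutions and the Laplacian are bare functions with a separate proof of
    linearity, so the usual rules are derived for such functions. *)
Lemma linear_D : {morph f : x y / x + y}.
Proof. by move=> x y; have := f_linear 1 x y; rewrite !scale1r. Qed.

Lemma linear_0 : f 0 = 0.
Proof. by apply: (addrI (f 0)); rewrite -linear_D !addr0. Qed.

Lemma linear_Z c x : f (c *: x) = c *: f x.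
Proof. by have := f_linear c x 0; rewrite linear_0 !addr0. Qed.

Lemma sum_of_linear (I : Type) (s : seq I) (F : I -> U) :
  f (\sum_(k <- s) F k) = \sum_(k <- s) f (F k).
Proof. by elim/big_rec2: _ => [|k y x _ <-]; rewrite ?linear_0 ?linear_D. Qed.

End UnbundledLinear.

(** * Generators of the quantum group algebra *)

Section StarAlgebra.
Variables (C : numClosedFieldType) (A : starAlg C).
Implicit Types x y : A.

Lemma adj_0 : adj (0 : A) = 0.
Proof.
have := adj_antilinear (-1) (0 : A) 0.
by rewrite scaler0 addr0 rmorphN1 scaleN1r addNr.
Qed.

Lemma adj_D x y : adj (x + y) = adj x + adj y.
Proof. by rewrite -[x in LHS]scale1r adj_antilinear conjC1 scale1r. Qed.

Lemma adj_Z (c : C) x : adj (c *: x) = c^* *: adj x.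
Proof. by rewrite -[X in adj X]addr0 adj_antilinear adj_0 addr0. Qed.

Lemma adj_N x : adj (- x) = - adj x.
Proof. by rewrite -scaleN1r adj_Z rmorphN1 scaleN1r. Qed.

Lemma adj_sum (I : Type) (s : seq I) (F : I -> A) :
  adj (\sum_(i <- s) F i) = \sum_(i <- s) adj (F i).
Proof.
elim: s => [|i s IH]; first by rewrite !big_nil adj_0.
by rewrite !big_cons adj_D IH.
Qed.

Lemma adj_1 : adj (1 : A) = 1.
Proof.
have e : adj (adj (1 : A) * 1) = adj 1 by rewrite adjM adjK mulr1.
by rewrite mulr1 adjK in e.
Qed.

End StarAlgebra.

(** * Star-subalgebras and induction on the generators *)

Section Subalgebra.
Variables (C : numClosedFieldType) (A : starAlg C) (P : A -> Prop).
Hypotheses (P_1 : P 1) (P_lin : forall c x y, P x -> P y -> P (c *: x + y)).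
Hypotheses (P_mul : forall x y, P x -> P y -> P (x * y)).
Hypotheses (P_adj : forall x, P x -> P (adj x)).

(** A classical boolean form of [P], from which the subtype and its algebra structure can be
    built. *)
Definition in_subalg : {pred A} := fun x => `[< P x >].

Lemma in_subalg_closed : subalg_closed in_subalg.
Proof.
split; first exact/asboolP.
- by move=> c x y /asboolP Px /asboolP Py; apply/asboolP/P_lin.
- by move=> x y /asboolP Px /asboolP Py; apply/asboolP/P_mul.
Qed.

HB.instance Definition _ := GRing.isSubalgClosed.Build C A in_subalg in_subalg_closed.

Record subalg := Subalg { subalg_val : A; subalg_valP : subalg_val \in in_subalg }.
HB.instance Definition _ := [isSub for subalg_val].
HB.instance Definition _ := [Choice of subalg by <:].
HB.instance Definition _ := [SubChoice_isSubAlgebra of subalg by <:].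

Lemma subalg_adjP (x : subalg) : adj (val x) \in in_subalg.
Proof. by case: x => x /= /asboolP Px; apply/asboolP/P_adj. Qed.

Definition subalg_adj (x : subalg) : subalg := Subalg (subalg_adjP x).

Lemma subalg_adj_antilinear (c : C) (x y : subalg) :
  subalg_adj (c *: x + y) = c^* *: subalg_adj x + subalg_adj y.
Proof. by apply: val_inj; rewrite /= adj_antilinear. Qed.

Lemma subalg_adjM (x y : subalg) :
  subalg_adj (x * y) = subalg_adj y * subalg_adj x.
Proof. by apply: val_inj; rewrite /= adjM. Qed.

Lemma subalg_adjK : involutive subalg_adj.
Proof. by move=> x; apply: val_inj; rewrite /= adjK. Qed.

Definition sub_starAlg : starAlg C :=
  StarAlg subalg_adj_antilinear subalg_adjM subalg_adjK.

Definition subalg_incl (x : sub_starAlg) : A := subalg_val x.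
HB.instance Definition _ :=
  GRing.Linear.copy subalg_incl (\val : subalg -> A).
HB.instance Definition _ :=
  GRing.RMorphism.copy subalg_incl (\val : subalg -> A).

End Subalgebra.

Section Generators.
Variables (R : realType) (q : R) (A : starAlg R[i]) (alpha gamma : A).
Hypothesis hA : is_SUq2 q alpha gamma.

(* [A] maps to the *-subalgebra cut out by [P]; by uniqueness in the universal property,
   composing with the inclusion gives the identity. *)
Lemma SUq2_star_ind (P : A -> Prop) :
    P 1 -> (forall c x y, P x -> P y -> P (c *: x + y)) ->
    (forall x y, P x -> P y -> P (x * y)) -> (forall x, P x -> P (adj x)) ->
    P alpha -> P gamma -> forall x, P x.
Proof.
move=> P1 PL PM Pa Palpha Pgamma x.
have [rel univ] := hA.
pose B := sub_starAlg P1 PL PM Pa.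
have Sa : alpha \in in_subalg P by apply/asboolP.
have Sc : gamma \in in_subalg P by apply/asboolP.
pose a : B := Subalg Sa; pose c : B := Subalg Sc.
have relB : SUq2_relations q a c.
  by case: rel => r1 r2 r3 r4 r5; split; apply: val_inj.
have [f [fs fa fc _]] := univ B a c relB.
have [f0 [_ _ _ f0u]] := univ A alpha gamma rel.
pose g : {lrmorphism A -> A} := @subalg_incl _ _ _ P1 PL PM Pa \o f.
have gE : g =1 f0.
  by apply: f0u => [y||]; rewrite /g /= ?fs ?fa ?fc.
have iE : idfun =1 f0 by apply: f0u.
have -> : x = g x by rewrite gE -iE.
exact/asboolP/(subalg_valP (f x)).
Qed.

(** The conjunction of [P x] and [P (adj x)] is stable under [adj]; this trades closure under the
    involution for two more generators. *)
Lemma SUq2_ind (P : A -> Prop) :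
    P 1 -> (forall c x y, P x -> P y -> P (c *: x + y)) ->
    (forall x y, P x -> P y -> P (x * y)) ->
    P alpha -> P gamma -> P (adj alpha) -> P (adj gamma) -> forall x, P x.
Proof.
move=> P1 PL PM Pa Pc Pa' Pc' x.
suff [] : P x /\ P (adj x) by [].
elim/SUq2_star_ind : x => //; first by rewrite adj_1.
- by move=> c x y [? ?] [? ?]; rewrite adj_antilinear; split; apply: PL.
- by move=> x y [? ?] [? ?]; rewrite adjM; split; apply: PM.
- by move=> x [? ?]; rewrite adjK.
Qed.

Lemma regular_adj_antilinear (c : R[i]) (x y : R[i]^o) :
  (c *: x + y)^* = c^* *: (x^* : R[i]^o) + y^*.
Proof. by rewrite rmorphD rmorphM. Qed.

Lemma regular_adjM (x y : R[i]^o) : (x * y)^* = (y^* * x^* : R[i]^o).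
Proof. by rewrite rmorphM mulrC. Qed.

Definition regular_starAlg : starAlg R[i] :=
  StarAlg regular_adj_antilinear regular_adjM (@conjCK _ : involutive (fun x : R[i]^o => x^*)).

(** The scalars 1 and 0 satisfy the relations of alpha and gamma. The resulting character is the
    counit, evaluation at the unit of the quantum group. *)
Lemma counit_exists : exists e : {lrmorphism A -> regular_starAlg},
  [/\ e alpha = 1, e gamma = 0 & forall x, e (adj x) = (e x)^*].
Proof.
have [|e [es ea ec _]] := hA.2 regular_starAlg 1 0.
  split; rewrite /= ?conjC0 ?conjC1 ?mulr0 ?mul0r ?scaler0 ?addr0 ?mul1r //.
by exists e.
Qed.

End Generators.

(** * Forms in coordinates *)

Section Forms.
Variables (R : realType) (q : R) (A : starAlg R[i]) (alpha gamma : A).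
Variable (Om : calculus3D q alpha gamma).
Hypothesis hq : 0 < `|q| < 1.

Local Notation Q := (q%:C : R[i]).
Local Notation i := (incl Om).
Local Notation e1 := (eta1 Om).
Local Notation e2 := (eta2 Om).
Local Notation e3 := (eta3 Om).

Lemma qC_neq0 : Q != 0.
Proof. by rewrite fmorph_eq0 -normr_gt0; case/andP: hq. Qed.

(* [J2] uses the orthonormal 2-forms in the order dual to eta1, eta2, eta3: in these
   coordinates [d] is symmetric from 1-forms to 2-forms, and on 2-forms it is minus the
   codifferential of 1-forms. *)
Definition J0 (a : A) : Om := i a.
Definition J1 (a b c : A) : Om := i a * e1 + i b * e2 + i c * e3.
Definition J2 (a b c : A) : Om :=
  i a * (Q ^- 7 *: (e1 * e2)) + i b * (- Q ^- 6 *: (e3 * e1)) +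
  i c * (Q *: (e2 * e3)).
Definition J3 (a : A) : Om := i a * (e1 * e2 * e3).

Lemma incl_scale (c : R[i]) (a : A) (w : Om) : i (c *: a) * w = c *: (i a * w).
Proof. by rewrite linearZ /= -scalerAl. Qed.

Lemma J2E a b c : J2 a b c =
  i (Q ^- 7 *: a) * (e1 * e2) + i (Q *: c) * (e2 * e3)
  + i (- Q ^- 6 *: b) * (e3 * e1).
Proof. by rewrite /J2 !incl_scale -!scalerAr addrAC. Qed.

Lemma J_free a0 a1 a2 a3 b1 b2 b3 b0 :
  J0 a0 + J1 a1 a2 a3 + J2 b1 b2 b3 + J3 b0 = 0 ->
  [/\ a0 = 0, [/\ a1 = 0, a2 = 0 & a3 = 0], [/\ b1 = 0, b2 = 0 & b3 = 0] & b0 = 0].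
Proof.
move=> H; have [free _ _ _ _] := calculus_forms Om.
(* [inv_basis] lists eta2 eta3 before eta3 eta1, the opposite of the order in [J2]; hence [b3]
   before [b2]. *)
pose s := [:: a0; a1; a2; a3; Q ^- 7 *: b1; Q *: b3; - Q ^- 6 *: b2; b0].
have {}free k : (k < 8)%N -> s`_k = 0.
  apply: (free (fun k => s`_k)).
  rewrite /= !big_ord_recl big_ord0 /= /bump /= mulr1.
  by rewrite -[RHS]H /J0 /J1 /J3 J2E !addrA addr0.
have q7 : Q ^- 7 != 0 by rewrite invr_eq0 expf_neq0 ?qC_neq0.
have q6 : - Q ^- 6 != 0 by rewrite oppr_eq0 invr_eq0 expf_neq0 ?qC_neq0.
have Z c (x : A) : c != 0 -> c *: x = 0 -> x = 0.
  by move=> c0 /eqP; rewrite scaler_eq0 (negPf c0) => /eqP.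
split; first exact: (free 0%N).
- by split; [exact: (free 1%N) | exact: (free 2%N) | exact: (free 3%N)].
- split; [apply: Z q7 (free 4%N _) | apply: Z q6 (free 6%N _)
    | apply: Z qC_neq0 (free 5%N _)] => //.
- exact: (free 7%N).
Qed.

Lemma J_span (w : Om) : exists a0 a1 a2 a3 b1 b2 b3 b0,
  w = J0 a0 + J1 a1 a2 a3 + J2 b1 b2 b3 + J3 b0.
Proof.
have [_ span _ _ _] := calculus_forms Om.
have [a ->] := span w.
exists (a 0%N), (a 1%N), (a 2%N), (a 3%N), (Q ^+ 7 *: a 4%N), (- Q ^+ 6 *: a 6%N),
  (Q^-1 *: a 5%N), (a 7%N).
rewrite /= !big_ord_recl big_ord0 /= /bump /= mulr1.
rewrite /J0 /J1 /J3 J2E !scalerA mulrNN !mulVf ?mulfV ?expf_neq0 ?qC_neq0 //.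
by rewrite !scale1r !addrA addr0.
Qed.

Lemma J0_inj : injective J0.
Proof.
move=> a b /eqP; rewrite -subr_eq0 -raddfB => /eqP H.
have [] := @J_free (a - b) 0 0 0 0 0 0 0.
  by rewrite /J0 /J1 /J2 /J3 !raddf0 !mul0r !addr0.
by move/subr0_eq.
Qed.

Lemma J1_0 : J1 0 0 0 = 0. Proof. by rewrite /J1 !raddf0 !mul0r !addr0. Qed.
Lemma J2_0 : J2 0 0 0 = 0. Proof. by rewrite /J2 !raddf0 !mul0r !addr0. Qed.
Lemma J0_0 : J0 0 = 0. Proof. by rewrite /J0 raddf0. Qed.
Lemma J3_0 : J3 0 = 0. Proof. by rewrite /J3 raddf0 mul0r. Qed.
Lemma J0Z c a : J0 (c *: a) = c *: J0 a. Proof. exact: linearZ. Qed.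
Lemma J3D a a' : J3 (a + a') = J3 a + J3 a'.
Proof. by rewrite /J3 raddfD mulrDl. Qed.
Lemma J3Z c a : J3 (c *: a) = c *: J3 a. Proof. exact: incl_scale. Qed.
Lemma J1D a b c a' b' c' :
  J1 (a + a') (b + b') (c + c') = J1 a b c + J1 a' b' c'.
Proof. by rewrite /J1 !raddfD !mulrDl /= [RHS]addrACA; congr (_ + _); exact: addrACA. Qed.
Lemma J1Z t a b c : J1 (t *: a) (t *: b) (t *: c) = t *: J1 a b c.
Proof. by rewrite /J1 !incl_scale !scalerDr. Qed.
Lemma J2D a b c a' b' c' :
  J2 (a + a') (b + b') (c + c') = J2 a b c + J2 a' b' c'.
Proof. by rewrite /J2 !raddfD !mulrDl /= [RHS]addrACA; congr (_ + _); exact: addrACA. Qed.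
Lemma J2Z t a b c : J2 (t *: a) (t *: b) (t *: c) = t *: J2 a b c.
Proof. by rewrite /J2 !incl_scale !scalerDr. Qed.

Lemma J1_inj a b c a' b' c' :
  J1 a b c = J1 a' b' c' -> [/\ a = a', b = b' & c = c'].
Proof.
move=> /eqP; rewrite -subr_eq0 -scaleN1r -J1Z -J1D !scaleN1r => /eqP H.
have [|_ [/subr0_eq ? /subr0_eq ? /subr0_eq ?] _ _] //
  := @J_free 0 (a - a') (b - b') (c - c') 0 0 0 0.
by rewrite H J0_0 J2_0 J3_0 !addr0.
Qed.

Lemma homogeneous_incl a : Omega_ Om 0 (i a).
Proof. by exists (fun=> a); rewrite big_ord_recl big_ord0 /= mulr1 addr0. Qed.

Lemma Omega_0P w : Omega_ Om 0 w <-> exists a, w = J0 a.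
Proof.
split=> [[a ->]|[a ->]]; last exact: homogeneous_incl.
by exists (a 0%N); rewrite big_ord_recl big_ord0 /= mulr1 addr0.
Qed.

Lemma Omega_1P w : Omega_ Om 1 w <-> exists a b c, w = J1 a b c.
Proof.
split=> [[a ->]|[a [b [c ->]]]].
  exists (a 0%N), (a 1%N), (a 2%N).
  by rewrite /= !big_ord_recl big_ord0 /= addr0 addrA.
exists (nth 0 [:: a; b; c]).
by rewrite /= !big_ord_recl big_ord0 /= addr0 addrA.
Qed.

Lemma Omega_2P w : Omega_ Om 2 w <-> exists a b c, w = J2 a b c.
Proof.
split=> [[a ->]|[a [b [c ->]]]].
  exists (Q ^+ 7 *: a 0%N), (- Q ^+ 6 *: a 2%N), (Q^-1 *: a 1%N).
  rewrite J2E /= !big_ord_recl big_ord0 /= addr0 addrA !scalerA mulrNN.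
  by rewrite !mulVf ?mulfV ?expf_neq0 ?qC_neq0 // !scale1r.
exists (nth 0 [:: Q ^- 7 *: a; Q *: c; - Q ^- 6 *: b]).
by rewrite J2E /= !big_ord_recl big_ord0 /= addr0 addrA.
Qed.

Lemma Omega_3P w : Omega_ Om 3 w <-> exists a, w = J3 a.
Proof.
split=> [[a ->]|[a ->]].
  by exists (a 0%N); rewrite big_ord_recl big_ord0 /= addr0.
by exists (fun=> a); rewrite big_ord_recl big_ord0 /= addr0.
Qed.

Lemma eta_homogeneous : [/\ Omega_ Om 1 e1, Omega_ Om 1 e2 & Omega_ Om 1 e3].
Proof.
split; apply/Omega_1P; [exists 1, 0, 0 | exists 0, 1, 0 | exists 0, 0, 1];
by rewrite /J1 !raddf0 !rmorph1 !mul0r mul1r ?add0r ?addr0.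
Qed.

Section Twist.
Hypothesis hA : is_SUq2 q alpha gamma.

(* Moving an invariant 1-form past a coefficient; this automorphism is not a *-map. *)
Definition twist (t : R[i]) (f : A -> A) : Prop :=
  [/\ f alpha = t^-1 *: alpha, f gamma = t^-1 *: gamma,
      f (adj alpha) = t *: adj alpha & f (adj gamma) = t *: adj gamma].

Lemma twist_uniq t (f g : {lrmorphism A -> A}) : twist t f -> twist t g -> f =1 g.
Proof.
move=> [fa fc fa' fc'] [ga gc ga' gc'] x.
elim/(SUq2_ind hA) : x; rewrite ?rmorph1 ?fa ?fc ?fa' ?fc' //.
- by move=> c x y ex ey; rewrite !linearP /= ex ey.
- by move=> x y ex ey; rewrite !rmorphM /= ex ey.
Qed.

(** The coefficients [a] for which eta a is again a left multiple of eta form a subalgebra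
    containing the generators, hence everything. As eta is free the multiple is unique, and
    uniqueness makes it linear and multiplicative in [a]. *)
Lemma twist_exists t (eta : Om) :
  (forall b, i b * eta = 0 -> b = 0) -> commutation i t eta alpha gamma ->
  exists f : {lrmorphism A -> A}, twist t f /\ forall a, eta * i a = i (f a) * eta.
Proof.
move=> free [ca cc ca' cc'].
have ex a : exists b, eta * i a = i b * eta.
  elim/(SUq2_ind hA) : a.
  - by exists 1; rewrite rmorph1 mulr1 mul1r.
  - move=> c x y [x' Ex] [y' Ey]; exists (c *: x' + y').
    by rewrite !linearP mulrDr mulrDl /= Ey -scalerAr Ex -scalerAl.
  - move=> x y [x' Ex] [y' Ey]; exists (x' * y').
    by rewrite !rmorphM mulrA Ex -mulrA Ey mulrA.
  - by exists (t^-1 *: alpha); rewrite incl_scale.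
  - by exists (t^-1 *: gamma); rewrite incl_scale.
  - by exists (t *: adj alpha); rewrite incl_scale.
  - by exists (t *: adj gamma); rewrite incl_scale.
pose f a := sval (cid (ex a)).
have fP a : eta * i a = i (f a) * eta by rewrite /f; case: cid.
have fE a b : eta * i a = i b * eta -> f a = b.
  move=> ab; apply/subr0_eq/free.
  by rewrite raddfB mulrBl /= -fP ab subrr.
have flin : linear f.
  move=> c x y; apply: fE.
  by rewrite !linearP mulrDr mulrDl /= fP -scalerAr fP -scalerAl.
have fmul : monoid_morphism f.
  split; first by apply: fE; rewrite rmorph1 mulr1 mul1r.
  by move=> x y; apply: fE; rewrite !rmorphM mulrA fP -mulrA fP mulrA.
pose fl := GRing.isLinear.Build _ _ _ _ f flin.
pose fm := GRing.isMonoidMorphism.Build _ _ f fmul.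
pose g : {lrmorphism A -> A} := HB.pack f fl fm.
by exists g; split=> //; split; apply: fE; rewrite incl_scale.
Qed.

End Twist.

Lemma eta_free : [/\ forall b, i b * e1 = 0 -> b = 0,
  forall b, i b * e2 = 0 -> b = 0 & forall b, i b * e3 = 0 -> b = 0].
Proof.
split=> b hb.
- have [] // := @J1_inj b 0 0 0 0 0.
  by rewrite J1_0 /J1 hb raddf0 !mul0r !addr0.
- have [] // := @J1_inj 0 b 0 0 0 0.
  by rewrite J1_0 /J1 hb raddf0 !mul0r !addr0.
- have [] // := @J1_inj 0 0 b 0 0 0.
  by rewrite J1_0 /J1 hb raddf0 !mul0r !addr0.
Qed.

End Forms.

(** * The Haar integral *)

Section Haar.
Variables (R : realType) (q : R) (A : starAlg R[i]) (alpha gamma : A).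
Hypotheses (hq : 0 < `|q| < 1) (hA : is_SUq2 q alpha gamma).
Variables (T : tensorSquare A) (Delta : {lrmorphism A -> T}).
Hypothesis hDelta : is_comult q alpha gamma Delta.
Local Notation Q := (q%:C : R[i]).

Lemma conj_qC : (Q)^* = Q.
Proof. exact: conjc_real. Qed.

Lemma tens_bilin : bilinear_map (tens T). Proof. exact: tens_bilinear. Qed.

Lemma tensDl a b c : tens T (a + b) c = tens T a c + tens T b c.
Proof. by have := (tens_bilin.1 c) 1 a b; rewrite !scale1r. Qed.
Lemma tensDr a b c : tens T a (b + c) = tens T a b + tens T a c.
Proof. by have := (tens_bilin.2 a) 1 b c; rewrite !scale1r. Qed.
Lemma tens0l c : tens T 0 c = 0.
Proof. by apply: (addrI (tens T 0 c)); rewrite -tensDl !addr0. Qed.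
Lemma tens0r c : tens T c 0 = 0.
Proof. by apply: (addrI (tens T c 0)); rewrite -tensDr !addr0. Qed.
Lemma tensZl k a c : tens T (k *: a) c = k *: tens T a c.
Proof. by have := (tens_bilin.1 c) k a 0; rewrite tens0l !addr0. Qed.
Lemma tensZr k a c : tens T a (k *: c) = k *: tens T a c.
Proof. by have := (tens_bilin.2 a) k c 0; rewrite tens0r !addr0. Qed.

Lemma slice_left_bilinear (h : {scalar A}) :
  bilinear_map (fun x y => h x *: (y : A)).
Proof.
split=> [y c u v|x c u v]; first by rewrite linearP scalerDl scalerA.
by rewrite scalerDr !scalerA mulrC.
Qed.

Lemma slice_right_bilinear (h : {scalar A}) :
  bilinear_map (fun x y => h y *: (x : A)).
Proof.
split=> [y c u v|x c u v]; first by rewrite scalerDr !scalerA mulrC.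
by rewrite linearP scalerDl scalerA.
Qed.

Lemma slice_rightE (h : {scalar A}) x y :
  slice_right h (tens T x y) = h y *: x.
Proof. exact: tliftE (slice_right_bilinear h) _ _. Qed.

Lemma slice_right_linear (h : {scalar A}) : linear (slice_right (T := T) h).
Proof. exact: tlift_linear (slice_right_bilinear h). Qed.

Lemma slice_leftE (h : {scalar A}) x y :
  slice_left h (tens T x y) = h x *: y.
Proof. exact: tliftE (slice_left_bilinear h) _ _. Qed.

Lemma slice_left_linear (h : {scalar A}) : linear (slice_left (T := T) h).
Proof. exact: tlift_linear (slice_left_bilinear h). Qed.

(** The uniqueness clause of the tensor square, for maps that are not bundled as linear. *)
Lemma tens_ext (V : lmodType R[i]) (f g : T -> V) : linear f -> linear g ->
  (forall a b, f (tens T a b) = g (tens T a b)) -> f =1 g.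
Proof.
move=> fl gl e.
pose fl' := GRing.isLinear.Build _ _ _ _ f fl.
pose gl' := GRing.isLinear.Build _ _ _ _ g gl.
pose f' : {linear T -> V} := HB.pack f fl'.
pose g' : {linear T -> V} := HB.pack g gl'.
exact: (@tlift_uniq _ _ T V f' g' e).
Qed.

Section TensorMap.
Variable f : {lrmorphism A -> A}.

Definition id_tens : T -> T := tlift (fun x y => tens T x (f y)).

Lemma id_tens_bilinear : bilinear_map (fun x y => tens T x (f y)).
Proof.
split=> [y c u v | x c u v]; first by rewrite tensDl tensZl.
by rewrite linearP tensDr tensZr.
Qed.

Lemma id_tensE x y : id_tens (tens T x y) = tens T x (f y).
Proof. exact: tliftE id_tens_bilinear _ _. Qed.

Lemma id_tens_linear : linear id_tens.
Proof. exact: tlift_linear id_tens_bilinear. Qed.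

Lemma id_tensD u v : id_tens (u + v) = id_tens u + id_tens v.
Proof. exact: linear_D id_tens_linear u v. Qed.

Lemma id_tensZ c u : id_tens (c *: u) = c *: id_tens u.
Proof. exact: linear_Z id_tens_linear c u. Qed.

Lemma id_tensM u v : id_tens (u * v) = id_tens u * id_tens v.
Proof.
apply: (tens_ext (f := fun u => id_tens (u * v)) (g := fun u => id_tens u * id_tens v)).
- by move=> c x y; rewrite mulrDl -scalerAl id_tens_linear.
- by move=> c x y; rewrite id_tens_linear mulrDl -scalerAl.
move=> a b.
apply: (tens_ext (f := fun v => id_tens (tens T a b * v))
  (g := fun v => id_tens (tens T a b) * id_tens v)).
- by move=> c x y; rewrite mulrDr -scalerAr id_tens_linear.
- by move=> c x y; rewrite id_tens_linear mulrDr -scalerAr.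
by move=> a' b'; rewrite tensM !id_tensE tensM rmorphM.
Qed.

(** The right-hand factors in the coproducts of alpha and gamma are alpha and gamma only, all scaled
    by 1/t; those of the adjoints are all scaled by t. So the twist acts on the second factor
    alone. *)
Lemma comult_twist t : twist alpha gamma t f ->
  forall a, Delta (f a) = id_tens (Delta a).
Proof.
move=> [fa fc fa' fc'] a.
have [Ds Da Dc] := hDelta.
elim/(SUq2_ind hA) : a.
- by rewrite !rmorph1 -(tens1 T) id_tensE rmorph1.
- by move=> c x y ex ey; rewrite !linearP /= ex ey id_tensD id_tensZ.
- by move=> x y ex ey; rewrite !rmorphM /= ex ey id_tensM.
- rewrite fa linearZ /= Da -scaleNr id_tensD id_tensZ !id_tensE fa fc !tensZr.
  by rewrite scalerDr !scalerA mulrC.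
- rewrite fc linearZ /= Dc id_tensD !id_tensE fa fc !tensZr.
  by rewrite scalerDr.
- rewrite fa' linearZ /= Ds Da -scaleNr adj_D adj_Z !tens_adj id_tensD id_tensZ.
  rewrite !id_tensE fa' fc' !tensZr.
  by rewrite scalerDr !scalerA mulrC.
- rewrite fc' linearZ /= Ds Dc adj_D !tens_adj id_tensD.
  by rewrite !id_tensE fa' fc' !tensZr scalerDr.
Qed.

End TensorMap.

Variable h : {scalar A}.
Hypothesis hh : is_haar Delta h.

(** Applying h to the first factor of [comult_twist] gives h(f a) 1 = f(h(a) 1), and f fixes 1. *)
Lemma haar_twist t (f : {lrmorphism A -> A}) : twist alpha gamma t f ->
  forall a, h (f a) = h a.
Proof.
move=> ft a; have [h1 _ hl _ _] := hh.
have sl u : slice_left h (id_tens f u) = f (slice_left h u).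
  move: u; apply: tens_ext.
  - by move=> c x y; rewrite id_tens_linear slice_left_linear.
  - by move=> c x y; rewrite slice_left_linear linearP.
  - by move=> x y; rewrite id_tensE !slice_leftE linearZ.
have := sl (Delta a); rewrite -(comult_twist ft) !hl linearZ /= rmorph1.
move/(congr1 h); rewrite !linearZ /= h1 /GRing.scale /= !mulr1.
by [].
Qed.

End Haar.

(** * The differential and the vector fields *)

Section VectorFields.
Variables (R : realType) (q : R) (A : starAlg R[i]) (alpha gamma : A).
Variable (Om : calculus3D q alpha gamma).
Hypothesis (hq : 0 < `|q| < 1).
Local Notation Q := (q%:C : R[i]).
Local Notation i := (incl Om).
Local Notation e1 := (eta1 Om).
Local Notation e2 := (eta2 Om).
Local Notation e3 := (eta3 Om).
Local Notation J1 := (J1 Om).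
Local Notation J2 := (J2 Om).
Local Notation J3 := (J3 Om).

Variables X1 X2 X3 : A -> A.
Hypothesis diff_incl : forall a, diff Om (i a) = J1 (X1 a) (X2 a) (X3 a).

Lemma fields_linear : [/\ linear X1, linear X2 & linear X3].
Proof.
suff H c a b : [/\ X1 (c *: a + b) = c *: X1 a + X1 b,
    X2 (c *: a + b) = c *: X2 a + X2 b & X3 (c *: a + b) = c *: X3 a + X3 b].
  by split=> c a b; have [] := H c a b.
by apply: (@J1_inj _ _ _ _ _ Om hq); rewrite J1D J1Z -!diff_incl !linearP.
Qed.

Lemma incl_mul_scale (a : A) (c : R[i]) (w : Om) : i a * (c *: w) = i (c *: a) * w.
Proof. by rewrite incl_scale scalerAr. Qed.

Lemma field2_generators :
  [/\ X2 alpha = alpha, X2 gamma = gamma, X2 (adj alpha) = - Q ^+ 2 *: adj alpha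
   & X2 (adj gamma) = - Q ^+ 2 *: adj gamma].
Proof.
have [_ _ _ [da dc da' dc'] _] := calculus_diff Om.
split.
- have [] // := @J1_inj _ _ _ _ _ Om hq (X1 alpha) (X2 alpha) (X3 alpha)
    0 alpha (- (Q ^+ 2) *: adj gamma).
  by rewrite -diff_incl da /J1 raddf0 mul0r add0r incl_scale scaleNr.
- have [] // := @J1_inj _ _ _ _ _ Om hq (X1 gamma) (X2 gamma) (X3 gamma)
    0 gamma (Q *: adj alpha).
  by rewrite -diff_incl dc /J1 raddf0 mul0r add0r incl_scale.
- have [] // := @J1_inj _ _ _ _ _ Om hq (X1 (adj alpha)) (X2 (adj alpha))
    (X3 (adj alpha)) (- gamma) (- Q ^+ 2 *: adj alpha) 0.
  rewrite -diff_incl da' /J1 !raddf0 mul0r addr0 incl_scale addrC.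
  by rewrite raddfN mulNr.
- have [] // := @J1_inj _ _ _ _ _ Om hq (X1 (adj gamma)) (X2 (adj gamma))
    (X3 (adj gamma)) (Q^-1 *: alpha) (- Q ^+ 2 *: adj gamma) 0.
  by rewrite -diff_incl dc' /J1 !raddf0 mul0r addr0 !incl_scale addrC.
Qed.

Lemma quadratic_relations :
  [/\ e1 * e1 = 0, e2 * e2 = 0 & e3 * e3 = 0] /\
  [/\ e1 * e2 = Q ^+ 7 *: (Q ^- 7 *: (e1 * e2)),
      e2 * e1 = - Q ^+ 11 *: (Q ^- 7 *: (e1 * e2)) &
      e3 * e1 = - Q ^+ 6 *: (- Q ^- 6 *: (e3 * e1))] /\
  [/\
      e1 * e3 = Q ^+ 4 *: (- Q ^- 6 *: (e3 * e1)),
      e2 * e3 = Q^-1 *: (Q *: (e2 * e3)) &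
      e3 * e2 = - Q ^+ 3 *: (Q *: (e2 * e3))].
Proof.
have [_ _ [s1 s2 s3] [c21 c32 c13] _] := calculus_forms Om.
have Q0 := qC_neq0 hq.
split; first by rewrite -!expr2.
have unit c (w : Om) : c = 1 -> w = c *: w by move=> ->; rewrite scale1r.
rewrite c21 c32 c13; split; split; rewrite !scalerA;
  by [apply: unit; field | congr (_ *: _); field].
Qed.

Lemma diff_mul a w : diff Om (i a * w) = diff Om (i a) * w + i a * diff Om w.
Proof.
have [_ dm _ _ _] := calculus_diff Om.
by rewrite (dm 0%N) ?expr0 ?scale1r //; apply: homogeneous_incl.
Qed.

Lemma diff_J1_1 a : diff Om (i a * e1) =
  J2 (Q ^+ 7 * (Q ^+ 2 + Q ^+ 4) *: a - Q ^+ 11 *: X2 a) (- Q ^+ 6 *: X3 a) 0.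
Proof.
have [_ _ _ _ [d1 _ _]] := calculus_diff Om.
have [[e11 _ _] [[e12 e21 e31] _]] := quadratic_relations.
have d1' : diff Om e1 =
    (Q ^+ 2 * (1 + Q ^+ 2) * Q ^+ 7) *: (Q ^- 7 *: (e1 * e2)).
  by rewrite d1 {1}e12 scalerA.
rewrite diff_mul diff_incl /J1 !mulrDl -!mulrA e11 e21 e31 d1' mulr0 add0r.
rewrite /J2; move: (Q ^- 7 *: _) (- Q ^- 6 *: _) (Q *: (e2 * _)) => F G H.
rewrite !incl_mul_scale raddf0 mul0r addr0.
rewrite addrAC; congr (_ + _); rewrite -mulrDl -raddfD /= scaleNr addrC.
by congr (i (_ *: _ - _) * _); ring.
Qed.

Lemma diff_J1_2 a : diff Om (i a * e2) =
  J2 (Q ^+ 7 *: X1 a) (Q ^+ 5 *: a) (- Q ^+ 3 *: X3 a).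
Proof.
have [_ _ _ _ [_ d2 _]] := calculus_diff Om.
have [[_ e22 _] [[e12 _ _] [e13 _ e32]]] := quadratic_relations.
have d2' : diff Om e2 = (Q * Q ^+ 4) *: (- Q ^- 6 *: (e3 * e1)).
  by rewrite d2 {1}e13 scalerA.
rewrite diff_mul diff_incl /J1 !mulrDl -!mulrA e22 {1}e12 e32 d2' mulr0 addr0.
rewrite /J2; move: (Q ^- 7 *: _) (- Q ^- 6 *: _) (Q *: (e2 * _)) => F G H.
rewrite !incl_mul_scale.
by rewrite addrAC -exprS.
Qed.

Lemma diff_J1_3 a : diff Om (i a * e3) =
  J2 0 (Q ^+ 4 *: X1 a) (Q^-1 * (Q ^+ 2 + Q ^+ 4) *: a + Q^-1 *: X2 a).
Proof.
have [_ _ _ _ [_ _ d3]] := calculus_diff Om.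
have [[_ _ e33] [_ [e13 e23 _]]] := quadratic_relations.
have d3' : diff Om e3 =
    (Q ^+ 2 * (1 + Q ^+ 2) * Q^-1) *: (Q *: (e2 * e3)).
  by rewrite d3 {1}e23 !scalerA.
rewrite diff_mul diff_incl /J1 !mulrDl -!mulrA e33 e13 {1}e23 d3' mulr0 addr0.
rewrite /J2; move: (Q ^- 7 *: _) (- Q ^- 6 *: _) (Q *: (e2 * _)) => F G H.
rewrite !incl_mul_scale raddf0 mul0r add0r.
rewrite -addrA; congr (_ + _); rewrite -mulrDl -raddfD /= addrC.
by congr (i (_ *: _ + _) * _); ring.
Qed.

(** [curl1], [curl2], [curl3] are the rows of the operator L, and [codiv] is D^*, in the coordinates
    of [J1] and [J2]. The terms without a field come from d eta_r. *)
Definition curl1 a b := Q ^+ 7 * (Q ^+ 2 + Q ^+ 4) *: a - Q ^+ 11 *: X2 a + Q ^+ 7 *: X1 b.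
Definition curl2 a b c := - Q ^+ 6 *: X3 a + Q ^+ 5 *: b + Q ^+ 4 *: X1 c.
Definition curl3 b c := - Q ^+ 3 *: X3 b + (Q^-1 * (Q ^+ 2 + Q ^+ 4) *: c + Q^-1 *: X2 c).
Definition codiv a b c := - Q^-1 *: X3 a + X2 b - Q *: X1 c.

Lemma diff_J1 a b c : diff Om (J1 a b c) = J2 (curl1 a b) (curl2 a b c) (curl3 b c).
Proof.
rewrite {1}/J1 !linearD /= diff_J1_1 diff_J1_2 diff_J1_3 -!J2D addr0 add0r.
by [].
Qed.

Lemma diff_inv_basis_2 :
  [/\ diff Om (e1 * e2) = 0, diff Om (e2 * e3) = 0 & diff Om (e3 * e1) = 0].
Proof.
have [_ dm _ _ [d1 d2 d3]] := calculus_diff Om.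
have [_ _ [s1 s2 s3] [c21 c32 c13] _] := calculus_forms Om.
have [h1 h2 h3] := eta_homogeneous Om.
rewrite !expr2 in s1 s2 s3.
have Q0 := qC_neq0 hq.
split.
- rewrite (dm 1%N) // d1 d2 -scalerAl -(mulrA e1) s2 mulr0 scaler0 add0r.
  by rewrite -scalerAr (mulrA e1) s1 mul0r !scaler0.
- rewrite (dm 1%N) // d2 d3 -scalerAl -(mulrA e1) s3 mulr0 scaler0 add0r.
  by rewrite -scalerAr (mulrA e2) s2 mul0r !scaler0.
(* The only case in which no square of an eta_r appears: e2 e3 e1 and e3 e1 e2 are both q^6 times
   the volume form, and they cancel. *)
- rewrite (dm 1%N) // d3 d1 -scalerAl -scalerAr (mulrA e3).
  have e31 : e3 * e1 = - Q ^+ 2 *: (e1 * e3).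
    by rewrite c13 scalerA mulrNN mulfV ?expf_neq0 // scale1r.
  rewrite e31.
  have -> : e2 * e3 * e1 = Q ^+ 6 *: (e1 * e2 * e3).
    rewrite -(mulrA e2) e31 -scalerAr (mulrA e2) c21 -scalerAl scalerA.
    by congr (_ *: _); ring.
  rewrite -scalerAl -(mulrA e1 e3) c32 -scalerAr (mulrA e1) !scalerA -scalerDl.
  by apply/eqP; rewrite scaler_eq0; apply/orP; left; apply/eqP; ring.
Qed.
End VectorFields.

Section RealParameter.
Variables (R : realType) (q : R).
Hypothesis hq : 0 < `|q| < 1.

Lemma q_neq0 : q != 0.
Proof. by rewrite -normr_gt0; case/andP: hq. Qed.

Lemma sqr_q_lt1 : q ^+ 2 < 1.
Proof. by rewrite -real_normK ?num_real // expr_lt1 //; case/andP: hq. Qed.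

Lemma one_subr_q2_neq0 : 1 - q ^+ 2 != 0.
Proof. by rewrite subr_eq0 eq_sym lt_eqF ?sqr_q_lt1. Qed.

Lemma one_subr_qC2_neq0 : 1 - (q%:C : R[i]) ^+ 2 != 0.
Proof.
by rewrite -rmorphXn -(rmorph1 (real_complex R)) -rmorphB fmorph_eq0 one_subr_q2_neq0.
Qed.

End RealParameter.

(** * The differential of 2- and 3-forms; Leibniz rule, involution and adjoints of the vector
    fields *)

Section VectorFieldIdentities.
Variables (R : realType) (q : R) (A : starAlg R[i]) (alpha gamma : A).
Variable (Om : calculus3D q alpha gamma).
Hypothesis (hq : 0 < `|q| < 1).
Local Notation Q := (q%:C : R[i]).
Local Notation i := (incl Om).
Local Notation e1 := (eta1 Om).
Local Notation e2 := (eta2 Om).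
Local Notation e3 := (eta3 Om).
Local Notation J0 := (J0 Om).
Local Notation J1 := (J1 Om).
Local Notation J2 := (J2 Om).
Local Notation J3 := (J3 Om).

Variables X1 X2 X3 : A -> A.
Hypothesis diff_incl : forall a, diff Om (i a) = J1 (X1 a) (X2 a) (X3 a).

Lemma cubic_relations :
  [/\ e1 * (e1 * e2) = 0, e2 * (e1 * e2) = 0 & e3 * (e1 * e2) = Q ^+ 6 *: (e1 * e2 * e3)]
  /\ [/\ e1 * (e3 * e1) = 0, e2 * (e3 * e1) = Q ^+ 6 *: (e1 * e2 * e3)
       & e3 * (e3 * e1) = 0]
  /\ [/\ e1 * (e2 * e3) = e1 * e2 * e3, e2 * (e2 * e3) = 0 & e3 * (e2 * e3) = 0].
Proof.
have [_ _ [s1 s2 s3] [c21 c32 c13] _] := calculus_forms Om.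
rewrite !expr2 in s1 s2 s3.
have Q0 := qC_neq0 hq.
have e31 : e3 * e1 = - Q ^+ 2 *: (e1 * e3).
  by rewrite c13 scalerA mulrNN mulfV ?expf_neq0 // scale1r.
split; [|split]; split.
- by rewrite mulrA s1 mul0r.
- by rewrite mulrA c21 -scalerAl -mulrA s2 mulr0 scaler0.
- rewrite mulrA e31 -scalerAl -(mulrA e1 e3) c32 -scalerAr !scalerA (mulrA e1 e2).
  by congr (_ *: _); ring.
- by rewrite mulrA c13 -scalerAl -mulrA s1 mulr0 scaler0.
- rewrite e31 -scalerAr mulrA c21 -scalerAl scalerA.
  by congr (_ *: _); ring.
- by rewrite mulrA s3 mul0r.
- by rewrite mulrA.
- by rewrite mulrA s2 mul0r.
- by rewrite mulrA c32 -scalerAl -mulrA s3 mulr0 scaler0.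
Qed.

(** The invariant 2-forms are closed, so only coefficients are differentiated, and each basis 2-form
    has a nonzero product with exactly one eta_r. The normalized 2-forms give the factors q^-1, -1
    and q. *)
Lemma diff_J2 a b c : diff Om (J2 a b c) = J3 (- codiv q X1 X2 X3 a b c).
Proof.
have [d12 d23 d31] := diff_inv_basis_2 Om hq.
have [[r1 r2 r3] [[r4 r5 r6] [r7 r8 r9]]] := cubic_relations.
have Q0 := qC_neq0 hq.
have D a' w : diff Om w = 0 ->
    diff Om (i a' * w) = i (X1 a') * (e1 * w) + i (X2 a') * (e2 * w) + i (X3 a') * (e3 * w).
  by move=> dw; rewrite diff_mul dw mulr0 addr0 diff_incl /J1 !mulrDl !mulrA.
rewrite /J2 !incl_mul_scale !linearD /= !D //.
rewrite r1 r2 r3 r4 r5 r6 r7 r8 r9 !mulr0 !add0r !addr0 /codiv /J3.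
have [l1 l2 l3] := fields_linear hq diff_incl.
rewrite !(linear_Z l1) !(linear_Z l2) !(linear_Z l3) !incl_mul_scale !scalerA -!mulrDl -!raddfD /=.
congr (i _ * _); rewrite scaleNr !opprD !opprK -[X2 b in RHS]scale1r -scaleNr.
by congr (_ *: _ + _ *: _ + _); field.
Qed.

Lemma diff_J3 a : diff Om (J3 a) = 0.
Proof.
have [hom _ _ _ _] := calculus_diff Om.
have [|b ->] := hom 3%N (J3 a); first by apply/Omega_3P; exists a.
(* The list of invariant forms in degree 4 is empty. *)
by rewrite big_ord0.
Qed.

Variables f1 f2 : {lrmorphism A -> A}.
Hypotheses (tw1 : forall a, e1 * i a = i (f1 a) * e1)
  (tw2 : forall a, e2 * i a = i (f2 a) * e2)
  (tw3 : forall a, e3 * i a = i (f1 a) * e3).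

Lemma fields_leibniz a b :
  [/\ X1 (a * b) = X1 a * f1 b + a * X1 b, X2 (a * b) = X2 a * f2 b + a * X2 b
    & X3 (a * b) = X3 a * f1 b + a * X3 b].
Proof.
apply: (@J1_inj _ _ _ _ _ Om hq); rewrite J1D -diff_incl rmorphM diff_mul !diff_incl.
congr (_ + _); rewrite /J1 ?mulrDl ?mulrDr !rmorphM -!mulrA //.
by rewrite tw1 tw2 tw3.
Qed.

Lemma fields_adj a :
  [/\ X1 (adj a) = Q^-1 *: f1 (adj (X3 a)), X2 (adj a) = - f2 (adj (X2 a))
    & X3 (adj a) = Q *: f1 (adj (X1 a))].
Proof.
have [stl _ sti stm [st1 st2 st3]] := calculus_star Om.
have [_ _ [_ ds] _ _] := calculus_diff Om.
have stD u v : form_star (c := Om) (u + v) = form_star u + form_star v.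
  by have := stl 1 u v; rewrite !scale1r conjC1 scale1r.
have [h1 h2 h3] := eta_homogeneous Om.
have st0 b eta : Omega_ Om 1 eta -> form_star (i b * eta) = form_star eta * i (adj b).
  move=> he; rewrite (stm 0%N 1%N) ?sti ?scale1r //; exact: homogeneous_incl.
apply: (@J1_inj _ _ _ _ _ Om hq); rewrite -diff_incl -sti ds diff_incl /J1.
rewrite !stD !st0 // st1 st2 st3 mulNr -!scalerAl tw1 tw2 tw3 !incl_scale.
by rewrite raddfN mulNr addrC addrA [RHS]addrAC addrC !addrA.
Qed.

(** Both sides obey the same twisted Leibniz rule, so the generators decide. The constant solves t
    (q^-2 - 1) = 1, the equation at alpha; it is also the prefactor of [lam]. *)
Lemma field2_twist : is_SUq2 q alpha gamma -> twist alpha gamma (Q ^+ 2) f2 ->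
  forall a, X2 a = (Q ^+ 2 / (1 - Q ^+ 2)) *: (f2 a - a).
Proof.
move=> hA [fa fc fa' fc'] a.
have [_ l2 _] := fields_linear hq diff_incl.
have [xa xc xa' xc'] := field2_generators hq diff_incl.
have Q0 := qC_neq0 hq.
have Q1 := one_subr_qC2_neq0 hq.
elim/(SUq2_ind hA) : a.
- rewrite rmorph1 subrr scaler0; have [_ + _] := fields_leibniz 1 1.
  by rewrite !mulr1 rmorph1 mulr1 mul1r -[LHS]addr0 => /addrI.
- move=> c x y ex ey; rewrite l2 ex ey linearP /=.
  have -> : c *: f2 x + f2 y - (c *: x + y) = c *: (f2 x - x) + (f2 y - y).
    by rewrite opprD addrACA scalerBr.
  by rewrite [RHS]scalerDr !scalerA (mulrC c).
- move=> x y ex ey; have [_ -> _] := fields_leibniz x y; rewrite ex ey.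
  rewrite -scalerAl -scalerAr -scalerDr rmorphM mulrBl mulrBr addrA subrK.
  by [].
- rewrite xa fa -{3}[alpha]scale1r -scalerBl scalerA -[LHS]scale1r.
  by congr (_ *: _); field; rewrite Q0.
- rewrite xc fc -{3}[gamma]scale1r -scalerBl scalerA -[LHS]scale1r.
  by congr (_ *: _); field; rewrite Q0.
- rewrite xa' fa' -{3}[adj alpha]scale1r -scalerBl scalerA.
  by congr (_ *: _); field.
- rewrite xc' fc' -{3}[adj gamma]scale1r -scalerBl scalerA.
  by congr (_ *: _); field.
Qed.

Variable h : {scalar A}.
Hypotheses (h_f1 : forall a, h (f1 a) = h a) (h_f2 : forall a, h (f2 a) = h a).
Hypothesis h_X : forall a, [/\ h (X1 a) = 0, h (X2 a) = 0 & h (X3 a) = 0].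

Definition hform (a b : A) : R[i] := h (adj b * a).

(** Integration by parts: h kills X(b^* a). By [fields_adj] the field of b^* is already twisted, so
    the boundary term of the Leibniz rule is the twist of a product, and h ignores the twist. *)
Lemma fields_adjoint a b :
  [/\ hform (X1 a) b = - Q^-1 * hform a (X3 b), hform (X2 a) b = hform a (X2 b)
    & hform (X3 a) b = - Q * hform a (X1 b)].
Proof.
have [a1 a2 a3] := fields_adj b.
have [l1 l2 l3] := fields_leibniz (adj b) a.
have [h1 h2 h3] := h_X (adj b * a).
have E (X : A -> A) y : h (X (adj b * a)) = 0 ->
   X (adj b * a) = X (adj b) * y + adj b * X a -> hform (X a) b = - h (X (adj b) * y).
  move=> h0 e; apply/eqP; rewrite -subr_eq0 opprK -raddfD /= addrC -e h0.
  by [].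
rewrite (E _ _ h1 l1) (E _ _ h2 l2) (E _ _ h3 l3) a1 a2 a3.
split.
- by rewrite -scalerAl linearZ /= -rmorphM h_f1 mulNr.
- by rewrite mulNr raddfN opprK -rmorphM; apply: h_f2.
- by rewrite -scalerAl linearZ /= -rmorphM h_f1 mulNr.
Qed.
End VectorFieldIdentities.

(** * Scalars *)

Lemma idxP (M : nat) (K : int) :
  reflect (exists2 j, (j < M)%N & K = (2 * j)%:Z - M.-1%:Z) (K \in idx M).
Proof.
apply: (iffP mapP) => [[j]|[j jM ->]].
  by rewrite mem_iota add0n => /andP[_ jM] ->; exists j.
by exists j; rewrite // mem_iota.
Qed.

(** An integer position, possibly out of range, turns membership into an interval condition that
    [lia] can decide. *)
Lemma mem_idx_int (n : int) M : (2 * n - M.-1%:Z \in idx M) = (0 <= n < M%:Z).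
Proof.
apply/idxP/idP => [[j jM e]|/andP[n0 nM]]; first by lia.
by exists `|n|%N; lia.
Qed.

Lemma idx_uniq M : uniq (idx M).
Proof.
rewrite map_inj_uniq ?iota_uniq // => i j /eqP.
by rewrite (inj_eq (addIr _)) eqz_nat eqn_pmul2l // => /eqP.
Qed.

Lemma idx_shift_down M K : K \in idx M -> K - 2 \notin idx M -> K = - M.-1%:Z.
Proof.
move=> /idxP[j jM ->] /idxP h; case: j jM h => [|j] jM h; first by lia.
by case: h; exists j; lia.
Qed.

Section Scalars.
Variables (R : realType) (q : R).
Hypothesis hq : 0 < `|q| < 1.

(** As q may be negative, the comparison passes through q^2, which lies strictly between 0 and 1. *)
Lemma exprz_q_inj : injective (exprz q).
Proof.
move=> m n e; apply: (@ieexprIz _ (q ^ 2)).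
- by rewrite -exprnP exprn_even_gt0 //= q_neq0.
- by rewrite -exprnP lt_eqF ?sqr_q_lt1.
- by rewrite exprzAC e exprzAC.
Qed.

Lemma sqr_q_gt0 : 0 < q ^+ 2.
Proof. by rewrite exprn_even_gt0 //= q_neq0. Qed.

Lemma lam_inj : injective (lam q).
Proof.
move=> K K' /(mulfI _) h; suff: - (2 * K) = - (2 * K') by lia.
apply: exprz_q_inj; apply: (addIr (-1)); apply: h.
by rewrite mulf_neq0 ?expf_neq0 ?invr_eq0 ?one_subr_q2_neq0 ?q_neq0.
Qed.

Lemma lam_shift_up K : q ^+ 4 * lam q (K + 2) = lam q K + (q ^+ 2 + q ^+ 4).
Proof.
have q0 := q_neq0 hq; have q1 := one_subr_q2_neq0 hq.
rewrite /lam; have -> : - (2 * (K + 2)) = - (2 * K) - 4 by lia.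
by rewrite expfzDr // -[q ^ (- 4)]/((q ^+ 4)^-1); field; rewrite q1 q0.
Qed.

Lemma lam_shift_down K : lam q (K - 2) = q ^+ 4 * lam q K - (q ^+ 2 + q ^+ 4).
Proof.
have q0 := q_neq0 hq; have q1 := one_subr_q2_neq0 hq.
rewrite /lam; have -> : - (2 * (K - 2)) = - (2 * K) + 4 by lia.
by rewrite expfzDr // -[q ^ 4]/(q ^+ 4); field.
Qed.

Definition cc_arg (M : nat) (K : int) : R :=
  (q ^ (- K) - q ^ M.-1%:Z) * (q ^ (- M.-1%:Z) - q ^ (- (K - 2))).

(** This factorization shows the sign and the zeros of the radicand: positive for 0 < j < M, zero at
    j = 0 and j = M. The position j = M, one past the index range, is included because c_{m+1}
    occurs in [nu]. *)
Lemma cc_argE M j : (0 < M)%N -> (j <= M)%N ->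
  cc_arg M ((2 * j)%:Z - M.-1%:Z) =
  ((q ^+ 2) ^+ j)^-1 * (1 - (q ^+ 2) ^+ j) * (1 - (q ^+ 2) ^+ (M - j)).
Proof.
move=> M0 jM; have q0 := q_neq0 hq; rewrite /cc_arg -!exprM.
set y := q ^ M.-1%:Z; set x := q ^ ((2 * j)%:Z - M.-1%:Z).
have x0 : x != 0 by rewrite expfz_neq0.
have y0 : y != 0 by rewrite expfz_neq0.
have -> : q ^ (- ((2 * j)%:Z - M.-1%:Z)) = x^-1 by rewrite invr_expz.
have -> : q ^ (- M.-1%:Z) = y^-1 by rewrite invr_expz.
have -> : q ^ (- ((2 * j)%:Z - M.-1%:Z - 2)) = x^-1 * q ^+ 2.
  by rewrite opprB addrC expfzDr // -invr_expz.
have -> : q ^+ (2 * j) = x * y.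
  by rewrite -expfzDr // subrK.
have -> : q ^+ (2 * (M - j)) = x^-1 * y * q ^+ 2.
  rewrite -[q ^+ 2]/(q ^ 2) invr_expz -!expfzDr //.
  by rewrite -[LHS]/(q ^ (2 * (M - j))%N%:Z); congr (q ^ _); lia.
by field; rewrite x0 y0.
Qed.

Lemma cc_arg_ge0 M j : (0 < M)%N -> (j <= M)%N ->
  0 <= cc_arg M ((2 * j)%:Z - M.-1%:Z).
Proof.
move=> M0 jM; rewrite cc_argE //.
have q2 := ltW sqr_q_gt0; have q21 := ltW (sqr_q_lt1 hq).
have N n : 0 <= 1 - (q ^+ 2) ^+ n by rewrite subr_ge0 exprn_ile1.
by rewrite !mulr_ge0 // invr_ge0 exprn_ge0.
Qed.

Lemma cc_sqr M j : (0 < M)%N -> (j <= M)%N ->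
  cc q M ((2 * j)%:Z - M.-1%:Z) ^+ 2 =
  (q / (1 - q ^+ 2)) ^+ 2 * cc_arg M ((2 * j)%:Z - M.-1%:Z).
Proof.
move=> M0 jM; rewrite /cc; case: ifPn => h.
  by rewrite exprMn sqr_sqrtr // cc_arg_ge0.
(* The convention c_{m+1} = 0 agrees with the formula, whose radicand vanishes there too. *)
have -> : j = M.
  apply/eqP; rewrite eqn_leq jM /= leqNgt; apply: contra h => jM'.
  by apply/idxP; exists j.
by rewrite cc_argE // subnn subrr mulr0 mulr0 expr0n.
Qed.

Lemma cc_bottom M : cc q M (- M.-1%:Z) = 0.
Proof.
rewrite /cc; case: ifP => // _.
by rewrite opprK subrr mul0r sqrtr0 mulr0.
Qed.

Lemma cc_top M : cc q M M.+1%:Z = 0.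
Proof.
clear hq; rewrite /cc; case: ifP => // /idxP[j jM e].
by exfalso; lia.
Qed.

Lemma cc_neq0 M j : (0 < j < M)%N -> cc q M ((2 * j)%:Z - M.-1%:Z) != 0.
Proof.
case/andP=> j0 jM; have M0 : (0 < M)%N by apply: leq_trans jM.
rewrite -sqrf_eq0 (cc_sqr M0 (ltnW jM)) (cc_argE M0 (ltnW jM)).
have q2 := sqr_q_gt0; have q21 := sqr_q_lt1 hq.
have N n : (0 < n)%N -> 1 - (q ^+ 2) ^+ n != 0.
  by move=> n0; rewrite subr_eq0 eq_sym lt_eqF // exprn_ilt1 ?ltW // -lt0n.
have a0 : (q / (1 - q ^+ 2)) ^+ 2 != 0.
  by rewrite expf_neq0 // mulf_neq0 ?invr_eq0 ?one_subr_q2_neq0 ?q_neq0.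
have b0 : (q ^+ 2) ^- j != 0 by rewrite invr_eq0 !expf_neq0 ?q_neq0.
have c0 : (0 < M - j)%N by rewrite subn_gt0.
exact: mulf_neq0 a0 (mulf_neq0 (mulf_neq0 b0 (N _ j0)) (N _ c0)).
Qed.

(** In terms of the fields this is q X2 = q^2 X3 X1 - X1 X3, the middle component of d d = 0, read
    on a matrix element. Here it is checked from the explicit formulas. *)
Lemma lam_cc M K : K \in idx M ->
  lam q K = cc q M K ^+ 2 - q ^+ 2 * cc q M (K + 2) ^+ 2.
Proof.
case/idxP=> j jM eK; have M0 : (0 < M)%N by apply: leq_trans jM.
have q0 := q_neq0 hq; have q1 := one_subr_q2_neq0 hq.
have eK2 : K + 2 = (2 * j.+1)%:Z - M.-1%:Z by lia.
rewrite eK2 (cc_sqr M0 jM) -eK2 eK (cc_sqr M0 (ltnW jM)) -eK /lam /cc_arg.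
have -> : - (K + 2 - 2) = - K by lia.
have -> : - (K + 2) = - K + - 2 by lia.
have -> : - (K - 2) = - K + 2 by lia.
have -> : - (2 * K) = - K + - K by lia.
rewrite !(expfzDr _ _ q0) -!invr_expz.
set x := q ^ K; set y := q ^ M.-1%:Z.
have x0 : x != 0 by rewrite expfz_neq0.
have y0 : y != 0 by rewrite expfz_neq0.
by field; rewrite ?x0 ?y0 ?q0 ?q1.
Qed.

(** Isolates the dependence on M, which enters only through q^-M + q^M. *)
Lemma nuE M K : K \in idx M ->
  nu q M K = (q / (1 - q ^+ 2)) ^+ 2 * (1 + q ^+ 4) * q ^ (- K - 1) * (q ^ (- M%:Z) + q ^+ M)
   + (lam q K ^+ 2 - (q / (1 - q ^+ 2)) ^+ 2 *
       (q ^ (- (2 * K)) * (q ^+ 4 + (q ^+ 2)^-1) + 1 + q ^+ 2)).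
Proof.
case/idxP=> j jM eK; have M0 : (0 < M)%N by apply: leq_trans jM.
have q0 := q_neq0 hq; have q1 := one_subr_q2_neq0 hq.
have eK2 : K + 2 = (2 * j.+1)%:Z - M.-1%:Z by lia.
rewrite /nu eK2 (cc_sqr M0 jM) -eK2 eK (cc_sqr M0 (ltnW jM)) -eK /cc_arg.
have -> : - (K + 2 - 2) = - K by lia.
have -> : - (K + 2) = - K + - 2 by lia.
have -> : - (K - 2) = - K + 2 by lia.
have -> : - (2 * K) = - K + - K by lia.
have -> : M.-1%:Z = M%:Z - 1 by lia.
have -> : - (M%:Z - 1) = - M%:Z + 1 by lia.
rewrite -[q ^+ M]/(q ^ M%:Z) !(expfzDr _ _ q0) -!invr_expz.
set x := q ^ K; set y := q ^ M%:Z.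
have x0 : x != 0 by rewrite expfz_neq0.
have y0 : y != 0 by rewrite expfz_neq0.
by field; rewrite ?x0 ?y0 ?q0 ?q1.
Qed.

(** The value y^-1 + y determines y up to inversion, and q^M q^M' = 1 forces M = M' = 0. Since [nu]
    also depends on K, degrees are separated only within one column. *)
Lemma nu_inj M M' K : K \in idx M -> K \in idx M' -> nu q M K = nu q M' K -> M = M'.
Proof.
have q0 := q_neq0 hq; have q1 := one_subr_q2_neq0 hq.
move=> h h'; rewrite !nuE // => /addIr /(mulfI _) e.
have {}e : q ^ (- M%:Z) + q ^+ M = q ^ (- M'%:Z) + q ^+ M'.
  apply: e; rewrite !mulf_neq0 ?expf_neq0 ?mulf_neq0 ?invr_eq0 ?expfz_neq0 //.
  by rewrite gt_eqF // ltr_pwDl // exprn_even_ge0.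
have : (q ^+ M' - q ^+ M) * (1 - q ^+ (M + M')) = 0.
  move: e; rewrite -!invr_expz -!exprnP exprD.
  set y := q ^+ M; set z := q ^+ M' => e.
  have y0 : y != 0 by rewrite expf_neq0.
  have z0 : z != 0 by rewrite expf_neq0.
  have -> : (z - y) * (1 - y * z) = y * z * ((y^-1 + y) - (z^-1 + z)).
    by field; rewrite y0 z0.
  by rewrite e subrr mulr0.
move/eqP; rewrite mulf_eq0 !subr_eq0 => /orP[/eqP e2|/eqP e2].
  by have := @exprz_q_inj M' M e2; lia.
by have := @exprz_q_inj 0 (M + M')%N e2; lia.
Qed.

Lemma idx_interior M K : K \in idx M.+2 -> - M.-1%:Z + 2 <= K <= M.-1%:Z - 2 ->
  [/\ K + 2 \in idx M, K \in idx M, K - 2 \in idx M, cc q M K != 0 & cc q M (K + 2) != 0].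
Proof.
move=> /idxP[j jM eK] hK.
have e0 : K + 2 = 2 * j%:Z - M.-1%:Z by lia.
have e1 : K = 2 * j.-1%:Z - M.-1%:Z by lia.
have e2 : K - 2 = 2 * (j%:Z - 2) - M.-1%:Z by lia.
split.
- by rewrite e0 mem_idx_int; lia.
- by rewrite e1 mem_idx_int; lia.
- by rewrite e2 mem_idx_int; lia.
- by rewrite e1; apply: cc_neq0; lia.
- by rewrite e0; apply: cc_neq0; lia.
Qed.

Lemma nu_gt0 M K : cc q M (K + 2) != 0 -> 0 < nu q M K.
Proof.
move=> c0; apply: ltr_pwDl; last by rewrite mulr_ge0 ?sqr_ge0.
apply: ltr_pwDl; last exact: sqr_ge0.
by rewrite lt_neqAle sqr_ge0 eq_sym expf_neq0.
Qed.

Section Roots.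
Variables (M : nat) (K : int).
Hypothesis nu0 : 0 < nu q M K.
Let s := Num.sqrt (Bk q K ^+ 2 - 4 * Ck q M K).

(** The product of the two roots is negative: they are real, nonzero and distinct, even when their
    squares agree. *)
Lemma Ck_lt0 : Ck q M K < 0.
Proof. by rewrite /Ck mulNr oppr_lt0 mulr_gt0 // exprn_even_gt0 //= q_neq0. Qed.

Let disc_gt0 : 0 < Bk q K ^+ 2 - 4 * Ck q M K.
Proof. by apply: ltr_wpDl; rewrite ?sqr_ge0 // oppr_gt0 pmulr_rlt0 // Ck_lt0. Qed.

Let root t : t ^+ 2 = s ^+ 2 ->
  (2^-1 * (Bk q K + t)) ^+ 2 - Bk q K * (2^-1 * (Bk q K + t)) + Ck q M K = 0.
Proof.
have sE : s ^+ 2 = Bk q K ^+ 2 - 4 * Ck q M K by rewrite sqr_sqrtr // ltW.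
move=> tE; transitivity ((t ^+ 2 - s ^+ 2) / 4); last by rewrite tE subrr mul0r.
by rewrite sE; move: (Bk q K) (Ck q M K) => B C; field.
Qed.

Lemma mu_plus_root : mu_plus q M K ^+ 2 - Bk q K * mu_plus q M K + Ck q M K = 0.
Proof. exact: root. Qed.

Lemma mu_minus_root : mu_minus q M K ^+ 2 - Bk q K * mu_minus q M K + Ck q M K = 0.
Proof. by apply: root; rewrite sqrrN. Qed.

Lemma mu_plus_neq_minus : mu_plus q M K != mu_minus q M K.
Proof.
have s0 : 0 < s by rewrite sqrtr_gt0.
rewrite -subr_eq0; have -> : mu_plus q M K - mu_minus q M K = s.
  by rewrite /mu_plus /mu_minus -/s; field.
by rewrite gt_eqF.
Qed.

(** Ensures that the eigenvector of [curl_eigen] is nonzero. If both factors vanished, their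
    difference would give lam = 0, hence mu = 0, which is no root since C_k is negative. *)
Lemma root_nondegenerate mu : mu ^+ 2 - Bk q K * mu + Ck q M K = 0 ->
  (q ^+ 3 * lam q K - mu != 0) || (- q ^+ 7 * lam q K - mu != 0).
Proof.
move=> chi; rewrite -negb_and; apply/negP => /andP[/eqP e1 /eqP e2].
have q0 := q_neq0 hq.
have l0 : lam q K = 0.
  have : q ^+ 3 * (1 + q ^+ 4) * lam q K = 0.
    transitivity ((q ^+ 3 * lam q K - mu) - (- q ^+ 7 * lam q K - mu)); first by ring.
    by rewrite e1 e2 subrr.
  have q40 : 0 < 1 + q ^+ 4 by rewrite ltr_pwDl // exprn_even_ge0.
  have h : q ^+ 3 * (1 + q ^+ 4) != 0 by rewrite mulf_neq0 ?expf_neq0 // gt_eqF.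
  by move/eqP; rewrite mulf_eq0 (negPf h) => /eqP.
have mu0 : mu = 0 by move: e1; rewrite l0 mulr0 sub0r => /eqP; rewrite oppr_eq0 => /eqP.
by move: chi; rewrite mu0 expr0n mulr0 subrr add0r => /eqP; rewrite lt_eqF // Ck_lt0.
Qed.

End Roots.

(** The first equation says that D^* kills the form with coordinates (x, y, z), the other three that
    it is an eigenvector of L for [mu]. *)
Definition eigen_eqs M K (x y z mu : R) :=
  [/\ - (cc q M (K + 2) * x) + lam q K * y + q * cc q M K * z = 0,
      - q ^+ 7 * (lam q K * x + cc q M (K + 2) * y) = mu * x,
      - q ^+ 7 * cc q M (K + 2) * x + q ^+ 5 * y - q ^+ 4 * cc q M K * z = mu * y &
      q ^+ 3 * lam q K * z - q ^+ 4 * cc q M K * y = mu * z].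

(* [mu^2 - B mu + C] is, up to the factor [-mu], the characteristic polynomial of the
   curl in the coordinates (x, y, z); the triple is, up to sign, the cross product of
   the first and last rows of [curl - mu]. *)
Lemma curl_eigen M K mu : K \in idx M ->
  mu ^+ 2 - Bk q K * mu + Ck q M K = 0 ->
  eigen_eqs M K (q ^+ 7 * cc q M (K + 2) * (q ^+ 3 * lam q K - mu))
    ((- q ^+ 7 * lam q K - mu) * (q ^+ 3 * lam q K - mu))
    (q ^+ 4 * cc q M K * (- q ^+ 7 * lam q K - mu)) mu.
Proof.
move=> KM; have := lam_cc KM; rewrite /Bk /Ck /nu /eigen_eqs.
move: (lam q K) (cc q M K) (cc q M (K + 2)) => l c c' /eqP lE chi.
have {}lE : l - c ^+ 2 + q ^+ 2 * c' ^+ 2 = 0.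
  by apply/eqP; rewrite -subr_eq0 opprB addrA addrAC in lE *.
split; apply/subr0_eq; rewrite ?subr0.
(* The first and third equations are explicit combinations of the quadratic equation for [mu] and of
   [lam_cc]; the second and fourth are polynomial identities. *)
- transitivity (l * (mu ^+ 2 - ((q ^+ 3 - q ^+ 7) * l + q ^+ 5) * mu +
     - q ^+ 10 * (c' ^+ 2 + l ^+ 2 + q ^+ 2 * c ^+ 2))
     + q ^+ 5 * mu * (l - c ^+ 2 + q ^+ 2 * c' ^+ 2)); first by ring.
  by rewrite chi lE !mulr0 addr0.
- by ring.
- transitivity (- mu * (mu ^+ 2 - ((q ^+ 3 - q ^+ 7) * l + q ^+ 5) * mu +
     - q ^+ 10 * (c' ^+ 2 + l ^+ 2 + q ^+ 2 * c ^+ 2))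
     + (- q ^+ 15 * l + (q ^+ 12 - q ^+ 8) * mu) * (l - c ^+ 2 + q ^+ 2 * c' ^+ 2)); first by ring.
  by rewrite chi lE !mulr0 addr0.
- by ring.
Qed.



End Scalars.

(** * The adjoint of the differential *)

Section InnerProduct.
Variables (C : numClosedFieldType) (V : lmodType C) (ip : V -> V -> C).
Hypothesis hip : inner_product ip.

Lemma ip_linear_l a u v w : ip (a *: u + v) w = a * ip u w + ip v w.
Proof. by case: hip. Qed.
Lemma ip_conj u v : ip v u = (ip u v)^*. Proof. by case: hip. Qed.
Lemma ip_gt0 v : v != 0 -> 0 < ip v v. Proof. by case: hip => _ _; apply. Qed.

Lemma ipDl u v w : ip (u + v) w = ip u w + ip v w.
Proof. by rewrite -[u]scale1r ip_linear_l mul1r scale1r. Qed.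
Lemma ip0l w : ip 0 w = 0.
Proof. by apply: (addrI (ip 0 w)); rewrite -ipDl !addr0. Qed.
Lemma ipZl a u w : ip (a *: u) w = a * ip u w.
Proof. by rewrite -[a *: u]addr0 ip_linear_l ip0l addr0. Qed.
Lemma ipDr u v w : ip u (v + w) = ip u v + ip u w.
Proof. by rewrite ip_conj ipDl rmorphD [ip u v]ip_conj [ip u w]ip_conj. Qed.
Lemma ipZr a u w : ip u (a *: w) = a^* * ip u w.
Proof. by rewrite ip_conj ipZl rmorphM [ip u w]ip_conj. Qed.
Lemma ip0r w : ip w 0 = 0.
Proof. by rewrite ip_conj ip0l rmorph0. Qed.
Lemma ipNr u w : ip u (- w) = - ip u w.
Proof. by rewrite -scaleN1r ipZr rmorphN1 mulN1r. Qed.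
Lemma ip_suml (I : Type) (s : seq I) (F : I -> V) w :
  ip (\sum_(k <- s) F k) w = \sum_(k <- s) ip (F k) w.
Proof.
elim: s => [|k s IH]; first by rewrite !big_nil ip0l.
by rewrite !big_cons ipDl IH.
Qed.
Lemma ip_sumr (I : Type) (s : seq I) (F : I -> V) w :
  ip w (\sum_(k <- s) F k) = \sum_(k <- s) ip w (F k).
Proof.
elim: s => [|k s IH]; first by rewrite !big_nil ip0r.
by rewrite !big_cons ipDr IH.
Qed.
Lemma ip_eq0 v : ip v v = 0 -> v = 0.
Proof. by move=> e; apply/eqP/negPn/negP => /ip_gt0; rewrite e ltxx. Qed.
Lemma ip_inj u v : (forall w, ip w u = ip w v) -> u = v.
Proof.
by move=> e; apply/subr0_eq/ip_eq0; rewrite ipDr ipNr e subrr.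
Qed.

Lemma orth_free n (b : 'I_n -> V) :
  (forall k, b k != 0) -> (forall k l, k != l -> ip (b k) (b l) = 0) ->
  forall c : 'I_n -> C, \sum_k c k *: b k = 0 -> forall k, c k = 0.
Proof.
move=> nz orth c e k; move/(congr1 (fun v => ip v (b k))): e.
rewrite ip0l ip_suml (bigD1 k) //= big1 ?addr0 => [|l lk].
  by rewrite ipZl => /eqP; rewrite mulf_eq0 (gt_eqF (ip_gt0 (nz k))) orbF => /eqP.
by rewrite ipZl orth ?mulr0.
Qed.

End InnerProduct.

Section Codifferential.
Variables (R : realType) (q : R) (A : starAlg R[i]) (alpha gamma : A).
Variable (Om : calculus3D q alpha gamma).
Hypothesis (hq : 0 < `|q| < 1).
Local Notation Q := (q%:C : R[i]).
Local Notation i := (incl Om).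
Local Notation e1 := (eta1 Om).
Local Notation e2 := (eta2 Om).
Local Notation e3 := (eta3 Om).
Local Notation J0 := (J0 Om).
Local Notation J1 := (J1 Om).
Local Notation J2 := (J2 Om).
Local Notation J3 := (J3 Om).

Variable h : {scalar A}.
Variables (ip : Om -> Om -> R[i]) (dstar : Om -> Om).
Hypotheses (hip : inner_product ip) (hleft : left_invariant h ip).
Hypothesis hon : orthonormal_basis ip (orthonormal_forms Om) (Omega_inv Om).
Hypothesis hdstar : is_adjoint ip (diff Om) dstar.
Local Notation hf := (hform h).

Lemma hformDl a b c : hf (a + b) c = hf a c + hf b c.
Proof. by rewrite /hform mulrDr raddfD. Qed.
Lemma hformDr a b c : hf a (b + c) = hf a b + hf a c.
Proof. by rewrite /hform adj_D mulrDl raddfD. Qed.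
Lemma hformZl k a c : hf (k *: a) c = k * hf a c.
Proof. by rewrite /hform -scalerAr linearZ. Qed.
Lemma hformZr k a c : hf a (k *: c) = k^* * hf a c.
Proof. by rewrite /hform adj_Z -scalerAl linearZ. Qed.
Lemma hformNl a c : hf (- a) c = - hf a c.
Proof. by rewrite /hform mulrN raddfN. Qed.
Lemma hformNr a c : hf a (- c) = - hf a c.
Proof. by rewrite /hform adj_N mulNr raddfN. Qed.
Lemma hform0l c : hf 0 c = 0.
Proof. by rewrite /hform mulr0 raddf0. Qed.
Lemma hform0r c : hf c 0 = 0.
Proof. by rewrite /hform adj_0 mul0r raddf0. Qed.

Lemma orthonormal_forms_inv k : (k < 8)%N -> Omega_inv Om (orthonormal_forms Om)`_k.
Proof.
move=> k8; rewrite hon.1; exists (fun l => (l == k)%:R).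
rewrite (bigD1 (Ordinal (k8 : (k < size (orthonormal_forms Om))%N))) //= eqxx scale1r big1 ?addr0 //.
by move=> l lk; rewrite -val_eqE /= in lk; rewrite (negPf lk) scale0r.
Qed.

Lemma ip_orthonormal (a b : nat -> A) (F := orthonormal_forms Om) :
  ip (\sum_(k < 8) i (a k) * F`_k) (\sum_(k < 8) i (b k) * F`_k)
  = \sum_(k < 8) hf (a k) (b k).
Proof.
rewrite (ip_suml hip); apply: eq_bigr => k _.
rewrite (ip_sumr hip) (bigD1 k) //= big1 ?addr0 => [|l lk].
  rewrite hleft; try exact: orthonormal_forms_inv (ltn_ord _).
  by rewrite hon.2 ?eqxx ?mulr1 //; apply: ltn_ord.
rewrite hleft; try exact: orthonormal_forms_inv (ltn_ord _).
rewrite hon.2; try exact: ltn_ord.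
by rewrite -val_eqE eq_sym in lk; rewrite (negPf lk) mulr0.
Qed.

Lemma J_sum a0 a1 a2 a3 b1 b2 b3 b0 :
  J0 a0 + J1 a1 a2 a3 + J2 b1 b2 b3 + J3 b0 =
  \sum_(k < 8) i ([:: a0; a1; a2; a3; b1; b3; b2; b0]`_k) * (orthonormal_forms Om)`_k.
Proof.
rewrite !big_ord_recl big_ord0 /= /bump /= mulr1 addr0 !addrA.
by congr (_ + _); rewrite addrAC.
Qed.

(** In these coordinates [Om] is an orthogonal sum of eight copies of [A] with the form <a, b>, so
    adjoints are computed entrywise. *)
Lemma ip_J a0 a1 a2 a3 b1 b2 b3 b0 a0' a1' a2' a3' b1' b2' b3' b0' :
  ip (J0 a0 + J1 a1 a2 a3 + J2 b1 b2 b3 + J3 b0)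
     (J0 a0' + J1 a1' a2' a3' + J2 b1' b2' b3' + J3 b0') =
  hf a0 a0' + (hf a1 a1' + hf a2 a2' + hf a3 a3') +
  (hf b1 b1' + hf b2 b2' + hf b3 b3') + hf b0 b0'.
Proof.
rewrite !J_sum (ip_orthonormal (nth 0 _) (nth 0 _)).
by rewrite !big_ord_recl big_ord0 /= /bump /=; ring.
Qed.

Variables X1 X2 X3 : A -> A.
Hypothesis diff_incl : forall a, diff Om (i a) = J1 (X1 a) (X2 a) (X3 a).
Hypothesis X_adj : forall a b,
  [/\ hf (X1 a) b = - Q^-1 * hf a (X3 b), hf (X2 a) b = hf a (X2 b)
    & hf (X3 a) b = - Q * hf a (X1 b)].

Local Notation codiv := (codiv q X1 X2 X3).
Local Notation curl1 := (curl1 q X1 X2).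
Local Notation curl2 := (curl2 q X1 X3).
Local Notation curl3 := (curl3 q X2 X3).

Lemma diff_J a0 a1 a2 a3 b1 b2 b3 b0 :
  diff Om (J0 a0 + J1 a1 a2 a3 + J2 b1 b2 b3 + J3 b0) =
  J0 0 + J1 (X1 a0) (X2 a0) (X3 a0)
  + J2 (curl1 a1 a2) (curl2 a1 a2 a3) (curl3 a2 a3) + J3 (- codiv b1 b2 b3).
Proof.
have D u v : diff Om (u + v) = diff Om u + diff Om v by rewrite linearD.
rewrite (D _ (J3 b0)) (D _ (J2 b1 b2 b3)) (D (J0 a0)) diff_J3 addr0 (diff_J2 hq diff_incl) (diff_J1 hq diff_incl).
by rewrite J0_0 add0r diff_incl.
Qed.

Lemma hform_X1r a b : hf a (X1 b) = - Q^-1 * hf (X3 a) b.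
Proof.
by have [_ _ ->] := X_adj a b; rewrite mulrA mulrNN mulVf ?mul1r ?qC_neq0.
Qed.

Lemma hform_X3r a b : hf a (X3 b) = - Q * hf (X1 a) b.
Proof.
by have [-> _ _] := X_adj a b; rewrite mulrA mulrNN mulfV ?mul1r ?qC_neq0.
Qed.

Lemma hform_X2r a b : hf a (X2 b) = hf (X2 a) b.
Proof. by have [_ -> _] := X_adj a b. Qed.

(** Testing against an arbitrary form identifies the adjoint. The symmetry of L appears as the reuse
    of the [curl] operators on 2-forms. *)
Lemma dstar_J a0 a1 a2 a3 b1 b2 b3 b0 :
  dstar (J0 a0 + J1 a1 a2 a3 + J2 b1 b2 b3 + J3 b0) =
  J0 (codiv a1 a2 a3) + J1 (curl1 b1 b2) (curl2 b1 b2 b3) (curl3 b2 b3)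
  + J2 (- X1 b0) (- X2 b0) (- X3 b0) + J3 0.
Proof.
apply: (ip_inj hip) => w; rewrite -hdstar.
have [u0 [u1 [u2 [u3 [v1 [v2 [v3 [v0 ->]]]]]]]] := J_span hq w.
have Q0 := qC_neq0 hq.
rewrite diff_J !ip_J /codiv /curl1 /curl2 /curl3.
rewrite !(hformDl, hformDr, hformNl, hformNr, hform0l, hform0r, hformZl, hformZr).
rewrite !(hform_X1r, hform_X2r, hform_X3r).
have Qr : Q \is Num.real by apply/CrealP/conj_qC.
rewrite !conj_Creal ?(rpredN, rpredM, rpredD, rpredV, rpredX, Qr) //.
(* Moving X1 and X3 across the form creates factors Q^-1. They are cancelled here, so that once the
   values of the form are generalized the goal is an identity for [ring]. *)
have k1 (x : R[i]) : - Q^-1 * (- Q * x) = x by rewrite mulrA mulrNN mulVf ?mul1r.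
have k2 (x : R[i]) : Q * (- Q^-1 * x) = - x by rewrite mulrA mulrN mulfV ?mulN1r.
have k7 (x : R[i]) : Q ^+ 7 * (- Q^-1 * x) = - Q ^+ 6 * x by rewrite exprSr -mulrA k2 mulrN mulNr.
have k4 (x : R[i]) : Q ^+ 4 * (- Q^-1 * x) = - Q ^+ 3 * x by rewrite exprSr -mulrA k2 mulrN mulNr.
rewrite k1 k2 k7 k4.
do ?[move: (hf (_ u0) _) | move: (hf (_ u1) _) | move: (hf (_ u2) _) | move: (hf (_ u3) _)
  | move: (hf (_ v1) _) | move: (hf (_ v2) _) | move: (hf (_ v3) _) | move: (hf u1 _)
  | move: (hf u2 _) | move: (hf u3 _)].
by move=> *; ring.
Qed.

End Codifferential.

(** * Matrix elements and their orthogonality *)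

Section Representations.
Variables (R : realType) (q : R) (A : starAlg R[i]) (alpha gamma : A).
Hypotheses (hq : 0 < `|q| < 1) (hA : is_SUq2 q alpha gamma).
Variables (T : tensorSquare A) (Delta : {lrmorphism A -> T}).
Hypothesis hDelta : is_comult q alpha gamma Delta.
Variables (chi1 chi2 chi3 : {scalar A}) (W : nat -> int -> int -> A).
Hypothesis hW : is_woronowicz_reps q Delta chi1 chi2 chi3 W.
Local Notation Q := (q%:C : R[i]).

Lemma convol_linear (chi : {scalar A}) : linear (convol Delta chi).
Proof. by move=> c x y; rewrite /convol linearP slice_right_linear. Qed.

Lemma W_convol (chi : {scalar A}) M p k : W_index (M, p, k) ->
  convol Delta chi (W M p k) = \sum_(i <- idx M) chi (W M i k) *: W M p i.
Proof.
move=> hi; rewrite /convol; have [-> // _ _ _] := hW.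
rewrite (sum_of_linear (slice_right_linear chi)).
by apply: eq_bigr => i _; rewrite slice_rightE.
Qed.

Lemma sum_delta M (V : lmodType R[i]) (c : R[i]) (J : int) (F : int -> V) :
  \sum_(i <- idx M) (if i == J then c else 0) *: F i = if J \in idx M then c *: F J else 0.
Proof.
case: ifP => h.
  rewrite (bigD1_seq J) ?idx_uniq //= eqxx big1 ?addr0 // => i /negPf ->.
  by rewrite scale0r.
rewrite big_seq big1 // => i hi; case: eqP => [e|]; last by rewrite scale0r.
by rewrite -e hi in h.
Qed.

Variables (M : nat) (p : int).
Hypotheses (M_gt0 : (0 < M)%N) (pM : p \in idx M).

Lemma W_indexT K : K \in idx M -> W_index (M, p, K).
Proof. by move=> h; rewrite /W_index /= M_gt0 pM. Qed.

Lemma chi_W i k : i \in idx M -> k \in idx M ->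
  [/\ chi1 (W M i k) = (if i == k + 2 then - cc q M (k + 2) else 0)%:C,
      chi2 (W M i k) = (if i == k then lam q k else 0)%:C &
      chi3 (W M i k) = (if i == k - 2 then q * cc q M k else 0)%:C].
Proof.
by move=> hi hk; have [_ _ h _] := hW; apply: h; rewrite /W_index /= M_gt0 hi.
Qed.

(** With [W0] this holds for every K, also outside the index range, so the boundary cases of
    E_1(M,p,k) need no separate formulas. *)
Lemma field1_W K : convol Delta chi1 (W0 W M p K) =
  - (cc q M (K + 2))%:C *: W0 W M p (K + 2).
Proof.
rewrite /W0; case: (boolP (K \in idx M)) => hK; last first.
  (* Just below the range the left side is 0 although the shifted matrix element is not; its
     coefficient c_{-m} vanishes. *)
  rewrite (linear_0 (convol_linear _)); case: ifP => hK2; last by rewrite scaler0.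
  have /idx_shift_down -> : K + 2 - 2 \notin idx M by rewrite addrK.
    by rewrite cc_bottom oppr0 scale0r.
  by [].
rewrite W_convol ?W_indexT // big_seq.
rewrite (eq_bigr (fun i => (if i == K + 2 then - (cc q M (K + 2))%:C else 0) *: W M p i)).
  by rewrite -big_seq sum_delta; case: ifP => //; rewrite scaler0.
move=> i hi; have [-> _ _] := chi_W hi hK.
by case: ifP; rewrite ?rmorphN ?rmorph0.
Qed.

Lemma field2_W K : convol Delta chi2 (W0 W M p K) = (lam q K)%:C *: W0 W M p K.
Proof.
rewrite /W0; case: (boolP (K \in idx M)) => hK; last first.
  by rewrite (linear_0 (convol_linear _)) scaler0.
rewrite W_convol ?W_indexT // big_seq.
rewrite (eq_bigr (fun i => (if i == K then (lam q K)%:C else 0) *: W M p i)).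
  by rewrite -big_seq sum_delta hK.
move=> i hi; have [_ -> _] := chi_W hi hK.
by case: ifP; rewrite ?rmorph0.
Qed.

Lemma field3_W K : convol Delta chi3 (W0 W M p K) =
  (q * cc q M K)%:C *: W0 W M p (K - 2).
Proof.
rewrite /W0; case: (boolP (K \in idx M)) => hK; last first.
  rewrite (linear_0 (convol_linear _)) /cc (negPf hK) mulr0 scale0r //.
rewrite W_convol ?W_indexT // big_seq.
rewrite (eq_bigr (fun i => (if i == K - 2 then (q * cc q M K)%:C else 0) *: W M p i)).
  by rewrite -big_seq sum_delta; case: ifP => //; rewrite scaler0.
move=> i hi; have [_ _ ->] := chi_W hi hK.
by case: ifP; rewrite ?rmorph0.
Qed.

Section Counit.
Variable e : {lrmorphism A -> regular_starAlg R}.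
Hypotheses (e_alpha : e alpha = 1) (e_gamma : e gamma = 0).
Hypothesis e_adj : forall x, e (adj x) = (e x)^*.

Let es : {scalar A} := e.

(** Slicing by a character is multiplicative, so it suffices to look at the generators. *)
Lemma counit_right a : slice_right (T := T) es (Delta a) = a.
Proof.
have [Ds Da Dc] := hDelta.
have slZ := linear_Z (slice_right_linear es); have slD := linear_D (slice_right_linear es).
have slM u v : slice_right (T := T) es (u * v) = slice_right es u * slice_right es v.
  move: u; apply: tens_ext.
  - by move=> c x y; rewrite mulrDl -scalerAl slice_right_linear.
  - by move=> c x y; rewrite slice_right_linear mulrDl -scalerAl.
  move=> x y; move: v; apply: tens_ext.
  - by move=> c u v; rewrite mulrDr -scalerAr slice_right_linear.
  - by move=> c u v; rewrite slice_right_linear mulrDr -scalerAr.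
  move=> x' y'; rewrite tensM !slice_rightE /= rmorphM -scalerAl -scalerAr scalerA.
  by [].
elim/(SUq2_ind hA) : a.
- by rewrite rmorph1 -(tens1 T) slice_rightE /= rmorph1 scale1r.
- by move=> c x y ex ey; rewrite linearP slice_right_linear ex ey.
- by move=> x y ex ey; rewrite rmorphM slM ex ey.
- by rewrite Da -scaleNr slD slZ !slice_rightE /= e_alpha e_gamma !scale0r scaler0 addr0 scale1r.
- by rewrite Dc slD !slice_rightE /= e_alpha e_gamma !scale0r addr0 scale1r.
- rewrite Ds Da -scaleNr adj_D adj_Z !tens_adj slD slZ !slice_rightE /= !e_adj e_alpha e_gamma.
  by rewrite conjC0 conjC1 !scale0r scaler0 addr0 scale1r.
- rewrite Ds Dc adj_D !tens_adj slD !slice_rightE /= !e_adj e_alpha e_gamma.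
  by rewrite conjC0 conjC1 !scale0r addr0 scale1r.
Qed.

(** Apply [counit_right] to the entry (p, k) and compare coefficients in the linearly independent
    p-th row. *)
Lemma counit_W i k : i \in idx M -> k \in idx M -> e (W M i k) = (i == k)%:R.
Proof.
move=> hi hk; have [_ _ _ [free _]] := hW.
have ci : W_index (M, p, k) by exact: W_indexT.
have := counit_right (W M p k); have [-> // _ _ _] := hW.
rewrite (sum_of_linear (slice_right_linear es)) => /eqP.
rewrite -subr_eq0 => /eqP h.
have := free [seq (M, p, j) | j <- idx M] (fun t => e (W M t.2 k) - (t.2 == k)%:R).
rewrite map_inj_uniq ?idx_uniq => [|x y [] //].
have -> : all W_index [seq (M, p, j) | j <- idx M].
  by apply/allP => _ /mapP[j hj ->]; exact: W_indexT.
move=> /(_ isT isT); rewrite big_map /= => H.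
apply/eqP; rewrite -subr_eq0; apply/eqP.
apply: (H _ (M, p, i)); last by apply/mapP; exists i.
rewrite -[RHS]h -[X in _ - X](_ : \sum_(j <- idx M) (if j == k then 1 else 0) *: W M p j = _).
  rewrite -sumrB; apply: eq_bigr => j _; rewrite slice_rightE scalerBl.
  by case: eqP.
by rewrite sum_delta hk scale1r.
Qed.

End Counit.
End Representations.

Lemma conj_RC (R : realType) (x : R) : (x%:C : R[i])^* = x%:C.
Proof. exact: conjc_real. Qed.

(** * Orthogonality of the matrix elements for the Haar form *)

Section Orthogonality.
Variables (R : realType) (q : R) (A : starAlg R[i]) (alpha gamma : A).
Hypotheses (hq : 0 < `|q| < 1) (hA : is_SUq2 q alpha gamma).
Variables (T : tensorSquare A) (Delta : {lrmorphism A -> T}).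
Hypothesis hDelta : is_comult q alpha gamma Delta.
Variables (chi1 chi2 chi3 : {scalar A}) (W : nat -> int -> int -> A).
Hypothesis hW : is_woronowicz_reps q Delta chi1 chi2 chi3 W.
Local Notation Q := (q%:C : R[i]).
Variable h : {scalar A}.
Hypothesis hh : is_haar Delta h.
Local Notation hf := (hform h).
Local Notation X1 := (convol Delta chi1).
Local Notation X2 := (convol Delta chi2).
Local Notation X3 := (convol Delta chi3).
Variable f : {lrmorphism A -> A}.
Hypothesis X2_twist : forall a, X2 a = (Q ^+ 2 / (1 - Q ^+ 2)) *: (f a - a).
Hypothesis X2_star : forall a, X2 (adj a) = - f (adj (X2 a)).
Hypothesis X_adj : forall a b,
  [/\ hf (X1 a) b = - Q^-1 * hf a (X3 b), hf (X2 a) b = hf a (X2 b)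
    & hf (X3 a) b = - Q * hf a (X1 b)].

Let W_K M p K : (0 < M)%N -> p \in idx M -> K \in idx M -> W0 W M p K = W M p K.
Proof. by move=> _ _; rewrite /W0 => ->. Qed.

Let kappa0 : Q ^+ 2 / (1 - Q ^+ 2) != 0.
Proof. by rewrite mulf_neq0 ?invr_eq0 ?expf_neq0 ?qC_neq0 ?one_subr_qC2_neq0. Qed.

Let lamC K : (lam q K)%:C = Q ^+ 2 / (1 - Q ^+ 2) * ((q ^ (- (2 * K)))%:C - 1).
Proof. by rewrite /lam !(rmorphM, rmorphB, fmorphV, rmorphXn, rmorph1). Qed.

Let lamZ K (a : A) :
  (lam q K)%:C *: a = (Q ^+ 2 / (1 - Q ^+ 2)) *: ((q ^ (- (2 * K)))%:C *: a - a).
Proof. by rewrite lamC -scalerA scalerBl scale1r. Qed.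

Lemma twist_W M p K : (0 < M)%N -> p \in idx M -> K \in idx M ->
  f (W M p K) = (q ^ (- (2 * K)))%:C *: W M p K.
Proof.
move=> M0 pM KM; have := field2_W hW M0 pM K; rewrite W_K // X2_twist.
rewrite lamZ => /(scalerI kappa0) e.
by rewrite -[LHS](subrK (W M p K)) e subrK.
Qed.

(** The twist does not commute with the involution. The weight of the adjoint comes from [X2_star],
    which makes it the inverse of the weight in [twist_W]. *)
Lemma twist_adj_W M p K : (0 < M)%N -> p \in idx M -> K \in idx M ->
  f (adj (W M p K)) = (q ^ (2 * K))%:C *: adj (W M p K).
Proof.
move=> M0 pM KM; have := X2_star (W M p K).
have := field2_W hW M0 pM K; rewrite W_K // => ->.
rewrite X2_twist adj_Z conj_RC linearZ /= lamZ -scalerN => /(scalerI kappa0).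
rewrite opprB => /addrI /oppr_inj {2}->.
rewrite scalerA -rmorphM -expfzDr ?q_neq0 //.
have -> : 2 * K + - (2 * K) = 0 by lia.
by rewrite expr0z rmorph1 scale1r.
Qed.

(* Columns, degrees and rows are separated by the self-adjoint operators [X2], [casimir]
   and by a character, respectively. *)
Lemma W_orthogonal_columns M M' p p' K K' : (0 < M)%N -> (0 < M')%N ->
  p \in idx M -> p' \in idx M' -> K \in idx M -> K' \in idx M' -> K != K' ->
  hf (W M p K) (W M' p' K') = 0.
Proof.
move=> M0 M0' pM pM' KM KM' KK'.
have [_ + _] := X_adj (W M p K) (W M' p' K').
have := field2_W hW M0 pM K; rewrite W_K // => ->.
have := field2_W hW M0' pM' K'; rewrite W_K // => ->.
rewrite hformZl hformZr conj_RC => /eqP.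
rewrite -subr_eq0 -mulrBl mulf_eq0 -rmorphB fmorph_eq0 subr_eq0.
by rewrite (inj_eq (lam_inj hq)) (negPf KK') => /eqP.
Qed.

(** This is D^* D, the Laplacian on functions, expressed by the vector fields alone. *)
Definition casimir a := codiv q X1 X2 X3 (X1 a) (X2 a) (X3 a).

Lemma casimir_adj a b : hf (casimir a) b = hf a (casimir b).
Proof.
have Qr : Q \is Num.real by apply/CrealP/conj_qC.
have X1r u v : hf u (X1 v) = - Q^-1 * hf (X3 u) v.
  by have [_ _ ->] := X_adj u v; rewrite mulrA mulrNN mulVf ?mul1r ?(qC_neq0 hq).
have X3r u v : hf u (X3 v) = - Q * hf (X1 u) v.
  by have [-> _ _] := X_adj u v; rewrite mulrA mulrNN mulfV ?mul1r ?(qC_neq0 hq).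
have X2r u v : hf u (X2 v) = hf (X2 u) v by have [_ -> _] := X_adj u v.
rewrite /casimir /codiv !(hformDl, hformDr, hformNl, hformNr, hformZl, hformZr).
rewrite !conj_Creal ?(rpredN, rpredV, Qr) // -!mulNr.
rewrite -(X1r (X1 a)) -(X3r (X3 a)) -(X2r (X2 a)).
have [<- _ _] := X_adj a (X1 b); have [_ <- _] := X_adj a (X2 b).
by have [_ _ <-] := X_adj a (X3 b).
Qed.

Lemma nuC M K : (nu q M K)%:C =
  (cc q M (K + 2))%:C ^+ 2 + (lam q K)%:C ^+ 2 + Q ^+ 2 * (cc q M K)%:C ^+ 2.
Proof. by rewrite /nu !rmorphD !rmorphXn (rmorphM _ (q ^+ 2)) !rmorphXn. Qed.

Lemma casimir_W M p K : (0 < M)%N -> p \in idx M ->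
  casimir (W0 W M p K) = (nu q M K)%:C *: W0 W M p K.
Proof.
move=> M0 pM; rewrite /casimir /codiv.
rewrite (field1_W hW M0 pM) (field2_W hW M0 pM) (field3_W hW M0 pM).
rewrite !(linear_Z (convol_linear _ _)).
rewrite (field1_W hW M0 pM) (field2_W hW M0 pM) (field3_W hW M0 pM).
rewrite addrK subrK !scalerA -scalerDl -scalerBl; congr (_ *: _).
rewrite nuC !(rmorphM (real_complex R) q) /=.
have Q0 := qC_neq0 hq.
by field.
Qed.

Lemma W_orthogonal_degrees M M' p p' K : (0 < M)%N -> (0 < M')%N ->
  p \in idx M -> p' \in idx M' -> K \in idx M -> K \in idx M' -> M != M' ->
  hf (W M p K) (W M' p' K) = 0.
Proof.
move=> M0 M0' pM pM' KM KM' MM'.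
have := casimir_adj (W M p K) (W M' p' K).
have := casimir_W K M0 pM; rewrite W_K // => ->.
have := casimir_W K M0' pM'; rewrite W_K // => ->.
rewrite hformZl hformZr conj_RC => /eqP.
rewrite -subr_eq0 -mulrBl mulf_eq0 -rmorphB fmorph_eq0 subr_eq0.
case/orP => /eqP // /(nu_inj hq KM KM') e.
by rewrite e eqxx in MM'.
Qed.

(* Apply the character [counit \o f], which is q^(-2p) on the p-th diagonal entry, to the
   invariance relation (id (x) h) Delta(a) = h(a) 1: it multiplies the left side by
   q^(2(p' - p)). *)
Lemma W_orthogonal_rows M p p' K : (0 < M)%N ->
  p \in idx M -> p' \in idx M -> K \in idx M -> p != p' ->
  hf (W M p K) (W M p' K) = 0.
Proof.
move=> M0 pM pM' KM pp'.
have [e [ea ec e_adj]] := counit_exists hA.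
have [_ hr _ _ _] := hh.
have [Ds _ _] := hDelta; have [DW _ _ _] := hW.
pose L (u : T) : R[i] := e (f (slice_right h u)).
have Ll : linear (L : T -> R[i]^o).
  by move=> c u v; rewrite /L slice_right_linear !linearP.
have Lt x y : L (tens T x y) = h y * e (f x).
  by rewrite /L slice_rightE !linearZ.
have La : L (Delta (adj (W M p' K) * W M p K)) = hf (W M p K) (W M p' K).
  by rewrite /L hr !linearZ /= !rmorph1 /GRing.scale /= mulr1.
have ew j : j \in idx M -> e (f (W M p j)) = (q ^ (- (2 * j)))%:C * (p == j)%:R.
  by move=> jM; rewrite twist_W // linearZ /= (counit_W hA hDelta hW M0 pM ea ec e_adj).
have ew' j : j \in idx M -> e (f (adj (W M p' j))) = (q ^ (2 * j))%:C * (p' == j)%:R.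
  move=> jM; rewrite twist_adj_W // linearZ /= e_adj.
  by rewrite (counit_W hA hDelta hW M0 pM ea ec e_adj) // conjC_nat.
have DE : Delta (adj (W M p' K) * W M p K) =
    \sum_(i <- idx M) \sum_(j <- idx M)
      tens T (adj (W M p' i) * W M p j) (adj (W M i K) * W M j K).
  transitivity (Delta (adj (W M p' K)) * Delta (W M p K)); first exact: rmorphM.
  rewrite Ds !DW ?W_indexT // adj_sum mulr_suml; apply: eq_bigr => i _.
  by rewrite mulr_sumr; apply: eq_bigr => j _; rewrite tens_adj tensM.
move: La; rewrite DE (sum_of_linear Ll) (bigD1_seq p') ?idx_uniq //=.
rewrite [X in _ + X]big1_seq ?addr0 => [|i /andP[ip' iM]]; last first.
  rewrite (sum_of_linear Ll) big1_seq // => j _.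
  by rewrite Lt !rmorphM /= ew' // eq_sym (negPf ip') mulr0 mul0r mulr0.
rewrite (sum_of_linear Ll) (bigD1_seq p) ?idx_uniq //=.
rewrite [X in _ + X]big1_seq ?addr0 => [|j /andP[jp jM]]; last first.
  by rewrite Lt !rmorphM /= ew // eq_sym (negPf jp) mulr0 mulr0 mulr0.
rewrite Lt !rmorphM /= ew // ew' // !eqxx !mulr1 -rmorphM -expfzDr ?q_neq0 // => /eqP.
rewrite -[X in _ == X]mulr1 -subr_eq0 -mulrBr mulf_eq0 => /orP[/eqP //|].
rewrite -(rmorph1 (real_complex R)) -rmorphB fmorph_eq0 subr_eq0 => /eqP e1.
have := @exprz_q_inj _ _ hq (2 * p' + - (2 * p)) 0 e1.
by move=> e2; case/eqP: pp'; lia.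
Qed.

Theorem W_orthogonal M M' p p' K K' : W_index (M, p, K) -> W_index (M', p', K') ->
  (M, p, K) != (M', p', K') -> hf (W M p K) (W M' p' K') = 0.
Proof.
rewrite /W_index /= => /and3P[M0 pM KM] /and3P[M0' pM' KM'].
have [eK|] := eqVneq K K'; last by move=> *; apply: W_orthogonal_columns.
rewrite -eK in KM' *; have [eM|] := eqVneq M M'.
  rewrite -eM in KM' pM' *; have [->|pp' _] := eqVneq p p'; first by rewrite eqxx.
  exact: W_orthogonal_rows.
by move=> *; apply: W_orthogonal_degrees.
Qed.



End Orthogonality.

(** * Spans, dimensions and eigenvalue lists *)

Section Span.
Variables (F : fieldType) (V : lmodType F).
Implicit Types (s : seq V) (E : set V).

Lemma lin_span_cons x s v :
  lin_span (x :: s) v <-> exists a w, lin_span s w /\ v = a *: x + w.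
Proof.
split=> [[c ->]|[a [_ [[c ->] ->]]]].
  exists (c 0%N), (\sum_(k < size s) c k.+1 *: s`_k); split; first by exists (fun k => c k.+1).
  by rewrite /= big_ord_recl.
by exists (fun k => if k is l.+1 then c l else a); rewrite /= big_ord_recl.
Qed.

Lemma lin_span_nil v : lin_span ([::] : seq V) v <-> v = 0.
Proof. by split=> [[c ->]|->]; [rewrite big_ord0 | exists (fun=> 0); rewrite big_ord0]. Qed.

Lemma lin_span_lin s a u v : lin_span s u -> lin_span s v -> lin_span s (a *: u + v).
Proof.
elim: s u v => [|x s IH] u v.
  by rewrite !lin_span_nil => -> ->; rewrite scaler0 addr0.
move=> /lin_span_cons[b [u' [su ->]]] /lin_span_cons[c [v' [sv ->]]]; apply/lin_span_cons.
exists (a * b + c), (a *: u' + v'); split; first exact: IH.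
by rewrite scalerDr scalerA scalerDl addrACA.
Qed.

Lemma lin_span_0 s : lin_span s 0.
Proof.
elim: s => [|x s IH]; first exact/lin_span_nil.
by apply/lin_span_cons; exists 0, 0; rewrite scale0r addr0.
Qed.

Lemma lin_span_mem s x : x \in s -> lin_span s x.
Proof.
elim: s => // y s IH; rewrite inE => /orP[/eqP ->|xs]; apply/lin_span_cons.
  by exists 1, 0; rewrite scale1r addr0; split=> //; apply: lin_span_0.
by exists 0, x; rewrite scale0r add0r; split=> //; apply: IH.
Qed.

Lemma lin_span_ind s (P : V -> Prop) : P 0 ->
  (forall a u v, P u -> P v -> P (a *: u + v)) ->
  (forall x, x \in s -> P x) -> forall v, lin_span s v -> P v.
Proof.
move=> P0 PL; elim: s => [|x s IH] Ps v; first by rewrite lin_span_nil => ->.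
case/lin_span_cons=> a [w [sw ->]]; apply: PL; first by apply: Ps; rewrite mem_head.
by apply: IH sw => y ys; apply: Ps; rewrite inE ys orbT.
Qed.

Lemma lin_span_filter0 s v : lin_span [seq x <- s | x != 0] v <-> lin_span s v.
Proof.
split; apply: lin_span_ind; try exact: lin_span_0; try exact: lin_span_lin.
  by move=> x; rewrite mem_filter => /andP[_]; apply: lin_span_mem.
move=> x xs; have [->|x0] := eqVneq x 0; first exact: lin_span_0.
by apply: lin_span_mem; rewrite mem_filter x0.
Qed.


Section FreeFamilies.
Variables (m n : nat) (b : 'I_m -> V) (b' : 'I_n -> V) (c : 'I_m -> 'I_n -> F).
Hypothesis free : forall u : 'I_m -> F, \sum_k u k *: b k = 0 -> forall k, u k = 0.
Hypothesis bE : forall k, b k = \sum_l c k l *: b' l.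
Let Mx := \matrix_(k < m, l < n) c k l.

Lemma coord_change (u : 'rV_m) : \sum_k u 0 k *: b k = \sum_l (u *m Mx) 0 l *: b' l.
Proof.
under eq_bigr => k _ do rewrite bE scaler_sumr.
rewrite exchange_big; apply: eq_bigr => l _.
by rewrite mxE scaler_suml; apply: eq_bigr => k _; rewrite mxE scalerA.
Qed.

Lemma coord_row_free : row_free Mx.
Proof.
apply: inj_row_free => u u0; apply/rowP => k; rewrite mxE.
apply: (free (u := fun k => u 0 k)); rewrite coord_change u0.
by rewrite big1 // => l _; rewrite mxE scale0r.
Qed.

End FreeFamilies.

Lemma has_dim_basis_mem E n (b : 'I_n -> V) :
  (forall v, E v <-> exists c : 'I_n -> F, v = \sum_l c l *: b l) -> forall k, E (b k).
Proof.
move=> sb k; apply/sb; exists (fun l => (l == k)%:R).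
by rewrite (bigD1 k) //= eqxx scale1r big1 ?addr0 // => l /negPf ->; rewrite scale0r.
Qed.

Lemma has_dim_lin E n a u v : has_dim E n -> E u -> E v -> E (a *: u + v).
Proof.
move=> [b [_ sb]] /sb[c ->] /sb[c' ->]; apply/sb; exists (fun k => a * c k + c' k).
rewrite scaler_sumr -big_split; apply: eq_bigr => k _.
by rewrite scalerDl scalerA.
Qed.

Lemma has_dim_0 E n : has_dim E n -> E 0.
Proof.
move=> [b [_ sb]]; apply/sb; exists (fun=> 0).
by rewrite big1 // => k _; rewrite scale0r.
Qed.

Lemma free_leq_dim E m n (b : 'I_m -> V) :
  (forall u : 'I_m -> F, \sum_k u k *: b k = 0 -> forall k, u k = 0) ->
  (forall k, E (b k)) -> has_dim E n -> (m <= n)%N.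
Proof.
move=> fb Eb [b' [_ sb']].
have /choice[c cP] k : exists c : 'I_n -> F, b k = \sum_l c l *: b' l by apply/sb'.
have := coord_row_free fb cP; rewrite /row_free => /eqP <-.
exact: rank_leq_col.
Qed.

Lemma has_dim_uniq E m n : has_dim E m -> has_dim E n -> m = n.
Proof.
move=> hm hn; have [b [fb /has_dim_basis_mem Eb]] := hm.
have [b' [fb' /has_dim_basis_mem Eb']] := hn.
by apply/eqP; rewrite eqn_leq (free_leq_dim fb Eb hn) (free_leq_dim fb' Eb' hm).
Qed.

(** The coordinate matrix of the free family in a basis is square and row free, hence invertible;
    its inverse gives the coefficients. *)
Lemma free_spans E n (b : 'I_n -> V) :
  (forall u : 'I_n -> F, \sum_k u k *: b k = 0 -> forall k, u k = 0) ->
  (forall k, E (b k)) -> has_dim E n ->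
  forall v, E v -> exists c : 'I_n -> F, v = \sum_k c k *: b k.
Proof.
move=> fb Eb [b' [_ sb']] v /sb'[a ->].
have /choice[c cP] k : exists c : 'I_n -> F, b k = \sum_l c l *: b' l by apply/sb'.
have := coord_row_free fb cP; rewrite row_free_unit => uM.
exists (fun k => ((\row_l a l) *m invmx (\matrix_(k < n, l < n) c k l)) 0 k).
rewrite (coord_change cP) mulmxKV //.
by apply: eq_bigr => l _; rewrite mxE.
Qed.

End Span.

Section OrthogonalSpan.
Variables (C : numClosedFieldType) (V : lmodType C) (ip : V -> V -> C).
Hypothesis hip : inner_product ip.

(** Zero vectors are allowed in [s], as the generators of E_1(M,p,k) vanish when their index leaves
    the range. *)
Lemma has_dim_orth_span (s : seq V) : pairwise (fun u v => ip u v == 0) s ->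
  has_dim (lin_span s) (size [seq v <- s | v != 0]).
Proof.
move=> orth; set s' := [seq v <- s | v != 0].
have orth' : pairwise (fun u v => ip u v == 0) s'.
  exact: subseq_pairwise (filter_subseq _ _) orth.
exists (fun k => s'`_k); split.
  apply: (orth_free hip) => [k|k l kl].
    have : s'`_k \in s' by rewrite mem_nth.
    by rewrite mem_filter => /andP[].
  have /(pairwiseP 0) ph := orth'.
  case: (ltngtP k l) => [lt|lt|/val_inj e]; last by rewrite e eqxx in kl.
    by apply/eqP/ph; rewrite ?inE.
  rewrite (ip_conj hip); apply/eqP; rewrite conjC_eq0; apply: ph; rewrite ?inE //.
move=> v; rewrite -lin_span_filter0 -/s'; split=> [[c ->]|[c ->]].
  by exists (fun k => c k).
elim/big_ind: _ => [||k _]; first exact: lin_span_0.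
  by move=> x y sx sy; rewrite -[x]scale1r; apply: lin_span_lin.
rewrite -[_ *: _]addr0; apply: lin_span_lin; last exact: lin_span_0.
by apply: lin_span_mem; rewrite mem_nth.
Qed.

(** Nonzero orthogonal eigenvectors, as many as the dimension, form a basis of [E], and the
    eigenspace of [z] is the span of those whose listed value is [z]. Repeated values in [s] are
    allowed. *)
Lemma eigenvalues_orth (f : V -> V) (E : set V) (s : seq C) (v : seq V) :
  linear f -> has_dim E (size s) -> size v = size s ->
  (forall k, (k < size s)%N -> [/\ E v`_k, v`_k != 0 & f v`_k = s`_k *: v`_k]) ->
  pairwise (fun x y => ip x y == 0) v -> eigenvalues_are f E s.
Proof.
move=> fl dE sz hv orth z.
pose b (k : 'I_(size s)) := v`_k.
have orthb (k l : 'I_(size s)) : k != l -> ip (b k) (b l) = 0.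
  move=> kl; have /(pairwiseP 0) ph := orth.
  case: (ltngtP k l) => [lt|lt|/val_inj e]; last by rewrite e eqxx in kl.
    by apply/eqP/ph; rewrite ?inE ?sz.
  rewrite (ip_conj hip); apply/eqP; rewrite conjC_eq0; apply: ph; rewrite ?inE ?sz //.
have nzb k : b k != 0 by have [] := hv k (ltn_ord k).
have fb := orth_free hip nzb orthb.
have Eb k : E (b k) by have [] := hv k (ltn_ord k).
pose r := [seq k <- enum 'I_(size s) | s`_(k : 'I_(size s)) == z].
pose t := [seq b k | k <- r].
have tz : [seq x <- t | x != 0] = t.
  by apply/all_filterP/allP => _ /mapP[k _ ->].
have szt : size t = count_mem z s.
  rewrite size_map size_filter -[in RHS](mkseq_nth 0 s) /mkseq count_map.
  by rewrite -val_enum_ord !count_map; apply: eq_count => k /=.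
have ot : pairwise (fun x y => ip x y == 0) t.
  rewrite pairwise_map; apply: (subseq_pairwise (filter_subseq _ _)).
  have : uniq (enum 'I_(size s)) by rewrite enum_uniq.
  rewrite uniq_pairwise; apply: sub_pairwise => k l /=.
  by move=> kl; rewrite orthb.
have := has_dim_orth_span ot; rewrite tz szt.
suff -> : lin_span t = eigenspace_on f E z by [].
apply/seteqP; split=> [x|x [Ex fx]].
  apply: lin_span_ind.
  - by split; [exact: has_dim_0 dE | rewrite linear_0 // scaler0].
  - move=> a u w [Eu fu] [Ew fw]; split; first exact: has_dim_lin dE Eu Ew.
    by rewrite fl fu fw scalerDr !scalerA mulrC.
  - move=> _ /mapP[k + ->]; rewrite mem_filter => /andP[/eqP <- _].
    by have [] := hv k (ltn_ord k).
(* Applying f - z to the expansion of [x] shows that a coefficient can be nonzero only where the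
   listed value is [z]. *)
have [c xE] := free_spans fb Eb dE Ex.
have c0 (k : 'I_(size s)) : (s`_k - z) * c k = 0.
  apply: (fb (fun k => (s`_k - z) * c k)).
  transitivity (f x - z *: x); last by rewrite fx subrr.
  rewrite xE (sum_of_linear fl) scaler_sumr -sumrB; apply: eq_bigr => l _.
  have [_ _ fl'] := hv l (ltn_ord l).
  by rewrite (linear_Z fl) fl' !scalerA -scalerBl mulrBl (mulrC (c l)).
rewrite xE; elim/big_ind: _ => [||k _]; first exact: lin_span_0.
  by move=> x' y sx sy; rewrite -[x']scale1r; apply: lin_span_lin.
have /eqP := c0 k; rewrite mulf_eq0 subr_eq0 => /orP[sk|/eqP ->]; last first.
  by rewrite scale0r; apply: lin_span_0.
rewrite -[_ *: _]addr0; apply: lin_span_lin; last exact: lin_span_0.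
by apply/lin_span_mem/mapP; exists k => //; rewrite mem_filter sk mem_enum.
Qed.

End OrthogonalSpan.

(** * Finite sums of vectors from a family of subspaces *)

Section Decomposable.
Variables (F : fieldType) (V : lmodType F) (I : eqType) (P : pred I) (E : I -> set V).
Hypotheses (E_0 : forall t, E t 0)
  (E_D : forall t u v, E t u -> E t v -> E t (u + v)).

Definition decomposable (v : V) := exists (s : seq I) (e : I -> V),
  [/\ uniq s, all P s, forall t, t \in s -> E t (e t) & v = \sum_(t <- s) e t].

Lemma decomposable0 : decomposable 0.
Proof. by exists [::], (fun=> 0); rewrite big_nil. Qed.

Lemma decomposable1 t v : P t -> E t v -> decomposable v.
Proof.
move=> Pt Ev; exists [:: t], (fun=> v); split; rewrite /= ?Pt ?big_seq1 //.
by move=> u; rewrite inE => /eqP ->.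
Qed.

Lemma big_uniq_sub (s u : seq I) (e : I -> V) : uniq s -> uniq u -> {subset s <= u} ->
  \sum_(t <- u) (if t \in s then e t else 0) = \sum_(t <- s) e t.
Proof.
move=> us uu su; rewrite -big_mkcond -big_filter; apply: perm_big.
apply: uniq_perm; rewrite ?filter_uniq // => t; rewrite mem_filter.
by apply/andP/idP => [[]//|ts]; split=> //; apply: su.
Qed.

Lemma decomposableD u v : decomposable u -> decomposable v -> decomposable (u + v).
Proof.
move=> [s [e [us Ps Es ->]]] [s' [e' [us' Ps' Es' ->]]].
exists (undup (s ++ s')), (fun t => (if t \in s then e t else 0) + (if t \in s' then e' t else 0)).
split; first exact: undup_uniq.
- by apply/allP => t; rewrite mem_undup mem_cat => /orP[/(allP Ps)|/(allP Ps')].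
- by move=> t _; apply: E_D; case: ifP => // h; [apply: Es | apply: Es'].
- rewrite big_split /= !big_uniq_sub ?undup_uniq // => t ts;
  by rewrite mem_undup mem_cat ts ?orbT.
Qed.

End Decomposable.

(** * The spectrum of the Laplacian *)

Section Laplacian.
Variables (R : realType) (q : R) (A : starAlg R[i]) (alpha gamma : A).
Hypotheses (hq : 0 < `|q| < 1) (hA : is_SUq2 q alpha gamma).
Variables (T : tensorSquare A) (Delta : {lrmorphism A -> T}).
Hypothesis hDelta : is_comult q alpha gamma Delta.
Variable h : {scalar A}.
Hypothesis hh : is_haar Delta h.
Variable Om : calculus3D q alpha gamma.
Variables (ip : Om -> Om -> R[i]) (dstar : Om -> Om).
Hypotheses (hip : inner_product ip) (hleft : left_invariant h ip).
Hypothesis hon : orthonormal_basis ip (orthonormal_forms Om) (Omega_inv Om).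
Hypothesis hdstar : is_adjoint ip (diff Om) dstar.
Variables chi1 chi2 chi3 : {scalar A}.
Hypothesis hchi : generators Om Delta chi1 chi2 chi3.
Variable W : nat -> int -> int -> A.
Hypothesis hW : is_woronowicz_reps q Delta chi1 chi2 chi3 W.

Local Notation Q := (q%:C : R[i]).
Local Notation i := (incl Om).
Local Notation J0 := (J0 Om).
Local Notation J1 := (J1 Om).
Local Notation J2 := (J2 Om).
Local Notation J3 := (J3 Om).
Local Notation hf := (hform h).
Local Notation X1 := (convol Delta chi1).
Local Notation X2 := (convol Delta chi2).
Local Notation X3 := (convol Delta chi3).
Local Notation codiv := (codiv q X1 X2 X3).
Local Notation curl1 := (curl1 q X1 X2).
Local Notation curl2 := (curl2 q X1 X3).
Local Notation curl3 := (curl3 q X2 X3).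
Local Notation casimir := (casimir q Delta chi1 chi2 chi3).
Local Notation nabla := (laplacian Om dstar).

Let diff_incl a : diff Om (i a) = J1 (X1 a) (X2 a) (X3 a).
Proof. exact: hchi. Qed.

(** eta1 and eta3 obey the same commutation rule, so by [twist_uniq] one automorphism serves
    both. *)
Lemma twists_exist : exists f1 f2 : {lrmorphism A -> A},
  [/\ twist alpha gamma Q f1, twist alpha gamma (Q ^+ 2) f2,
      forall a, eta1 Om * i a = i (f1 a) * eta1 Om,
      forall a, eta2 Om * i a = i (f2 a) * eta2 Om &
      forall a, eta3 Om * i a = i (f1 a) * eta3 Om].
Proof.
have [fr1 fr2 fr3] := eta_free Om hq.
have [_ _ _ _ [c1 c2 c3]] := calculus_forms Om.
have [f1 [tf1 e1]] := twist_exists hA fr1 c1.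
have [f2 [tf2 e2]] := twist_exists hA fr2 c2.
have [f3 [tf3 e3]] := twist_exists hA fr3 c3.
exists f1, f2; split=> // a.
by rewrite e3 (twist_uniq hA tf3 tf1).
Qed.

(** Slicing both factors of the coproduct in either order gives h(chi * a) = h(a) chi(1), and the
    Leibniz rule at 1 = 1 1 forces chi(1) = 0. *)
Lemma haar_field a : [/\ h (X1 a) = 0, h (X2 a) = 0 & h (X3 a) = 0].
Proof.
have [f1 [f2 [tf1 tf2 tw1 tw2 tw3]]] := twists_exist.
have [l1 l2 l3] := fields_leibniz hq diff_incl tw1 tw2 tw3 1 1.
have X1z (chi : {scalar A}) (f : A -> A) : convol Delta chi (1 * 1) = convol Delta chi 1 * f 1 + 1 * convol Delta chi 1 ->
    f 1 = 1 -> chi 1 = 0.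
  move=> e f1'; move: e; rewrite f1' !mulr1 mul1r => e.
  have : convol Delta chi 1 = 0 by apply: (addrI (convol Delta chi 1)); rewrite -e addr0.
  rewrite /convol rmorph1 -(tens1 T) slice_rightE => /eqP.
  by rewrite scaler_eq0 oner_eq0 orbF => /eqP.
have [_ _ hl _ _] := hh.
have key (chi : {scalar A}) : chi 1 = 0 -> h (convol Delta chi a) = 0.
  move=> c1; transitivity (chi (slice_left h (Delta a))).
    rewrite /convol; move: (Delta a).
    have sl := slice_left_linear (T := T) h; have sr := slice_right_linear (T := T) chi.
    apply: (tens_ext (V := R[i]^o) (f := fun u : T => h (slice_right chi u))
       (g := fun u : T => chi (slice_left h u))).
    - by move=> c x y; rewrite sr linearP.
    - by move=> c x y; rewrite sl linearP.
    - by move=> x y; rewrite slice_rightE slice_leftE !linearZ /= mulrC.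
  by rewrite hl linearZ /= c1 mulr0.
have k1 : chi1 1 = 0 by apply: (X1z chi1 f1 l1); apply: rmorph1.
have k2 : chi2 1 = 0 by apply: (X1z chi2 f2 l2); apply: rmorph1.
have k3 : chi3 1 = 0 by apply: (X1z chi3 f1 l3); apply: rmorph1.
by split; apply: key.
Qed.

Lemma field_adj a b : [/\ hf (X1 a) b = - Q^-1 * hf a (X3 b), hf (X2 a) b = hf a (X2 b)
    & hf (X3 a) b = - Q * hf a (X1 b)].
Proof.
have [f1 [f2 [tf1 tf2 tw1 tw2 tw3]]] := twists_exist.
exact: (fields_adjoint hq diff_incl tw1 tw2 tw3 (haar_twist hA hDelta hh tf1)
  (haar_twist hA hDelta hh tf2) haar_field).
Qed.

Lemma W_orth M M' p p' K K' : W_index (M, p, K) -> W_index (M', p', K') ->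
  (M, p, K) != (M', p', K') -> hf (W M p K) (W M' p' K') = 0.
Proof.
have [f1 [f2 [tf1 tf2 tw1 tw2 tw3]]] := twists_exist.
apply: (W_orthogonal hq hA hDelta hW hh (f := f2)) => [a|a|].
- exact: (field2_twist hq diff_incl tw1 tw2 tw3 hA tf2).
- by have [] := fields_adj hq diff_incl tw1 tw2 tw3 a.
- exact: field_adj.
Qed.

Lemma W_neq0 M p K : W_index (M, p, K) -> W M p K != 0.
Proof.
move=> hi; apply/eqP => w0; have [_ _ _ [free _]] := hW.
have := free [:: (M, p, K)] (fun=> 1) isT; rewrite /= hi big_seq1 /= w0 scaler0.
by move=> /(_ isT erefl _ (mem_head _ _)) /eqP; rewrite oner_eq0.
Qed.

Let dD := dstar_J hq hip hleft hon hdstar diff_incl field_adj.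

(** A name to fold the general form into, so that [dstar_J] can be specialized to each degree by
    rewriting. *)
Definition Jall a0 a1 a2 a3 b1 b2 b3 b0 := J0 a0 + J1 a1 a2 a3 + J2 b1 b2 b3 + J3 b0.

Lemma J_J0 a : J0 a = Jall a 0 0 0 0 0 0 0.
Proof. by rewrite /Jall J1_0 J2_0 J3_0 !addr0. Qed.
Lemma J_J1 a b c : J1 a b c = Jall 0 a b c 0 0 0 0.
Proof. by rewrite /Jall J0_0 J2_0 J3_0 add0r !addr0. Qed.
Lemma J_J2 a b c : J2 a b c = Jall 0 0 0 0 a b c 0.
Proof. by rewrite /Jall J0_0 J1_0 J3_0 !add0r !addr0. Qed.
Lemma J_J3 a : J3 a = Jall 0 0 0 0 0 0 0 a.
Proof. by rewrite /Jall J0_0 J1_0 J2_0 !add0r. Qed.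

Let X10 : X1 0 = 0. Proof. exact: linear_0 (convol_linear Delta chi1). Qed.
Let X20 : X2 0 = 0. Proof. exact: linear_0 (convol_linear Delta chi2). Qed.
Let X30 : X3 0 = 0. Proof. exact: linear_0 (convol_linear Delta chi3). Qed.
Let codiv0 : codiv 0 0 0 = 0.
Proof. by rewrite /codiv X10 X20 X30 !scaler0 oppr0 !addr0. Qed.
Let curl10 : curl1 0 0 = 0.
Proof. by rewrite /curl1 X10 X20 !scaler0 oppr0 !addr0. Qed.
Let curl20 : curl2 0 0 0 = 0.
Proof. by rewrite /curl2 X10 X30 !scaler0 !addr0. Qed.
Let curl30 : curl3 0 0 = 0.
Proof. by rewrite /curl3 X20 X30 !scaler0 !addr0. Qed.
Let zeros := (X10, X20, X30, codiv0, curl10, curl20, curl30, oppr0).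

Lemma dstar_J0 a : dstar (J0 a) = 0.
Proof. by rewrite J_J0 dD !zeros -/(Jall _ _ _ _ _ _ _ _) -J_J0 J0_0. Qed.
Lemma dstar_J1 a b c : dstar (J1 a b c) = J0 (codiv a b c).
Proof. by rewrite J_J1 dD !zeros -/(Jall _ _ _ _ _ _ _ _) -J_J0. Qed.
Lemma dstar_J2 a b c : dstar (J2 a b c) = J1 (curl1 a b) (curl2 a b c) (curl3 b c).
Proof. by rewrite J_J2 dD !zeros -/(Jall _ _ _ _ _ _ _ _) -J_J1. Qed.
Lemma dstar_J3 a : dstar (J3 a) = J2 (- X1 a) (- X2 a) (- X3 a).
Proof. by rewrite J_J3 dD !zeros -/(Jall _ _ _ _ _ _ _ _) -J_J2. Qed.

Let dJ1 := diff_J1 hq diff_incl.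
Let dJ2 := diff_J2 hq diff_incl.
Let dJ3 := diff_J3 Om.

(** The adjoint is given as a bare function; its linearity follows from adjointness and
    nondegeneracy. *)
Lemma dstarP a u v : dstar (a *: u + v) = a *: dstar u + dstar v.
Proof.
by apply: (ip_inj hip) => w; rewrite -hdstar !(ipDr hip, ipZr hip) -!hdstar.
Qed.

Lemma dstarD u v : dstar (u + v) = dstar u + dstar v.
Proof. by have := dstarP 1 u v; rewrite !scale1r. Qed.

Lemma dd0 w : diff Om (diff Om w) = 0.
Proof. by have [_ _ [-> _] _ _] := calculus_diff Om. Qed.

Lemma dstardstar0 w : dstar (dstar w) = 0.
Proof. by apply: (ip_inj hip) => u; rewrite -!hdstar dd0 (ip0l hip) (ip0r hip). Qed.

Lemma nablaE w : nabla w = diff Om (dstar w) + dstar (diff Om w).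
Proof.
by rewrite /laplacian linearD dstarD dd0 dstardstar0 add0r addr0 /=.
Qed.

Lemma nabla_linear : linear nabla.
Proof.
move=> a u v; rewrite !nablaE dstarP !linearP /= dstarP scalerDr addrACA.
by [].
Qed.

Lemma nabla_J0 a : nabla (J0 a) = J0 (casimir a).
Proof. by rewrite nablaE dstar_J0 linear0 add0r diff_incl dstar_J1. Qed.

Definition lap1 a b c := X1 (codiv a b c) + curl1 (curl1 a b) (curl2 a b c).
Definition lap2 a b c := X2 (codiv a b c) + curl2 (curl1 a b) (curl2 a b c) (curl3 b c).
Definition lap3 a b c := X3 (codiv a b c) + curl3 (curl2 a b c) (curl3 b c).

Lemma nabla_J1 a b c :
  nabla (J1 a b c) = J1 (lap1 a b c) (lap2 a b c) (lap3 a b c).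
Proof. by rewrite nablaE dstar_J1 dJ1 dstar_J2 diff_incl -J1D. Qed.

Let XN (chi : {scalar A}) a : convol Delta chi (- a) = - convol Delta chi a.
Proof. by rewrite -scaleN1r (linear_Z (convol_linear Delta chi)) scaleN1r. Qed.

(** Compared with 1-forms the two summands change roles: d after the adjoint gives L^2, the adjoint
    after d gives D D^*, where two minus signs cancel. *)
Lemma nabla_J2 a b c :
  nabla (J2 a b c) = J2 (lap1 a b c) (lap2 a b c) (lap3 a b c).
Proof.
by rewrite nablaE dstar_J2 dJ1 dJ2 dstar_J3 !XN !opprK addrC -J2D.
Qed.

Lemma nabla_J3 a : nabla (J3 a) = J3 (casimir a).
Proof.
rewrite nablaE dJ3 dstar_J3 dJ2 -[X in _ + dstar X]J3_0 dstar_J3.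
rewrite !zeros J2_0 addr0; congr J3; rewrite /codiv !XN !scalerN.
by rewrite !opprD !opprK.
Qed.


(* The three components of [vec M p K x y z] have weights K + 2, K, K - 2, so that every
   first-order operator below acts on the coordinates (x, y, z) by scalars. *)
Definition vec M p K (x y z : R[i]) : Om :=
  J1 (x *: W0 W M p (K + 2)) (y *: W0 W M p K) (z *: W0 W M p (K - 2)).

Section FixedRow.
Variables (M : nat) (p : int).
Hypotheses (M_gt0 : (0 < M)%N) (pM : p \in idx M).
Variable K : int.
Local Notation w := (W0 W M p).
Local Notation c := ((cc q M K)%:C : R[i]).
Local Notation c' := ((cc q M (K + 2))%:C : R[i]).
Local Notation l := ((lam q K)%:C : R[i]).

Let XZ (chi : {scalar A}) t a : convol Delta chi (t *: a) = t *: convol Delta chi a.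
Proof. exact: (linear_Z (convol_linear Delta chi)). Qed.

Let qM (x : R) : (q * x)%:C = Q * x%:C.
Proof. exact: rmorphM. Qed.

Let Q0 : Q != 0. Proof. exact: qC_neq0. Qed.

Lemma codiv_vec x y z :
  codiv (x *: w (K + 2)) (y *: w K) (z *: w (K - 2)) =
  (- (c' * x) + l * y + Q * c * z) *: w K.
Proof.
rewrite /codiv !XZ (field3_W hW M_gt0 pM) (field2_W hW M_gt0 pM) (field1_W hW M_gt0 pM).
rewrite addrK subrK !qM !scalerA -scalerDl -scalerBl; congr (_ *: _).
by field.
Qed.

Let lam_up : Q ^+ 4 * (lam q (K + 2))%:C = l + (Q ^+ 2 + Q ^+ 4).
Proof. by rewrite -!rmorphXn -rmorphM lam_shift_up // !rmorphD. Qed.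

Let lam_down : (lam q (K - 2))%:C = Q ^+ 4 * l - (Q ^+ 2 + Q ^+ 4) :> R[i].
Proof. by rewrite lam_shift_down // rmorphB rmorphD rmorphM !rmorphXn. Qed.

(** The terms q^2 + q^4 contributed by d eta1 and d eta3 are exactly those that arise when lam at K
    + 2 or K - 2 is expressed by lam at K, so only lam at K remains. *)
Lemma curl1_vec x y : curl1 (x *: w (K + 2)) (y *: w K) =
  (- Q ^+ 7 * (l * x + c' * y)) *: w (K + 2).
Proof.
rewrite /curl1 !XZ (field2_W hW M_gt0 pM) (field1_W hW M_gt0 pM).
rewrite !scalerA -scalerBl -scalerDl; congr (_ *: _).
have -> : Q ^+ 11 * x * (lam q (K + 2))%:C = Q ^+ 7 * x * (Q ^+ 4 * (lam q (K + 2))%:C).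
  by ring.
by rewrite lam_up; ring.
Qed.

Lemma curl2_vec x y z : curl2 (x *: w (K + 2)) (y *: w K) (z *: w (K - 2)) =
  (- Q ^+ 7 * c' * x + Q ^+ 5 * y - Q ^+ 4 * c * z) *: w K.
Proof.
rewrite /curl2 !XZ (field3_W hW M_gt0 pM) (field1_W hW M_gt0 pM).
rewrite addrK subrK qM !scalerA -!scalerDl; congr (_ *: _).
by ring.
Qed.

Lemma curl3_vec y z : curl3 (y *: w K) (z *: w (K - 2)) =
  (Q ^+ 3 * l * z - Q ^+ 4 * c * y) *: w (K - 2).
Proof.
rewrite /curl3 !XZ (field3_W hW M_gt0 pM) (field2_W hW M_gt0 pM).
rewrite qM !scalerA -!scalerDl lam_down; congr (_ *: _).
by field.
Qed.

Lemma nabla_vec_in x y z : exists x' y' z', nabla (vec M p K x y z) = vec M p K x' y' z'.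
Proof.
rewrite /vec nabla_J1 /lap1 /lap2 /lap3.
rewrite codiv_vec curl1_vec curl2_vec curl3_vec curl1_vec curl2_vec curl3_vec !XZ.
rewrite (field3_W hW M_gt0 pM) (field2_W hW M_gt0 pM) (field1_W hW M_gt0 pM) !scalerA.
by rewrite -!scalerDl; do 3 eexists.
Qed.

Let evC (l a a' x y z mu : R) : - (a' * x) + l * y + q * a * z = 0 ->
  - q ^+ 7 * (l * x + a' * y) = mu * x ->
  - q ^+ 7 * a' * x + q ^+ 5 * y - q ^+ 4 * a * z = mu * y ->
  q ^+ 3 * l * z - q ^+ 4 * a * y = mu * z ->
  [/\ - (a'%:C * x%:C) + l%:C * y%:C + Q * a%:C * z%:C = 0,
      - Q ^+ 7 * (l%:C * x%:C + a'%:C * y%:C) = (mu * x)%:C,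
      - Q ^+ 7 * a'%:C * x%:C + Q ^+ 5 * y%:C - Q ^+ 4 * a%:C * z%:C = (mu * y)%:C &
      Q ^+ 3 * l%:C * z%:C - Q ^+ 4 * a%:C * y%:C = (mu * z)%:C].
Proof.
move=> e0 e1 e2 e3; split.
- by rewrite -[RHS](rmorph0 (real_complex R)) -e0 !(rmorphD, rmorphM, rmorphN).
- by rewrite -e1 !(rmorphD, rmorphM, rmorphN, rmorphXn).
- by rewrite -e2 !(rmorphD, rmorphM, rmorphN, rmorphXn).
- by rewrite -e3 !(rmorphD, rmorphM, rmorphN, rmorphXn).
Qed.

Section Eigenvector.
Variables (x y z mu : R).
Local Notation l' := (lam q K).
Local Notation a := (cc q M K).
Local Notation a' := (cc q M (K + 2)).
Hypotheses (ev0 : - (a' * x) + l' * y + q * a * z = 0)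
  (ev1 : - q ^+ 7 * (l' * x + a' * y) = mu * x)
  (ev2 : - q ^+ 7 * a' * x + q ^+ 5 * y - q ^+ 4 * a * z = mu * y)
  (ev3 : q ^+ 3 * l' * z - q ^+ 4 * a * y = mu * z).
Local Notation v := (vec M p K x%:C y%:C z%:C).

Let v2 := J2 (x%:C *: w (K + 2)) (y%:C *: w K) (z%:C *: w (K - 2)).

Let eigC := evC ev0 ev1 ev2 ev3.

Lemma eigen_codiv : dstar v = 0.
Proof. by rewrite /vec dstar_J1 codiv_vec; have [-> _ _ _] := eigC; rewrite scale0r J0_0. Qed.

Lemma eigen_diff : diff Om v = mu%:C *: v2.
Proof.
rewrite /vec dJ1 curl1_vec curl2_vec curl3_vec; have [_ -> -> ->] := eigC.
by rewrite !rmorphM -!scalerA J2Z.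
Qed.

Lemma eigen_dstar : dstar v2 = mu%:C *: v.
Proof.
rewrite /v2 dstar_J2 curl1_vec curl2_vec curl3_vec; have [_ -> -> ->] := eigC.
by rewrite !rmorphM -!scalerA J1Z.
Qed.

Lemma eigen_nabla : nabla v = (mu ^+ 2)%:C *: v.
Proof.
have dstarZ t u : dstar (t *: u) = t *: dstar u.
  by have := dstarP t u 0; rewrite -J0_0 dstar_J0 J0_0 !addr0.
rewrite nablaE eigen_codiv linear0 add0r eigen_diff dstarZ eigen_dstar scalerA.
by rewrite -rmorphM expr2.
Qed.

End Eigenvector.

Lemma grad_vec : diff Om (J0 (w K)) = vec M p K (- cc q M (K + 2))%:C (lam q K)%:C (q * cc q M K)%:C.
Proof.
by rewrite diff_incl (field3_W hW M_gt0 pM) (field2_W hW M_gt0 pM) (field1_W hW M_gt0 pM) rmorphN.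
Qed.

Lemma nabla_W : nabla (J0 (w K)) = (nu q M K)%:C *: J0 (w K).
Proof. by rewrite nabla_J0 (casimir_W hq hW) // J0Z. Qed.

(** The Laplacian commutes with d, so the eigenvalue of the function passes to its gradient. *)
Lemma nabla_grad : nabla (diff Om (J0 (w K))) = (nu q M K)%:C *: diff Om (J0 (w K)).
Proof.
have e : dstar (diff Om (J0 (w K))) = (nu q M K)%:C *: J0 (w K).
  by rewrite -nabla_W nablaE dstar_J0 linear0 add0r.
have d0 : dstar 0 = 0 by rewrite -(J0_0 Om) dstar_J0 J0_0.
rewrite nablaE e dd0 d0 addr0; exact: linearZ.
Qed.

End FixedRow.


Lemma ip_J1 a b c a' b' c' :
  ip (J1 a b c) (J1 a' b' c') = hf a a' + hf b b' + hf c c'.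
Proof.
rewrite !J_J1 /Jall (ip_J hip hleft hon).
by rewrite !hform0l !addr0 add0r.
Qed.

Lemma ip_J2 a b c a' b' c' :
  ip (J2 a b c) (J2 a' b' c') = hf a a' + hf b b' + hf c c'.
Proof.
rewrite !J_J2 /Jall (ip_J hip hleft hon).
by rewrite !hform0l !addr0 !add0r.
Qed.

Lemma J1_eq0 a b c : (J1 a b c == 0) = [&& a == 0, b == 0 & c == 0].
Proof.
apply/eqP/and3P => [|[/eqP -> /eqP -> /eqP ->]]; last exact: J1_0.
by rewrite -(J1_0 Om) => /(J1_inj hq)[-> -> ->].
Qed.

Definition gens M p K : seq Om :=
  [:: J1 (W0 W M p (K + 2)) 0 0; J1 0 (W0 W M p K) 0; J1 0 0 (W0 W M p (K - 2))].

Local Notation E := (E1 Om W).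

Lemma E1E M p K : E M p K = lin_span (gens M p K).
Proof. by rewrite /gens /J1 !raddf0 !mul0r ?addr0 ?add0r ?addr0. Qed.

Lemma vecE M p K x y z : vec M p K x y z =
  x *: (gens M p K)`_0 + (y *: (gens M p K)`_1 + (z *: (gens M p K)`_2 + 0)).
Proof. by rewrite /= -!J1Z -(J1_0 Om) -!J1D !scaler0 ?addr0 ?add0r. Qed.

Lemma E1P M p K v : E M p K v <-> exists x y z, v = vec M p K x y z.
Proof.
rewrite E1E; split=> [|[x [y [z ->]]]]; last first.
  by rewrite vecE; do 3![apply: lin_span_lin; first by apply/lin_span_mem/mem_nth]; apply: lin_span_0.
move=> /lin_span_cons[x [_ [/lin_span_cons[y [_ [/lin_span_cons[z [_ [/lin_span_nil -> ->] ->]]]]] ->]]].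
by exists x, y, z; rewrite vecE /gens.
Qed.

Lemma gens_orth M p K : pairwise (fun u v => ip u v == 0) (gens M p K).
Proof. by rewrite /= !ip_J1 !hform0l !hform0r !addr0 eqxx. Qed.

Lemma E1_dim M p K : (0 < M)%N -> p \in idx M ->
  has_dim (E M p K) ((K + 2 \in idx M) + (K \in idx M) + (K - 2 \in idx M)).
Proof.
move=> M0 pM; rewrite E1E.
have nz k : (W0 W M p k != 0) = (k \in idx M).
  rewrite /W0; case: ifP => hk; last by rewrite eqxx.
  by rewrite W_neq0 // /W_index /= M0 pM.
have := has_dim_orth_span hip (gens_orth M p K); rewrite /gens /= !J1_eq0 !eqxx !andbT /= !nz.
by case: (_ \in _); case: (_ \in _); case: (_ \in _).
Qed.

(** When K has position j in the enlarged range, the three components have positions j, j - 1 and j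
    - 2 in [idx M]; the summands count those that exist. *)
Lemma E1_dimE M p j (K := (2 * j)%:Z - M.+1%:Z) : (0 < M)%N -> p \in idx M ->
  has_dim (E M p K) ((j < M) + (0 < j <= M) + (1 < j < M.+2))%N.
Proof.
move=> M0 pM; have := E1_dim K M0 pM.
have -> : K + 2 = 2 * j%:Z - M.-1%:Z by rewrite /K; lia.
have -> : K - 2 = 2 * (j%:Z - 2) - M.-1%:Z by rewrite /K; lia.
have -> : (K \in idx M) = (0 < j <= M)%N.
  have -> : K = 2 * (j%:Z - 1) - M.-1%:Z by rewrite /K; lia.
  by rewrite mem_idx_int; lia.
rewrite !mem_idx_int.
have -> : (0 <= j%:Z < M%:Z) = (j < M)%N by lia.
by have -> : (0 <= j%:Z - 2 < M%:Z) = (1 < j < M.+2)%N by lia.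
Qed.

Lemma E1_indexP M p K : E1_index (M, p, K) ->
  exists j, [/\ (0 < M)%N, p \in idx M, (j < M.+2)%N & K = (2 * j)%:Z - M.+1%:Z].
Proof. by case/and3P=> M0 pM /idxP[j jM eK]; exists j. Qed.

Lemma E1_invariant M p K : E1_index (M, p, K) -> forall v, E M p K v -> E M p K (nabla v).
Proof.
case/and3P=> M0 pM _ v /E1P[x [y [z ->]]]; apply/E1P.
exact: nabla_vec_in.
Qed.

Lemma E1_dims M p K : E1_index (M, p, K) ->
  has_dim (E M p K) 1 \/ has_dim (E M p K) 2 \/ has_dim (E M p K) 3.
Proof.
move=> /E1_indexP[j [M0 pM jM ->]]; have := E1_dimE j M0 pM.
case: (ltnP j M) => h1; case: (ltnP 0 j) => h2; case: (leqP j M) => h3;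
  case: (ltnP 1 j) => h4; rewrite ?jM /=; try lia; by [left | right; left | right; right].
Qed.

Let dim_iff M p j n (K := (2 * j)%:Z - M.+1%:Z) : (0 < M)%N -> p \in idx M ->
  has_dim (E M p K) n <-> n = ((j < M) + (0 < j <= M) + (1 < j < M.+2))%N.
Proof.
move=> M0 pM; split=> [h1|->]; last exact: E1_dimE.
exact: has_dim_uniq h1 (E1_dimE j M0 pM).
Qed.

Lemma E1_dim1 M p K : E1_index (M, p, K) ->
  has_dim (E M p K) 1 <-> M = 1%N \/ K = - M.+1%:Z \/ K = M.+1%:Z.
Proof. by move=> /E1_indexP[j [M0 pM jM ->]]; rewrite dim_iff //; lia. Qed.

Lemma E1_dim2 M p K : E1_index (M, p, K) ->
  has_dim (E M p K) 2 <-> (1 < M)%N /\ (K = - M.-1%:Z \/ K = M.-1%:Z).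
Proof. by move=> /E1_indexP[j [M0 pM jM ->]]; rewrite dim_iff //; lia. Qed.

Lemma E1_dim3 M p K : E1_index (M, p, K) ->
  has_dim (E M p K) 3 <-> (- M.-1%:Z + 2 <= K <= M.-1%:Z - 2).
Proof. by move=> /E1_indexP[j [M0 pM jM ->]]; rewrite dim_iff //; lia. Qed.


Lemma vec_neq0 M p K x y z : (0 < M)%N -> p \in idx M ->
  [|| (x != 0) && (K + 2 \in idx M), (y != 0) && (K \in idx M)
    | (z != 0) && (K - 2 \in idx M)] -> vec M p K x y z != 0.
Proof.
move=> M0 pM; rewrite /vec J1_eq0 !negb_and !scaler_eq0 !negb_or.
have nz k : k \in idx M -> W0 W M p k != 0.
  by move=> hk; rewrite /W0 hk W_neq0 // /W_index /= M0 pM.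
by case/or3P => /andP[-> /nz ->]; rewrite ?orbT.
Qed.

Lemma grad_orth a v : dstar v = 0 -> ip (diff Om (J0 a)) v == 0.
Proof. by move=> v0; rewrite hdstar v0 (ip0r hip). Qed.

Section Spectrum.
Variables (M : nat) (p : int).
Hypotheses (M_gt0 : (0 < M)%N) (pM : p \in idx M).

(** Passing from 1-form to 2-form coordinates is an isometry, so d and its adjoint act there as one
    symmetric operator L with real eigenvalues. Distinct [mu] suffice, even with equal squares. *)
Lemma eigen_orth K x y z mu x' y' z' mu' : mu != mu' ->
  eigen_eqs q M K x y z mu -> eigen_eqs q M K x' y' z' mu' ->
  ip (vec M p K x%:C y%:C z%:C) (vec M p K x'%:C y'%:C z'%:C) == 0.
Proof.
move=> ne [e0 e1 e2 e3] [e0' e1' e2' e3'].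
have := hdstar (vec M p K x%:C y%:C z%:C)
  (J2 (x'%:C *: W0 W M p (K + 2)) (y'%:C *: W0 W M p K) (z'%:C *: W0 W M p (K - 2))).
rewrite (eigen_diff M_gt0 pM e0 e1 e2 e3) (eigen_dstar M_gt0 pM e0' e1' e2' e3').
rewrite (ipZl hip) (ipZr hip) conj_RC ip_J2 -ip_J1 -/(vec _ _ _ _ _ _) => /eqP.
rewrite -/(vec M p K x'%:C y'%:C z'%:C).
rewrite -subr_eq0 -mulrBl mulf_eq0 -rmorphB fmorph_eq0 subr_eq0 (negPf ne).
by [].
Qed.

Lemma spectrum1 K x y z mu : has_dim (E M p K) 1 -> eigen_eqs q M K x y z mu ->
  vec M p K x%:C y%:C z%:C != 0 -> eigenvalues_are nabla (E M p K) [:: (mu ^+ 2)%:C].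
Proof.
move=> d [e0 e1 e2 e3] nz.
apply: (eigenvalues_orth hip (v := [:: vec M p K x%:C y%:C z%:C]) nabla_linear) => //.
case=> // _; split=> //; first by apply/E1P; do 3 eexists.
exact: (eigen_nabla M_gt0 pM e0 e1 e2 e3).
Qed.

Let grad_E K : E M p K (diff Om (J0 (W0 W M p K))).
Proof. by rewrite (grad_vec M_gt0 pM); apply/E1P; do 3 eexists. Qed.

Lemma spectrum2 K x y z mu : has_dim (E M p K) 2 -> eigen_eqs q M K x y z mu ->
  vec M p K x%:C y%:C z%:C != 0 -> diff Om (J0 (W0 W M p K)) != 0 ->
  eigenvalues_are nabla (E M p K) [:: (nu q M K)%:C; (mu ^+ 2)%:C].
Proof.
move=> d [e0 e1 e2 e3] nz nz'.
apply: (eigenvalues_orth hip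
  (v := [:: diff Om (J0 (W0 W M p K)); vec M p K x%:C y%:C z%:C]) nabla_linear) => //.
  case=> [|[|//]] _; split=> //; first exact: nabla_grad.
    by apply/E1P; do 3 eexists.
  exact: (eigen_nabla M_gt0 pM e0 e1 e2 e3).
by rewrite /= grad_orth // (eigen_codiv M_gt0 pM e0 e1 e2 e3).
Qed.

Lemma spectrum3 K x y z mu x' y' z' mu' : mu != mu' -> has_dim (E M p K) 3 ->
  eigen_eqs q M K x y z mu -> eigen_eqs q M K x' y' z' mu' ->
  vec M p K x%:C y%:C z%:C != 0 -> vec M p K x'%:C y'%:C z'%:C != 0 ->
  diff Om (J0 (W0 W M p K)) != 0 ->
  eigenvalues_are nabla (E M p K) [:: (nu q M K)%:C; (mu ^+ 2)%:C; (mu' ^+ 2)%:C].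
Proof.
move=> ne d ev ev' nz nz' nz0; have [e0 e1 e2 e3] := ev; have [e0' e1' e2' e3'] := ev'.
apply: (eigenvalues_orth hip
  (v := [:: diff Om (J0 (W0 W M p K)); vec M p K x%:C y%:C z%:C;
     vec M p K x'%:C y'%:C z'%:C]) nabla_linear) => //.
  case=> [|[|[|//]]] _; split=> //; first exact: nabla_grad.
  - by apply/E1P; do 3 eexists.
  - exact: (eigen_nabla M_gt0 pM e0 e1 e2 e3).
  - by apply/E1P; do 3 eexists.
  - exact: (eigen_nabla M_gt0 pM e0' e1' e2' e3').
by rewrite /= !grad_orth ?(eigen_orth ne ev ev') ?(eigen_codiv M_gt0 pM e0 e1 e2 e3)
   ?(eigen_codiv M_gt0 pM e0' e1' e2' e3').
Qed.

End Spectrum.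


(** * Eigenvalues on each space E_1(M,p,k) *)

Lemma spectrum_bottom M p : (0 < M)%N -> p \in idx M ->
  eigenvalues_are nabla (E M p (- M.+1%:Z)) [:: (q ^+ 14 * lam q (- M.+1%:Z) ^+ 2)%:C].
Proof.
move=> M0 pM; set K := - M.+1%:Z.
have d : has_dim (E M p K) 1.
  have := E1_dimE 0 M0 pM; have -> : (2 * 0)%N%:Z - M.+1%:Z = K by rewrite /K; lia.
  by rewrite M0.
have c'0 : cc q M (K + 2) = 0.
  have -> : K + 2 = - M.-1%:Z by rewrite /K; lia.
  exact: cc_bottom.
have -> : q ^+ 14 * lam q K ^+ 2 = (- q ^+ 7 * lam q K) ^+ 2 by ring.
(* Only the eta1 component survives, and c_{-m} = 0 removes the off-diagonal entries: L acts by -q^7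
   lam. *)
apply: (spectrum1 M0 pM (x := 1) (y := 0) (z := 0) d).
  by split; rewrite ?c'0; ring.
apply: vec_neq0 => //; apply/or3P/Or31; rewrite rmorph1 oner_eq0 /=.
have -> : K + 2 = 2 * 0 - M.-1%:Z by rewrite /K; lia.
by rewrite mem_idx_int; lia.
Qed.

Lemma spectrum_top M p : (0 < M)%N -> p \in idx M ->
  eigenvalues_are nabla (E M p M.+1%:Z) [:: (q ^+ 6 * lam q M.+1%:Z ^+ 2)%:C].
Proof.
move=> M0 pM; set K := M.+1%:Z.
have d : has_dim (E M p K) 1.
  have := E1_dimE M.+1 M0 pM; have -> : (2 * M.+1)%N%:Z - M.+1%:Z = K by rewrite /K; lia.
  by have -> : ((M.+1 < M) + (0 < M.+1 <= M) + (1 < M.+1 < M.+2))%N = 1%N by lia.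
have c0 : cc q M K = 0 by apply: cc_top.
have -> : q ^+ 6 * lam q K ^+ 2 = (q ^+ 3 * lam q K) ^+ 2 by ring.
(* Only the eta3 component survives, and c_{m+1} = 0 leaves the diagonal entry q^3 lam of L. *)
apply: (spectrum1 M0 pM (x := 0) (y := 0) (z := 1) d).
  by split; rewrite ?c0; ring.
apply: vec_neq0 => //; apply/or3P/Or33; rewrite rmorph1 oner_eq0 /=.
have -> : K - 2 = 2 * (M%:Z - 1) - M.-1%:Z by rewrite /K; lia.
by rewrite mem_idx_int; lia.
Qed.

Lemma spectrum_trivial : eigenvalues_are nabla (E 1%N 0 0) [:: (q ^+ 10)%:C].
Proof.
have M0 : (0 < 1)%N by [].
have pM : 0 \in idx 1 by [].
have d : has_dim (E 1%N 0 0) 1 by have := E1_dimE 1 M0 pM.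
have -> : q ^+ 10 = (q ^+ 5) ^+ 2 by ring.
have c0 : cc q 1 0 = 0 by apply: (cc_bottom q 1).
have e2 : 0 + 2 = 2%N%:Z :> int by lia.
have c'0 : cc q 1 (0 + 2) = 0 by rewrite e2; apply: (cc_top q 1).
have l0 : lam q 0 = 0 by rewrite /lam mulr0 oppr0 expr0z subrr mulr0.
apply: (spectrum1 M0 pM (x := 0) (y := 1) (z := 0) d).
  by split; rewrite ?c0 ?c'0 ?l0; ring.
by apply: vec_neq0 => //; apply/or3P/Or32; rewrite rmorph1 oner_eq0.
Qed.

Lemma spectrum_left M p (K := - M.-1%:Z) : (1 < M)%N -> p \in idx M ->
  eigenvalues_are nabla (E M p K)
    [:: (nu q M K)%:C; ((q ^+ 5 - q ^+ 7 * lam q K) ^+ 2)%:C].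
Proof.
move=> M1 pM; have M0 : (0 < M)%N by lia.
have d : has_dim (E M p K) 2.
  have := E1_dimE 1 M0 pM; have -> : (2 * 1)%N%:Z - M.+1%:Z = K by rewrite /K; lia.
  by rewrite M1 M0.
have KM : K \in idx M.
  have -> : K = 2 * 0 - M.-1%:Z by rewrite /K; lia.
  by rewrite mem_idx_int; lia.
have KM' : K + 2 \in idx M.
  have -> : K + 2 = 2 * 1 - M.-1%:Z by rewrite /K; lia.
  by rewrite mem_idx_int; lia.
have c0 : cc q M K = 0 by apply: cc_bottom.
have c'0 : cc q M (K + 2) != 0.
  have -> : K + 2 = (2 * 1)%N%:Z - M.-1%:Z by rewrite /K; lia.
  by apply: cc_neq0.
have lE := lam_cc hq KM; rewrite c0 expr0n sub0r in lE.
(* The direction orthogonal to the gradient, whose coordinates are (-c_{k+1}, lam, 0); it is an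
   eigenvector of L because lam = -q^2 c_{k+1}^2 here. *)
apply: (spectrum2 M0 pM (x := lam q K) (y := cc q M (K + 2)) (z := 0) d).
- split; rewrite ?c0; try by ring.
  apply/subr0_eq; have -> : - q ^+ 7 * (lam q K * lam q K + cc q M (K + 2) * cc q M (K + 2))
    - (q ^+ 5 - q ^+ 7 * lam q K) * lam q K =
    - q ^+ 5 * (lam q K + q ^+ 2 * cc q M (K + 2) ^+ 2) by ring.
  by rewrite {1}lE addNr mulr0.
- by apply: vec_neq0 => //; apply/or3P/Or32; rewrite fmorph_eq0 c'0.
- rewrite grad_vec //; apply: vec_neq0 => //; apply/or3P/Or31.
  by rewrite fmorph_eq0 oppr_eq0 c'0.
Qed.

Lemma spectrum_right M p (K := M.-1%:Z) : (1 < M)%N -> p \in idx M ->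
  eigenvalues_are nabla (E M p K)
    [:: (nu q M K)%:C; ((q ^+ 5 + q ^+ 3 * lam q K) ^+ 2)%:C].
Proof.
move=> M1 pM; have M0 : (0 < M)%N by lia.
have d : has_dim (E M p K) 2.
  have := E1_dimE M M0 pM; have -> : (2 * M)%N%:Z - M.+1%:Z = K by rewrite /K; lia.
  by have -> : ((M < M) + (0 < M <= M) + (1 < M < M.+2))%N = 2%N by lia.
have KM : K \in idx M.
  have -> : K = 2 * (M%:Z - 1) - M.-1%:Z by rewrite /K; lia.
  by rewrite mem_idx_int; lia.
have KM' : K - 2 \in idx M.
  have -> : K - 2 = 2 * (M%:Z - 2) - M.-1%:Z by rewrite /K; lia.
  by rewrite mem_idx_int; lia.
have c'0 : cc q M (K + 2) = 0.
  have -> : K + 2 = M.+1%:Z by rewrite /K; lia.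
  by apply: cc_top.
have c0 : cc q M K != 0.
  have -> : K = (2 * M.-1)%N%:Z - M.-1%:Z by rewrite /K; lia.
  by apply: cc_neq0 => //; lia.
have q0 := q_neq0 hq.
have lE := lam_cc hq KM; rewrite c'0 expr0n mulr0 subr0 in lE.
(* Again orthogonal to the gradient, now (0, lam, q c_k); the eigenvector equation uses lam =
   c_k^2. *)
apply: (spectrum2 M0 pM (x := 0) (y := - (q * cc q M K)) (z := lam q K) d).
- split; rewrite ?c'0; try by ring.
  apply/subr0_eq; have -> : q ^+ 3 * lam q K * lam q K - q ^+ 4 * cc q M K * - (q * cc q M K) -
    (q ^+ 5 + q ^+ 3 * lam q K) * lam q K = q ^+ 5 * (cc q M K ^+ 2 - lam q K) by ring.
  by rewrite lE subrr mulr0.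
- apply: vec_neq0 => //; apply/or3P/Or32.
  by rewrite fmorph_eq0 oppr_eq0 mulf_eq0 negb_or q0 c0.
- rewrite grad_vec //; apply: vec_neq0 => //; apply/or3P/Or33.
  by rewrite fmorph_eq0 mulf_eq0 negb_or q0 c0.
Qed.

Lemma spectrum_middle M p K : E1_index (M, p, K) -> - M.-1%:Z + 2 <= K <= M.-1%:Z - 2 ->
  eigenvalues_are nabla (E M p K)
    [:: (nu q M K)%:C; (mu_plus q M K ^+ 2)%:C; (mu_minus q M K ^+ 2)%:C].
Proof.
move=> hi hK; have d := (E1_dim3 hi).2 hK.
have /and3P[M0 pM hK'] := hi.
have [KM0 KM KM2 c0 c'0] := idx_interior hq hK' hK; have q0 := q_neq0 hq.
have nu0 := nu_gt0 c'0.
have rp := mu_plus_root hq nu0; have rm := mu_minus_root hq nu0.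
have ne := mu_plus_neq_minus hq nu0.
have nz mu : mu ^+ 2 - Bk q K * mu + Ck q M K = 0 ->
    vec M p K (q ^+ 7 * cc q M (K + 2) * (q ^+ 3 * lam q K - mu))%:C
      ((- q ^+ 7 * lam q K - mu) * (q ^+ 3 * lam q K - mu))%:C
      (q ^+ 4 * cc q M K * (- q ^+ 7 * lam q K - mu))%:C != 0.
  move=> chi; apply: vec_neq0 => //; rewrite !fmorph_eq0 KM0 KM2 !andbT.
  case/orP: (root_nondegenerate hq nu0 chi) => n0; apply/or3P.
    by apply/Or31/mulf_neq0 => //; rewrite mulf_neq0 ?expf_neq0.
  by apply/Or33/mulf_neq0 => //; rewrite mulf_neq0 ?expf_neq0.
apply: (spectrum3 M0 pM ne d (curl_eigen hq KM rp) (curl_eigen hq KM rm) (nz _ rp) (nz _ rm)).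
rewrite grad_vec //; apply: vec_neq0 => //; apply/or3P/Or31.
by rewrite fmorph_eq0 oppr_eq0 c'0.
Qed.

(** * Eigenvalues in degrees 0, 2, 3 and the decomposition of the 1-forms *)

Lemma spectrum_Omega0 z : eigenvalue_on nabla (Omega_ Om 0) z <->
  exists M k, [/\ (0 < M)%N, k \in idx M & z = (nu q M k)%:C].
Proof.
have [_ _ _ [free span]] := hW; split; last first.
  move=> [M [k [M0 kM ->]]]; exists (J0 (W M k k)).
    split; first by apply/Omega_0P; exists (W M k k).
    by have := nabla_W M0 kM k; rewrite /W0 kM.
  rewrite -(J0_0 Om) (inj_eq (@J0_inj _ _ _ _ _ Om hq)) W_neq0 //.
  by rewrite /W_index /= M0 kM.
move=> [v [/Omega_0P[a ->] e] nz].
have [s [c [us Ps aE]]] := span a.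
(* A nonzero eigenvector has a nonzero coefficient at some basis element; comparing coefficients
   there identifies [z] with the value of [nu] at that index. *)
have [t ts ct] : exists2 t, t \in s & c t != 0.
  apply/hasP; apply: contraNT nz => /hasPn h0.
  rewrite aE big_seq big1 ?J0_0 // => t /h0; rewrite negbK => /eqP ->.
  by rewrite scale0r.
have /andP[M0 /andP[pM kM]] := allP Ps t ts.
exists t.1.1, t.2; split=> //.
have casE u : u \in s -> J0 (c u *: W u.1.1 u.1.2 u.2) = J0 (c u *: W u.1.1 u.1.2 u.2) ->
   nabla (J0 (c u *: W u.1.1 u.1.2 u.2)) = J0 ((c u * (nu q u.1.1 u.2)%:C) *: W u.1.1 u.1.2 u.2).
  move=> us' _; have /andP[M0' /andP[pM' kM']] := allP Ps u us'.
  rewrite J0Z (linear_Z nabla_linear); have := nabla_W M0' pM' u.2; rewrite /W0 kM' => ->.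
  by rewrite scalerA J0Z.
have J0S (F : nat * int * int -> A) : J0 (\sum_(u <- s) F u) = \sum_(u <- s) J0 (F u).
  exact: (raddf_sum (incl Om)).
have sum0 : \sum_(u <- s) (c u * ((nu q u.1.1 u.2)%:C - z)) *: W u.1.1 u.1.2 u.2 = 0.
  apply: (@J0_inj _ _ _ _ _ Om hq); rewrite J0_0.
  transitivity (nabla (J0 a) - z *: J0 a); last by rewrite e subrr.
  rewrite aE !J0S (sum_of_linear nabla_linear) scaler_sumr -sumrB.
  rewrite big_seq [RHS]big_seq; apply: eq_bigr => u us'.
  by rewrite casE // -J0Z scalerA (mulrC z) -[RHS]raddfB -scalerBl mulrBr.
have /eqP := free s _ us Ps sum0 t ts.
by rewrite mulf_eq0 (negPf ct) subr_eq0 => /eqP <-.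
Qed.

Lemma J2_eq0 a b c : (J2 a b c == 0) = [&& a == 0, b == 0 & c == 0].
Proof.
apply/eqP/and3P => [e|[/eqP -> /eqP -> /eqP ->]]; last exact: J2_0.
have [|_ _ [-> -> ->] _] := @J_free _ _ _ _ _ Om hq 0 0 0 0 a b c 0; last by [].
by rewrite J0_0 J1_0 J3_0 e !addr0.
Qed.

Lemma J3_eq0 a : (J3 a == 0) = (a == 0).
Proof.
apply/eqP/eqP => [e|->]; last exact: J3_0.
have [|_ _ _ ->] := @J_free _ _ _ _ _ Om hq 0 0 0 0 0 0 0 a; last by [].
by rewrite J0_0 J1_0 J2_0 e !addr0.
Qed.

Let J2_inj a b c a' b' c' : J2 a b c = J2 a' b' c' -> [/\ a = a', b = b' & c = c'].
Proof.
move/eqP; rewrite -subr_eq0 -scaleN1r -J2Z -J2D !scaleN1r J2_eq0.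
by move=> /and3P[/eqP/subr0_eq -> /eqP/subr0_eq -> /eqP/subr0_eq ->].
Qed.

Let J3_inj a a' : J3 a = J3 a' -> a = a'.
Proof.
move/eqP; rewrite -subr_eq0 -scaleN1r -J3Z -J3D !scaleN1r J3_eq0.
by move=> /eqP/subr0_eq.
Qed.

Lemma spectrum_Omega2 z :
  eigenvalue_on nabla (Omega_ Om 2) z <-> eigenvalue_on nabla (Omega_ Om 1) z.
Proof.
split=> -[v []].
- move=> /(Omega_2P hq)[a [b [c ->]]]; rewrite nabla_J2 -J2Z J2_eq0 => /J2_inj e nz.
  exists (J1 a b c); last by rewrite J1_eq0.
  split; first by apply/Omega_1P; exists a, b, c.
  by rewrite nabla_J1 -J1Z; case: e => -> -> ->.
- move=> /Omega_1P[a [b [c ->]]]; rewrite nabla_J1 -J1Z J1_eq0 => /(J1_inj hq) e nz.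
  exists (J2 a b c); last by rewrite J2_eq0.
  split; first by apply/(Omega_2P hq); exists a, b, c.
  by rewrite nabla_J2 -J2Z; case: e => -> -> ->.
Qed.

Lemma spectrum_Omega3 z :
  eigenvalue_on nabla (Omega_ Om 3) z <-> eigenvalue_on nabla (Omega_ Om 0) z.
Proof.
have j0 a : (J0 a == 0) = (a == 0).
  by rewrite -(J0_0 Om) (inj_eq (@J0_inj _ _ _ _ _ Om hq)).
split=> -[v []].
- move=> /Omega_3P[a ->]; rewrite nabla_J3 -J3Z J3_eq0 => /J3_inj e nz.
  exists (J0 a); last by rewrite j0.
  by split; [apply/Omega_0P; exists a | rewrite nabla_J0 -J0Z e].
- move=> /Omega_0P[a ->]; rewrite nabla_J0 -J0Z j0 => /(@J0_inj _ _ _ _ _ Om hq) e nz.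
  exists (J3 a); last by rewrite J3_eq0.
  by split; [apply/Omega_3P; exists a | rewrite nabla_J3 -J3Z e].
Qed.

Lemma E1_direct_sum :
  orthogonal_direct_sum ip E1_index (fun t => E t.1.1 t.1.2 t.2) (Omega_ Om 1).
Proof.
have hfW0 M M' p p' K K' : (0 < M)%N -> (0 < M')%N -> p \in idx M -> p' \in idx M' ->
    (M, p, K) != (M', p', K') -> hf (W0 W M p K) (W0 W M' p' K') = 0.
  move=> M0 M0' pM pM' ne; rewrite /W0; case: ifP => h1; last by rewrite hform0l.
  case: ifP => h2; last by rewrite hform0r.
  by apply: W_orth => //; rewrite /W_index /= ?M0 ?pM ?M0' ?pM'.
have orth t u : E1_index t -> E1_index u -> t != u ->
    forall v w, E t.1.1 t.1.2 t.2 v -> E u.1.1 u.1.2 u.2 w -> ip v w = 0.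
  case: t u => [[M p] K] [[M' p'] K'] /and3P[M0 pM _] /and3P[M0' pM' _] ne v w.
  move=> /E1P[x [y [z ->]]] /E1P[x' [y' [z' ->]]].
  rewrite /vec ip_J1 !(hformZl, hformZr) !hfW0 ?mulr0 ?addr0 //.
  + by apply: contra ne => /eqP[-> -> /addIr ->].
  + by apply: contra ne => /eqP[-> -> /addIr ->].
have EP (t : nat * int * int) a u v : E t.1.1 t.1.2 t.2 u -> E t.1.1 t.1.2 t.2 v ->
    E t.1.1 t.1.2 t.2 (a *: u + v) by apply: lin_span_lin.
split=> //.
- by move=> t _ v /E1P[x [y [z ->]]]; apply/Omega_1P; do 3 eexists.
- move=> v /Omega_1P[a [b [c ->]]].
  pose dec := decomposable (I := (nat * int * int)%type) E1_index (fun t => E t.1.1 t.1.2 t.2).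
  have dec0 : dec 0 by apply: decomposable0 => t; apply: lin_span_0.
  have decD u w : dec u -> dec w -> dec (u + w).
    apply: decomposableD => [t|t x y ex ey]; first exact: lin_span_0.
    by rewrite -[x]scale1r; apply: EP.
  have [_ _ _ [_ span]] := hW.
  (* [sh] is the doubled shift of the column index: W_{pk} eta1, W_{pk} eta2 and W_{pk} eta3 lie in
     E_1(M,p,k-1), E_1(M,p,k) and E_1(M,p,k+1). *)
  have key (F : A -> Om) (sh : int) : linear F ->
      (forall M p k, (0 < M)%N -> p \in idx M -> k \in idx M ->
         (k + sh \in idx M.+2) /\ E M p (k + sh) (F (W M p k))) -> forall a, dec (F a).
    move=> lF hF a'; have [s [cf [us Ps ->]]] := span a'.
    rewrite (sum_of_linear lF) big_seq; elim/big_ind: _ => // t ts.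
    have /and3P[M0 pM kM] := allP Ps t ts.
    have [h1 h2] := hF _ _ _ M0 pM kM.
    apply: (decomposable1 (t := (t.1.1, t.1.2, t.2 + sh))); first by apply/and3P.
    rewrite (linear_Z lF) -[_ *: _]addr0; apply: EP => //.
    exact: lin_span_0.
  have -> : J1 a b c = J1 a 0 0 + J1 0 b 0 + J1 0 0 c.
    by rewrite -!J1D !addr0 !add0r.
  apply: (decD); first apply: (decD).
  + apply: (key (fun a => J1 a 0 0) (- 2)) => [k x y|M p k M0 pM kM].
      by rewrite -J1Z -J1D !scaler0 !addr0.
    split; first by move/idxP: kM => [j jM ->]; apply/idxP; exists j; lia.
    rewrite E1E; apply: lin_span_mem; rewrite /gens subrK /W0 kM; exact: mem_head.
  + apply: (key (fun a => J1 0 a 0) 0) => [k x y|M p k M0 pM kM].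
      by rewrite -J1Z -J1D !scaler0 !addr0.
    split; first by move/idxP: kM => [j jM ->]; apply/idxP; exists j.+1; lia.
    by rewrite E1E; apply: lin_span_mem; rewrite /gens addr0 /W0 kM !inE eqxx orbT.
  + apply: (key (fun a => J1 0 0 a) 2) => [k x y|M p k M0 pM kM].
      by rewrite -J1Z -J1D !scaler0 !addr0.
    split; first by move/idxP: kM => [j jM ->]; apply/idxP; exists j.+2; lia.
    by rewrite E1E; apply: lin_span_mem; rewrite /gens addrK /W0 kM !inE eqxx !orbT.
- move=> s e us Ps Es sum0 t ts; apply: (ip_eq0 hip).
  move/(congr1 (fun v => ip v (e t))): sum0; rewrite (ip_suml hip) (ip0l hip).
  rewrite (bigD1_seq t) //= big_seq_cond big1 ?addr0 // => u /andP[us' ut].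
  by apply: (orth u t); rewrite ?(allP Ps) //; apply: Es.
Qed.

End Laplacian.
Theorem mainTheorem10
  (R : realType) (q : R) (hq : 0 < `|q| < 1)
  (A : starAlg R[i]) (alpha gamma : A) (hA : is_SUq2 q alpha gamma)
  (T : tensorSquare A) (Delta : {lrmorphism A -> T})
  (hDelta : is_comult q alpha gamma Delta)
  (h : {scalar A}) (hh : is_haar Delta h)
  (Om : calculus3D q alpha gamma)
  (ip : Om -> Om -> R[i]) (hip : inner_product ip)
  (hleft : left_invariant h ip)
  (hon : orthonormal_basis ip (orthonormal_forms Om) (Omega_inv Om))
  (dstar : Om -> Om) (hdstar : is_adjoint ip (diff Om) dstar)
  (chi1 chi2 chi3 : {scalar A}) (hchi : generators Om Delta chi1 chi2 chi3)
  (W : nat -> int -> int -> A)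
  (hW : is_woronowicz_reps q Delta chi1 chi2 chi3 W) :
  let nabla := laplacian Om dstar in
  let E := E1 Om W in
  orthogonal_direct_sum ip E1_index (fun t => E t.1.1 t.1.2 t.2) (Omega_ Om 1)
  /\
  (forall (M : nat) (p k : int), E1_index (M, p, k) ->
     (forall v, E M p k v -> E M p k (nabla v)) /\
     (has_dim (E M p k) 1 \/ has_dim (E M p k) 2 \/ has_dim (E M p k) 3))
  /\
  (* dimension 1 *)
  (forall (M : nat) (p k : int), E1_index (M, p, k) ->
     [/\ has_dim (E M p k) 1 <->
           M = 1%N \/ k = - M.+1%:Z \/ k = M.+1%:Z,
         (1 < M)%N -> k = - M.+1%:Z ->
           eigenvalues_are nabla (E M p k) [:: (q ^+ 14 * lam q k ^+ 2)%:C] &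
         (1 < M)%N -> k = M.+1%:Z ->
           eigenvalues_are nabla (E M p k) [:: (q ^+ 6 * lam q k ^+ 2)%:C]])
  /\
  [/\ eigenvalues_are nabla (E 1%N 0 (-2))
        [:: (q ^+ 18 * (1 + q ^+ 2) ^+ 2)%:C],
      eigenvalues_are nabla (E 1%N 0 0) [:: (q ^+ 10)%:C] &
      eigenvalues_are nabla (E 1%N 0 2)
        [:: (q ^+ 2 * (1 + q ^+ 2) ^+ 2)%:C]]
  /\
  (* dimension 2 *)
  (forall (M : nat) (p k : int), E1_index (M, p, k) ->
     [/\ has_dim (E M p k) 2 <->
           (1 < M)%N /\ (k = - M.-1%:Z \/ k = M.-1%:Z),
         (1 < M)%N -> k = - M.-1%:Z ->
           eigenvalues_are nabla (E M p k)
             [:: (nu q M k)%:C; ((q ^+ 5 - q ^+ 7 * lam q k) ^+ 2)%:C] &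
         (1 < M)%N -> k = M.-1%:Z ->
           eigenvalues_are nabla (E M p k)
             [:: (nu q M k)%:C; ((q ^+ 5 + q ^+ 3 * lam q k) ^+ 2)%:C]])
  /\
  (* dimension 3 *)
  (forall (M : nat) (p k : int), E1_index (M, p, k) ->
     (has_dim (E M p k) 3 <-> (- M.-1%:Z + 2 <= k <= M.-1%:Z - 2)) /\
     ((- M.-1%:Z + 2 <= k <= M.-1%:Z - 2) ->
        eigenvalues_are nabla (E M p k)
          [:: (nu q M k)%:C; (mu_plus q M k ^+ 2)%:C;
              (mu_minus q M k ^+ 2)%:C]))
  /\
  (* degrees 0, 2 and 3 *)
  (forall (M : nat) (p k : int), W_index (M, p, k) ->
     nabla (incl Om (W M p k)) = (nu q M k)%:C *: incl Om (W M p k))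
  /\
  (forall z : R[i], eigenvalue_on nabla (Omega_ Om 0) z <->
     exists (M : nat) (k : int),
       [/\ (0 < M)%N, k \in idx M & z = (nu q M k)%:C])
  /\
  (forall z : R[i],
     eigenvalue_on nabla (Omega_ Om 2) z <-> eigenvalue_on nabla (Omega_ Om 1) z)
  /\
  (forall z : R[i],
     eigenvalue_on nabla (Omega_ Om 3) z <-> eigenvalue_on nabla (Omega_ Om 0) z).
Proof.
move=> nabla E.
have inv := E1_invariant hq hA hDelta hh hip hleft hon hdstar hchi hW.
have dims := E1_dims hq hip hleft hon hW.
have dim1 := E1_dim1 hq hip hleft hon hW.
have dim2 := E1_dim2 hq hip hleft hon hW.
have dim3 := E1_dim3 hq hip hleft hon hW.
have bottom := spectrum_bottom hq hA hDelta hh hip hleft hon hdstar hchi hW.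
have top := spectrum_top hq hA hDelta hh hip hleft hon hdstar hchi hW.
have q0 := q_neq0 hq; have q1 := one_subr_q2_neq0 hq.
split; first exact: (E1_direct_sum hq hA hDelta hh hip hleft hon hchi hW).
split; first by move=> M p k hi; split; [exact: inv | exact: dims].
split.
  move=> M p k hi; split; first exact: dim1.
    by case/and3P: hi => M0 pM _ _ ->; apply: bottom.
  by case/and3P: hi => M0 pM _ _ ->; apply: top.
split; first split.
(* For M = 1 the two outer values are instances of the general ones, with lam_{-1} = -q^2 (1 + q^2)
   and lam_1 = q^-2 (1 + q^2). *)
- have -> : q ^+ 18 * (1 + q ^+ 2) ^+ 2 = q ^+ 14 * lam q (-2) ^+ 2.
    by rewrite /lam -[q ^ _]/(q ^+ 4); field.
  exact: (bottom 1%N 0).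
- exact: (spectrum_trivial hq hA hDelta hh hip hleft hon hdstar hchi hW).
- have -> : q ^+ 2 * (1 + q ^+ 2) ^+ 2 = q ^+ 6 * lam q 2 ^+ 2.
    by rewrite /lam -[q ^ _]/(q ^- 4); field; rewrite q0 q1.
  exact: (top 1%N 0).
split.
  move=> M p k hi; split; first exact: dim2.
    case/and3P: hi => _ pM _ M1 ->.
    exact: (spectrum_left hq hA hDelta hh hip hleft hon hdstar hchi hW).
  case/and3P: hi => _ pM _ M1 ->.
  exact: (spectrum_right hq hA hDelta hh hip hleft hon hdstar hchi hW).
split.
  move=> M p k hi; split; first exact: dim3.
  exact: (spectrum_middle hq hA hDelta hh hip hleft hon hdstar hchi hW).
split.
  move=> M p k /and3P[M0 pM kM].
  have := nabla_W hq hA hDelta hh hip hleft hon hdstar hchi hW M0 pM k.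
  by rewrite /W0 kM.
split; first exact: (spectrum_Omega0 hq hA hDelta hh hip hleft hon hdstar hchi hW).
split; first exact: (spectrum_Omega2 hq hA hDelta hh hip hleft hon hdstar hchi).
exact: (spectrum_Omega3 hq hA hDelta hh hip hleft hon hdstar hchi).
Qed.
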